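(* Suppose that $0\le\alpha(t)\le\alpha^*<1$ and $|\alpha'(t)|,|\alpha''(t)|\le Q_*$ on $[0,T]$ for constants $\alpha^*,Q_*$, and that $\alpha(0)=\alpha'(0)=0$. Consider the problem $$\partial_t^2 u(\boldsymbol x,t)-K\Delta u(\boldsymbol x,t)=f(\boldsymbol x,t)+K\,(k*\Delta u)(\boldsymbol x,t),\quad (\boldsymbol x,t)\in\Omega\times(0,T],$$ $$u(\boldsymbol x,0)=u_0(\boldsymbol x),\quad \partial_t u(\boldsymbol x,0)=\hat u_0(\boldsymbol x),\ \boldsymbol x\in\Omega;\qquad u(\boldsymbol x,t)=0,\ (\boldsymbol x,t)\in\partial\Omega\times[0,T]. \qquad (P)$$ There is a constant $Q>0$, independent of $u_0,\hat u_0,f$, such that the following hold. (i) If $f\in L^2(L^2)$, $u_0\in\check H^1$ and $\hat u_0\in L^2$, then (P) has a unique solution $u\in H^1(L^2)$, and $$\|u\|_{H^1(L^2)}\le Q\big(\|u_0\|_{\check H^1}+\|\hat u_0\|_{L^2}+\|f\|_{L^2(L^2)}\big).$$ (ii) If $f\in H^1(L^2)\cap L^2(\check H^1)$, $u_0\in\check H^2$ and $\hat u_0\in\check H^1$, then $$\|u\|_{H^2(L^2)}+\|u\|_{L^2(\check H^2)}\le Q\big(\|u_0\|_{\check H^2}+\|\hat u_0\|_{\check H^1}+\|f\|_{H^1(L^2)}+\|f\|_{L^2(\check H^1)}\big).$$ (iii) If $f\in H^1(\check H^1)\cap L^2(\check H^2)$, $u_0\in\check H^3$ and $\hat u_0\in\check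 H^2$, then $$\|u\|_{H^3(L^2)}+\|u\|_{H^1(\check H^2)}\le Q\big(\|u_0\|_{\check H^3}+\|\hat u_0\|_{\check H^2}+\|f\|_{H^1(\check H^1)}+\|f\|_{L^2(\check H^2)}\big).$$ (iv) If $f\in H^2(\check H^2)\cap L^2(\check H^3)$, $u_0\in\check H^4$ and $\hat u_0\in\check H^3$, then $$\|u\|_{H^4(L^2)}+\|u\|_{H^2(\check H^2)}\le Q\big(\|u_0\|_{\check H^4}+\|\hat u_0\|_{\check H^3}+\|f\|_{H^2(\check H^2)}+\|f\|_{L^2(\check H^3)}\big).$$
   Context: $\Omega\subset\mathbb R^d$ ($1\le d\le 3$) is a simply connected bounded domain with piecewise smooth boundary $\partial\Omega$ and convex corners; $K>0$ and $T>0$ are constants. The kernel is $$k(t):=\frac{d}{dt}\left(\frac{t^{-\alpha(t)}}{\Gamma(1-\alpha(t))}\right),\quad 0<t\le T,$$ extended by continuity to $t=0$, and $*$ denotes convolution in time, $(g*h)(t)=\int_0^t g(t-s)h(s)\,ds$. Let $\{\lambda_i^2,\phi_i\}_{i\ge1}$ ($\lambda_i>0$) be the eigenpairs of $-K\Delta$ with homogeneous Dirichlet boundary conditions, where $\{\phi_i\}$ is an orthonormal basis of $L^2(\Omega)$ and $\{\lambda_i^2\}$ is positive and non-decreasing. For $s\ge0$, $$\check H^s=\check H^s(\Omega):=\Big\{q\in L^2(\Omega):\ \|q\|_{\check H^s}^2:=\sum_{i\ge1}\lambda_i^{2s}(q,\phi_i)^2<\infty\Big\},$$ with $(\cdot,\cdot)$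 the $L^2(\Omega)$ inner product; $\check H^0=L^2(\Omega)$ and $\check H^2=H^2(\Omega)\cap H_0^1(\Omega)$. For a Banach space $X$, $L^2(X)=L^2(0,T;X)$ and $H^m(X)=W^{m,2}(0,T;X)$ with standard norms; $L^2$ inside parentheses means $L^2(\Omega)$. A function $u$ is a solution of (P) if its coefficients $u_i(t)=(u(\cdot,t),\phi_i)$ satisfy, for every $i\ge1$, $u_i''+\lambda_i^2u_i=f_i-\lambda_i^2(k*u_i)$ on $(0,T]$, $u_i(0)=(u_0,\phi_i)$, $u_i'(0)=(\hat u_0,\phi_i)$, where $f_i(t)=(f(\cdot,t),\phi_i)$. *)

(* Defs.v *)
From HB Require Import structures.
From mathcomp Require Import all_boot all_order all_algebra.
From mathcomp Require Import all_classical all_reals all_analysis.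
Set Implicit Arguments. Unset Strict Implicit. Unset Printing Implicit Defensive.
Import Order.TTheory GRing.Theory Num.Theory.
Import numFieldNormedType.Exports.
Local Open Scope classical_set_scope.
Local Open Scope ring_scope.

(* The sigma-algebra on row vectors is the product sigma-algebra, as for
   tuples in the library. The measure lebesgue_rV below, an iterated product,
   is the Lebesgue measure: see its values on boxes in lebesgue_rV_box. *)

Definition measure_rV_display : measure_display -> measure_display.
Proof. exact. Qed.

Section measurable_rV.
Context (R : realType) (n : nat).

Definition rV_coord (i : 'I_n) (x : 'rV[R]_n) : R := x ord0 i.

Let rV_set0 : g_sigma_preimage rV_coord set0.
Proof. exact: sigma_algebra0. Qed.

Let rV_setC A : g_sigma_preimage rV_coord A -> g_sigma_preimage rV_coord (~` A).
Proof. exact: sigma_algebraC. Qed.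

Let rV_bigcup (F : _^nat) : (forall i, g_sigma_preimage rV_coord (F i)) ->
  g_sigma_preimage rV_coord (\bigcup_i (F i)).
Proof. exact: sigma_algebra_bigcup. Qed.

HB.instance Definition _ :=
  @isMeasurable.Build (measure_rV_display R.-ocitv.-measurable.-sigma) 'rV[R]_n
  (g_sigma_preimage rV_coord) rV_set0 rV_setC rV_bigcup.

End measurable_rV.

Lemma measurable_rV_coord (R : realType) n (i : 'I_n) :
  measurable_fun [set: 'rV[R]_n] (@rV_coord R n i).
Proof.
move=> _ Y mY; rewrite setTI; apply: sub_sigma_algebra => /=.
rewrite -bigcup_seq/=; exists i => /=; first by rewrite mem_index_enum.
by exists Y => //; rewrite setTI.
Qed.

Lemma measurable_fun_rVP (R : realType) n d (T : measurableType d)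
    (f : T -> 'rV[R]_n) :
  (forall i, measurable_fun [set: T] (@rV_coord R n i \o f)) ->
  measurable_fun [set: T] f.
Proof.
move=> mf; suff : g_sigma_preimage (fun i => @rV_coord R n i \o f) `<=` measurable.
  by rewrite g_sigma_preimage_comp => prefS _ A mA; apply: prefS; exists A.
apply: smallest_sub; first exact: sigma_algebra_measurable.
case: n => [|n] in f mf *; first by rewrite big_ord0.
rewrite -bigcup_mkord_ord; apply: bigcup_sub => i Ii.
by move=> A [B mB <-]; exact: mf.
Qed.

Section lebesgue_rV.
Context (R : realType).

Definition cons_rV n (p : R * 'rV[R]_n) : 'rV[R]_n.+1 :=
  \row_i oapp (fun j => p.2 ord0 j) p.1 (unlift ord0 i).

Lemma measurable_cons_rV n : measurable_fun setT (@cons_rV n).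
Proof.
apply: measurable_fun_rVP => i.
case: (unliftP ord0 i) => [j|] ->.
- rewrite (_ : _ \o _ = @rV_coord R n j \o snd).
    apply: measurableT_comp => //; exact: measurable_rV_coord.
  by apply/funext => p; rewrite /rV_coord /= mxE liftK.
- rewrite (_ : _ \o _ = fst); first exact: measurable_fst.
  by apply/funext => p; rewrite /rV_coord /= mxE unlift_none.
Qed.

Definition uncons_rV n (x : 'rV[R]_n.+1) : R * 'rV[R]_n :=
  (x ord0 ord0, \row_j x ord0 (lift ord0 j)).

Lemma measurable_uncons_rV n : measurable_fun setT (@uncons_rV n).
Proof.
apply: measurable_fun_pair; first exact: (@measurable_rV_coord R n.+1 ord0).
apply: measurable_fun_rVP => i.
rewrite (_ : _ \o _ = @rV_coord R n.+1 (lift ord0 i)).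
  exact: measurable_rV_coord.
by apply/funext => x; rewrite /rV_coord /= mxE.
Qed.

Lemma cons_rVK n : cancel (@cons_rV n) (@uncons_rV n).
Proof.
move=> [x y]; rewrite /cons_rV /uncons_rV mxE unlift_none; congr pair.
by apply/rowP => j; rewrite !mxE liftK.
Qed.

Section step.
Variables (n : nat) (mu : {sigma_finite_measure set 'rV[R]_n -> \bar R}).

Let prod_sigma_finite :
  sigma_finite setT (product_measure1 (@lebesgue_measure R) mu).
Proof.
have /sigma_finiteP[F [TF ndF Foo]] := sigma_finiteT (@lebesgue_measure R).
have /sigma_finiteP[G [TG ndG Goo]] := sigma_finiteT mu.
exists (fun k => F k `*` G k).
  rewrite -setXTT TF TG predeqE => -[x y]; split => [[/= [i _ Fx] [k _ Gy]]|].
    exists (maxn i k) => //; split.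
    - by move: x Fx; exact/subsetPset/ndF/leq_maxl.
    - by move: y Gy; exact/subsetPset/ndG/leq_maxr.
  by move=> [i _ []/= ? ?]; split; exists i.
move=> k; have [? ?] := Foo k; have [? ?] := Goo k.
split; first exact: measurableX.
by rewrite product_measure1E// lte_mul_pinfty// ge0_fin_numE.
Qed.

Definition cons_measure := 
  pushforward (product_measure1 (@lebesgue_measure R) mu) (@cons_rV n).

Let nu_pushforward : {measure set 'rV[R]_n.+1 -> \bar R} :=
  measure_function_pushforward__canonical__measure_function_Measure
    (product_measure1 (@lebesgue_measure R) mu) (@measurable_cons_rV n).

HB.instance Definition _ := Measure.copy cons_measure nu_pushforward.

Let cons_measure_sigma_finite : sigma_finite setT cons_measure.
Proof.
have [F FT Fmu] := prod_sigma_finite.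
exists (fun k => @uncons_rV n @^-1` F k).
  by rewrite -preimage_bigcup -FT preimage_setT.
move=> k; have [mF Foo] := Fmu k; split.
  by rewrite -[X in measurable X]setTI; exact: measurable_uncons_rV.
rewrite /cons_measure /pushforward -comp_preimage (_ : _ \o _ = id) ?preimage_id//.
by apply/funext => p; exact: cons_rVK.
Qed.

HB.instance Definition _ :=
  Measure_isSigmaFinite.Build _ _ _ cons_measure cons_measure_sigma_finite.

End step.

Fixpoint lebesgue_rV n : {sigma_finite_measure set 'rV[R]_n -> \bar R} :=
  match n with
  | 0 => dirac (0 : 'rV[R]_0)
  | m.+1 => cons_measure (lebesgue_rV m)
  end.

Lemma lebesgue_rV_box n (A : 'I_n -> set R) :
  (forall i, measurable (A i : set (measurableTypeR R))) ->
  lebesgue_rV n [set x | forall i, A i (x ord0 i)] =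
  (\prod_(i < n) lebesgue_measure (A i))%E.
Proof.
elim: n A => [|n IHn] A mA.
  rewrite big_ord0 /=; set B := (X in dirac _ X).
  by rewrite diracE (_ : B = setT) ?in_setT//; apply/seteqP; split => // x _ [].
rewrite big_ord_recl /= /cons_measure /pushforward.
rewrite (_ : _ @^-1` _ =
    A ord0 `*` [set x : 'rV[R]_n | forall j, A (lift ord0 j) (x ord0 j)]).
  rewrite product_measure1E//; first by rewrite -IHn.
  rewrite (_ : mkset _ =
      \big[setI/setT]_(j < n) (@rV_coord R n j @^-1` A (lift ord0 j))).
    apply: bigsetI_measurable => j _; rewrite -[X in measurable X]setTI.
    by apply: measurable_rV_coord => //; exact: mA.
  rewrite -bigcap_seq; apply/seteqP; split => x h.
    by move=> j _; exact: h.
  by move=> j; apply: (h j); rewrite /= mem_index_enum.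
apply/seteqP; split => [[x y] /= h|[x y] /= [Ax Ay] i].
  split; first by have := h ord0; rewrite mxE unlift_none.
  by move=> j; have := h (lift ord0 j); rewrite mxE liftK.
by case: (unliftP ord0 i) => [j|] ->; rewrite mxE ?liftK ?unlift_none/=.
Qed.

End lebesgue_rV.

Section smooth.
Context (R : realType) (V : normedModType R).

Fixpoint Ck (n : nat) (f : V -> R) : Prop :=
  continuous f /\
  match n with
  | 0 => True
  | m.+1 => forall v : V,
      (forall x, derivable f x v) /\ Ck m (fun x => 'D_v f x)
  end.

Definition smooth (f : V -> R) := forall n, Ck n f.

Definition test_function (U : set V) (psi : V -> R) :=
  smooth psi /\
  exists C : set V,
    [/\ compact C, C `<=` U & forall x, ~ C x -> psi x = 0].

(* Every loop in U is null-homotopic in U relatively to its base point. *)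
Definition loops_contract (U : set V) := forall gam : R -> V,
  {within `[0, 1], continuous gam} -> gam @` `[0, 1] `<=` U ->
  gam 0 = gam 1 ->
  exists H : R * R -> V,
    [/\ {within `[0, 1] `*` `[0, 1], continuous H},
        H @` (`[0, 1] `*` `[0, 1]) `<=` U,
        {in `[0, 1], forall s, H (0, s) = gam s},
        {in `[0, 1], forall s, H (1, s) = gam 0} &
        {in `[0, 1], forall r, H (r, 0) = gam 0 /\ H (r, 1) = gam 0}].

Definition simply_connected (U : set V) := connected U /\ loops_contract U.

(* Near each of its boundary points, Omega is a finite intersection of
   regions {g_j < 0} with g_j smooth, whose linearizations {'D_v (g_j) p < 0}
   have a common element v. The tangent cone of Omega at p is then a convex
   cone with nonempty interior: boundary points are either regular (one
   function) or convex corners and edges. *)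
Definition piecewise_smooth_convex_corners (Omega : set V) :=
  forall p, closure Omega p -> ~ Omega p ->
  exists (n : nat) (g : 'I_n -> V -> R) (v : V),
    (forall j, [/\ smooth (g j), g j p = 0 & 'D_v (g j) p < 0]) /\
    \forall x \near p, Omega x <-> (forall j, g j x < 0).

Definition admissible_domain (Omega : set V) :=
  [/\ open Omega, Omega !=set0, bounded_set Omega, simply_connected Omega &
      piecewise_smooth_convex_corners Omega].

End smooth.

Section L2_Omega.
Context (R : realType) (d : nat) (Omega : set 'rV[R]_d).
Implicit Types (q r : 'rV[R]_d -> R).

(* Elements of L^2(Omega) are represented by functions on R^d, whose values
   outside Omega are irrelevant. *)
Definition L2 q : Prop := (q \_ Omega) \in Lfun (lebesgue_rV R d) 2%:E.

Definition L2_norm q : \bar R :=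
  'N[lebesgue_rV R d]_2%:E[EFin \o (q \_ Omega)].

Definition inner q r : R := \int[lebesgue_rV R d]_(x in Omega) (q x * r x).

Definition partial (j : 'I_d) (q : 'rV[R]_d -> R) : 'rV[R]_d -> R :=
  fun x => 'D_(delta_mx ord0 j) q x.

Definition laplacian q : 'rV[R]_d -> R :=
  fun x => \sum_(j < d) partial j (partial j q) x.

(* H^1_0(Omega): the closure of the test functions in H^1(Omega); the g j are
   the weak partial derivatives of q. *)
Definition H10 q := L2 q /\
  exists (psi : nat -> 'rV[R]_d -> R) (g : 'I_d -> 'rV[R]_d -> R),
    [/\ forall n, test_function Omega (psi n),
        forall j, L2 (g j),
        L2_norm (psi n \- q) @[n --> \oo] --> 0%E &
        forall j, L2_norm (partial j (psi n) \- g j) @[n --> \oo] --> 0%E].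

(* phi is in H^1_0(Omega) and - K laplacian(phi) = mu phi in the sense of
   distributions on Omega. *)
Definition dirichlet_eigenpair (K mu : R) (phi : 'rV[R]_d -> R) :=
  H10 phi /\
  forall psi, test_function Omega psi ->
    - K * inner phi (laplacian psi) = mu * inner phi psi.

Definition orthonormal_basis (phi : nat -> 'rV[R]_d -> R) :=
  [/\ forall i, L2 (phi i),
      forall i j, inner (phi i) (phi j) = (i == j)%:R &
      forall q, L2 q ->
        L2_norm (fun x => q x - \sum_(i < n) inner q (phi i) * phi i x)
          @[n --> \oo] --> 0%E].

(* lam i and phi i stand for lambda_(i+1) and phi_(i+1). *)
Definition dirichlet_eigensystem (K : R) (lam : nat -> R)
    (phi : nat -> 'rV[R]_d -> R) :=
  [/\ forall i, 0 < lam i,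
      forall i j, (i <= j)%N -> lam i ^+ 2 <= lam j ^+ 2,
      forall i, dirichlet_eigenpair K (lam i ^+ 2) (phi i) &
      orthonormal_basis phi].

(* As for L2_norm, the value is meaningful for q in L^2(Omega), and +oo when
   q is not in the space. *)
Definition checkH_norm (lam : nat -> R) (phi : nat -> 'rV[R]_d -> R) (s : R) q
    : \bar R :=
  ((\sum_(0 <= i <oo) (lam i `^ (2 * s) * inner q (phi i) ^+ 2)%:E)
    `^ 2^-1)%E.

Definition checkH lam phi (s : R) q :=
  L2 q /\ (checkH_norm lam phi s q < +oo)%E.

End L2_Omega.

(* L2X and HmX are the spaces L^2(0,T;X) and H^m(0,T;X). X is a Hilbert space
   continuously embedded in L^2(Omega), given by its norm N, which is +oo on
   the functions of L^2(Omega) outside X. *)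

Section bochner.
Context (R : realType) (d : nat) (Omega : set 'rV[R]_d) (T : R).
Implicit Types (g h : R -> 'rV[R]_d -> R) (N : ('rV[R]_d -> R) -> \bar R).

Definition simple_L2 g :=
  exists (n : nat) (A : 'I_n -> set R) (w : 'I_n -> 'rV[R]_d -> R),
    [/\ forall j, measurable (A j : set (measurableTypeR R)),
        forall j, L2 Omega (w j) &
        forall t x, g t x = \sum_(j < n) \1_(A j) t * w j x].

(* Bochner measurability in L^2(Omega). As the measurable sets of R are the
   Borel sets, a class of functions equal almost everywhere is represented
   by one that is a limit of simple functions at every t. For the separable
   spaces X used here this entails Bochner measurability in X. *)
Definition strongly_measurable g :=
  exists s : nat -> R -> 'rV[R]_d -> R,
    (forall n, simple_L2 (s n)) /\
    forall t : R, t \in `[0, T] -> L2_norm Omega (s n t \- g t) @[n --> \oo] --> 0%E.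

Definition L2X_norm N g : \bar R :=
  ((\int[lebesgue_measure]_(t in `[0%R, T]) (N (g t) `^ 2)) `^ 2^-1)%E.

(* Finiteness of the integral forces g t to be in X for almost every t. *)
Definition L2X N g :=
  [/\ forall t : R, t \in `[0, T] -> L2 Omega (g t), strongly_measurable g &
      (L2X_norm N g < +oo)%E].

(* The equality \int g psi' = - \int h psi of Bochner integrals, tested
   against the elements of L^2(Omega). *)
Definition weak_derivative g h :=
  forall (psi : R -> R) (w : 'rV[R]_d -> R),
    test_function `]0, T[ (psi : R^o -> R) -> L2 Omega w ->
    \int[lebesgue_measure]_(t in `]0, T[) (inner Omega (g t) w * derive1 psi t) =
    - \int[lebesgue_measure]_(t in `]0, T[) (inner Omega (h t) w * psi t).

Definition Hm_derivatives (m : nat) N g (D : nat -> R -> 'rV[R]_d -> R) :=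
  [/\ D 0%N = g, forall j, (j <= m)%N -> L2X N (D j) &
      forall j, (j < m)%N -> weak_derivative (D j) (D j.+1)].

Definition HmX (m : nat) N g := exists D, Hm_derivatives m N g D.

(* All the sequences D give the same sum: weak derivatives are unique almost
   everywhere. The infimum is +oo when g is not in H^m(0,T;X). *)
Definition HmX_norm (m : nat) N g : \bar R :=
  ereal_inf [set ((\sum_(j < m.+1) (L2X_norm N (D j) `^ 2)) `^ 2^-1)%E
            | D in Hm_derivatives m N g].

End bochner.

Section problem.
Context (R : realType).

(* Derivatives relative to a set, hence one-sided at its endpoints *)
Definition derivable_on (D : set R) (f : R -> R) :=
  forall t, D t -> cvg ((f s - f t) / (s - t) @[s --> within D t^']).

Definition deriv_on (D : set R) (f : R -> R) (t : R) : R :=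
  lim ((f s - f t) / (s - t) @[s --> within D t^']).

Definition Gamma (z : R) : R :=
  \int[lebesgue_measure]_(t in `]0, +oo[) (t `^ (z - 1) * expR (- t)).

(* Extended to t = 0 by continuity (the values at t < 0 are not used) *)
Definition memory_kernel (alpha : R -> R) (T : R) (t : R) : R :=
  let k := deriv_on `]0, T] (fun s => s `^ (- alpha s) / Gamma (1 - alpha s)) in
  if 0 < t then k t else lim (k s @[s --> 0^'+]).

Definition time_convolution (g h : R -> R) (t : R) : R :=
  \int[lebesgue_measure]_(s in `[0, t]) (g (t - s) * h s).

(* As f is only square integrable in time, the second order equation for
   u_i holds almost everywhere: u_i is differentiable on [0, T], and u_i' is
   absolutely continuous, with almost everywhere derivative u_i''. *)
Definition solution (d : nat) (Omega : set 'rV[R]_d) (T : R) (k : R -> R)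
    (lam : nat -> R) (phi : nat -> 'rV[R]_d -> R)
    (u0 v0 : 'rV[R]_d -> R) (f u : R -> 'rV[R]_d -> R) :=
  forall i,
  let ui t := inner Omega (u t) (phi i) in
  let fi t := inner Omega (f t) (phi i) in
  let ui' := deriv_on `[0, T] ui in
  [/\ derivable_on `[0, T] ui,
      ui 0 = inner Omega u0 (phi i),
      ui' 0 = inner Omega v0 (phi i) &
      exists ui'' : R -> R,
      [/\ lebesgue_measure.-integrable `[0, T] (EFin \o ui''),
          forall t : R, t \in `[0, T] ->
            ui' t = ui' 0 + \int[lebesgue_measure]_(s in `[0, t]) ui'' s &
          {ae lebesgue_measure, forall t : R, t \in `]0, T] ->
            ui'' t + lam i ^+ 2 * ui t =
            fi t - lam i ^+ 2 * time_convolution k ui t}]].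

End problem.

(* Main.v *)
(* Expanding in the eigenfunctions decouples (P) into the scalar equations
   u_i'' + lam_i^2 u_i = f_i - lam_i^2 (k * u_i). Since alpha(0) = alpha'(0) = 0,
   the kernel is absolutely continuous: k(t) is the integral over [0, t] of some
   q = O(t^(-1/4)), so that k * u_i is the primitive of q * u_i. Integrating by
   parts in the variation of constants formula then removes one of the two
   factors lam_i in front of the memory term, and an exponentially weighted sup
   norm gives
     lam_i |u_i| + |u_i'| <= C (lam_i |u_i(0)| + |u_i'(0)| + ||f_i||_{L^2(0, T)})
   with C independent of i. The equation and its first two derivatives, where
   q * u_i is the primitive of u_i(0) q + q * u_i', express the further time
   derivatives of u_i at the price of one factor lam_i each. Every norm of the
   theorem is a weighted l^2 sum of such quantities; the identities of Parseval
   and Riesz-Fischer translate between functions and their coefficients. *)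

Require Import Defs.
From mathcomp Require Import all_boot all_order all_algebra.
From mathcomp Require Import all_classical all_reals all_analysis.
From mathcomp Require Import measurable_realfun ring lra.
Set Implicit Arguments. Unset Strict Implicit. Unset Printing Implicit Defensive.
Import Order.TTheory GRing.Theory Num.Theory.
Import numFieldNormedType.Exports.
Local Open Scope classical_set_scope.
Local Open Scope ring_scope.

(** * Primitives and convolutions on the line *)

(** Used as a mere forcing term, [l^2 (k * y)] would leave a factor [l] in the Gronwall rate, and
    the constant would blow up along the spectrum. The integration by parts makes it uniform; it
    rests on the vanishing of the kernel at 0 and on the integrability of [q]. Once the conditions
    at 0 have made alpha' / t and alpha / t^2 bounded, the only singular term of [q] is a multiple
    of alpha'' ln t. The power t^(-1/4) is a convenient majorant of the logarithm; any exponent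
    strictly between -1/2 and 0 would do, because the fourth derivative of [y] contains a multiple
    of [q] and must be square integrable in time. Since f_i is only square integrable, second
    derivatives exist almost everywhere: absolutely continuous functions are therefore written as a
    constant plus a primitive [prim h], and Fubini supplies the rules for their products and
    convolutions. A path in L^2(Omega) is a function of every time; it is rebuilt from its
    coefficients by choice, one time after the other, and its strong measurability is recovered from
    that of the coefficients. *)

Section lebesgue_line.
Context {R : realType}.
Notation mu := (@lebesgue_measure R).

Lemma measurable_reflect (c : R) :
  measurable_fun [set: measurableTypeR R] (fun s : measurableTypeR R => c - s : measurableTypeR R).
Proof. exact: measurable_funB. Qed.

(** Lebesgue measure is determined by half-open intervals; the reflection only moves the open end to
    the other side. *)
Lemma lebesgue_reflect (c : R) (A : set (measurableTypeR R)) : measurable A ->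
  mu A = pushforward mu (fun s : measurableTypeR R => c - s : measurableTypeR R) A.
Proof.
move=> mA.
pose nu : {measure set (measurableTypeR R) -> \bar R} :=
  measure_function_pushforward__canonical__measure_function_Measure mu (@measurable_reflect c).
apply: (@lebesgue_measure_unique R nu) => // X /ocitvP[->|[[a b] /= ab ->]].
  by rewrite !measure0.
rewrite /nu /= /pushforward.
have -> : (fun s : R => c - s) @^-1` `]a, b] = `[c - b, c - a[%classic.
  apply/seteqP; split => x /=; rewrite !in_itv/= => /andP[? ?]; apply/andP; split; lra.
rewrite !lebesgue_measure_itv /= !lte_fin ab ifT; last by lra.
by rewrite -!EFinB; congr EFin; lra.
Qed.

Lemma integral_reflect (c : R) (f : R -> \bar R) :
  measurable_fun [set: R] f ->
  (\int[mu]_x f (c - x)%R = \int[mu]_x f x)%E.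
Proof.
move=> mf.
have ge0 (g : R -> \bar R) : (forall x, 0 <= g x)%E ->
    measurable_fun [set: R] g ->
    (\int[mu]_x g (c - x)%R = \int[mu]_x g x)%E.
  move=> g0 mg.
  pose nu : {measure set (measurableTypeR R) -> \bar R} :=
    measure_function_pushforward__canonical__measure_function_Measure mu (@measurable_reflect c).
  rewrite [RHS](eq_measure_integral nu); last by move=> A mA _; exact: lebesgue_reflect.
  rewrite /nu ge0_integral_pushforward//.
  exact: measurable_reflect.
rewrite integralE [RHS]integralE; congr (_ - _)%E.
- rewrite -[RHS](ge0 f^\+%E)//; last exact: measurable_funepos.
  by apply: eq_integral => x _; rewrite !funeposE.
- rewrite -[RHS](ge0 f^\-%E)//; last exact: measurable_funeneg.
  by apply: eq_integral => x _; rewrite !funenegE.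
Qed.

(** A translation is the composition of two reflections. *)
Lemma integral_translate (c : R) (f : R -> \bar R) :
  measurable_fun [set: R] f ->
  (\int[mu]_x f (x - c)%R = \int[mu]_x f x)%E.
Proof.
move=> mf; rewrite -[RHS](integral_reflect (- c) mf).
rewrite -(integral_reflect 0).
  by apply: eq_integral => x _; congr f; lra.
apply: (measurableT_comp mf); exact: measurable_funB.
Qed.

Variables (T : R).
Implicit Types a b h : R -> R.
Implicit Types s t r c M : R.
Definition L1 a := mu.-integrable `[0, T] (EFin \o a).

Lemma L1_restrict a : L1 a -> mu.-integrable [set: R] (EFin \o (a \_ `[0, T])).
Proof.
move=> ia; rewrite -restrict_EFin; exact/(integrable_mkcond _ _).1.
Qed.

Lemma L1_measurable a : L1 a -> measurable_fun `[0, T] a.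
Proof. by move=> ia; apply/measurable_EFinP; exact: (measurable_int mu). Qed.

Lemma L1_sub a (s t : R) : L1 a -> 0 <= s -> t <= T -> mu.-integrable `[s, t] (EFin \o a).
Proof.
move=> ia s0 tT; apply: (integrableS _ _ _ ia) => //.
by apply: subset_itv; rewrite bnd_simp.
Qed.

Lemma L1_bounded a M : measurable_fun `[0, T] a ->
  (forall t, t \in `[0, T] -> `|a t| <= M) -> L1 a.
Proof.
move=> ma aM; apply: measurable_bounded_integrable => //.
  by rewrite /= lebesgue_measure_itv /=; case: ifP => // _; rewrite -EFinB ltry.
exists M; split; first exact: num_real.
by move=> x Mx t /= tT; apply: (le_trans (aM _ tT)); exact: ltW.
Qed.

(** The extensions by 0 encode the limits of integration: they vanish unless [0 <= s <= t], and for
    [t <= T] the cut at [T] removes nothing. On the whole line reflection, translation and Fubini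
    apply. *)
Lemma time_convolutionE a b t : t <= T ->
  time_convolution a b t =
  \int[mu]_s ((a \_ `[0, T]) (t - s) * (b \_ `[0, T]) s).
Proof.
move=> tT; rewrite /time_convolution Rintegral_mkcond.
apply: eq_Rintegral => s _; rewrite !patchE !mem_setE !in_itv /=.
case: ifPn => [/andP[s0 st]|].
  by rewrite !ifT //; apply/andP; split; lra.
rewrite negb_and -!ltNge => /orP[s0|ts].
  by rewrite [X in _ * X]ifF ?mulr0 // leNgt s0.
by rewrite ifF ?mul0r // leNgt; apply/negbTE; rewrite negb_and negbK; apply/orP; left; lra.
Qed.

Lemma measurable_conv_integrand a b t :
  measurable_fun `[0, T] a -> measurable_fun `[0, T] b ->
  measurable_fun [set: R] (fun s => (a \_ `[0, T]) (t - s) * (b \_ `[0, T]) s).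
Proof.
move=> ma mb; apply: measurable_funM.
  apply: (@measurableT_comp _ _ _ _ _ _ (a \_ `[0, T])).
    by apply/(measurable_restrict _ _ _).1 => //; rewrite setTI.
  exact: measurable_funB.
by apply/(measurable_restrict _ _ _).1 => //; rewrite setTI.
Qed.

Lemma time_convolutionC a b t : t <= T ->
  measurable_fun `[0, T] a -> measurable_fun `[0, T] b ->
  time_convolution a b t = time_convolution b a t.
Proof.
move=> tT ma mb; rewrite !time_convolutionE // /Rintegral.
rewrite -(integral_reflect t); last first.
  by apply/measurable_EFinP; exact: measurable_conv_integrand.
congr fine; apply: eq_integral => s _; rewrite mulrC; congr (_ * _)%:E.
by congr patch; lra.
Qed.


Lemma Rintegral_EFin (D : set R) (f : R -> R) : measurable D ->
  mu.-integrable D (EFin \o f) ->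
  (\int[mu]_(x in D) (f x)%:E = (\int[mu]_(x in D) f x)%:E)%E.
Proof. by move=> mD fi; rewrite /Rintegral fineK//; exact: integrable_fin_num. Qed.

(** The inner integrals given by Fubini may be infinite on a null set; this passes to their real
    values, which are what [Rintegral] produces. *)
Lemma integral_fine (D : set R) (f : R -> \bar R) : measurable D ->
  mu.-integrable D f ->
  mu.-integrable D (fun x => (fine (f x))%:E) /\
  (\int[mu]_(x in D) (fine (f x))%:E = \int[mu]_(x in D) f x)%E.
Proof.
move=> mD fi; have mf := measurable_int _ fi.
have mff : measurable_fun D (fun x => (fine (f x))%:E).
  by apply/measurable_EFinP; exact: (measurableT_comp (fine_measurable measurableT) mf).
split.
  apply: le_integrable fi => // x Dx; case: (f x) => [r| |] //=;
  by rewrite normr0 leey.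
apply: ae_eq_integral => //.
have := @integrable_ae _ _ _ mu D mD f fi.
by apply: filterS => x /= fx Dx; rewrite fineK// fx.
Qed.

Definition conv_plane a b (z : R * R) : R :=
  (a \_ `[0, T]) (z.1 - z.2) * (b \_ `[0, T]) z.2.

Lemma measurable_conv_plane a b : L1 a -> L1 b ->
  measurable_fun setT (conv_plane a b).
Proof.
move=> ia ib; apply: measurable_funM.
  apply: (@measurableT_comp _ _ _ _ _ _ (a \_ `[0, T])).
    by apply/(measurable_restrict _ _ _).1 => //; rewrite setTI; exact: L1_measurable.
  exact: measurable_funB.
apply: (@measurableT_comp _ _ _ _ _ _ (b \_ `[0, T])) => //.
by apply/(measurable_restrict _ _ _).1 => //; rewrite setTI; exact: L1_measurable.
Qed.

(** By Tonelli and translation invariance, the double integral of the absolute value is the product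
    of the two L^1 norms. *)
Lemma integrable_conv_plane a b : L1 a -> L1 b ->
  (mu \x mu)%E.-integrable setT (EFin \o conv_plane a b).
Proof.
move=> ia ib.
have mA : measurable_fun setT (a \_ `[0, T]).
  by apply/(measurable_restrict _ _ _).1 => //; rewrite setTI; exact: L1_measurable.
apply/integrable21ltyP.
  by apply/measurable_EFinP; exact: measurable_conv_plane.
have /integrableP[_ Aoo] := L1_restrict ia.
have /integrableP[mB Boo] := L1_restrict ib.
set CA := (\int[mu]_x `|(EFin \o a \_ `[0%R, T]) x|)%E in Aoo.
have CA0 : (0 <= CA)%E by exact: integral_ge0.
rewrite [X in (X < _)%E](_ : _ = \int[mu]_s (CA * `|(EFin \o b \_ `[0%R, T]) s|))%E; last first.
  apply: eq_integral => s _.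
  under eq_integral do rewrite /conv_plane /= normrM EFinM muleC.
  rewrite ge0_integralZl//.
  - rewrite muleC; congr (_ * _)%E.
    rewrite (integral_translate s (f := fun x => `|(a \_ `[0, T]) x|%:E))//.
    by apply/measurable_EFinP; exact: measurableT_comp.
  - apply/measurable_EFinP; apply: measurableT_comp => //.
    apply: (@measurableT_comp _ _ _ _ _ _ (a \_ `[0, T])) => //.
    exact: measurable_funB.
rewrite ge0_integralZl//; last first.
  apply: measurableT_comp => //.
rewrite lte_mul_pinfty// ge0_fin_numE//.
Qed.

Lemma L1_time_convolution a b : L1 a -> L1 b -> L1 (time_convolution a b).
Proof.
move=> ia ib; have H := integrable_conv_plane ia ib.
have := integrable_fubini_F H => /(integral_fine measurableT)[+ _] => {}H.
have : mu.-integrable `[0, T] (fun x => (fine (fubini_F mu (EFin \o conv_plane a b) x))%:E).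
  exact: integrableS H.
apply: eq_integrable => // t; rewrite inE/= in_itv/= => /andP[_ tT].
by rewrite time_convolutionE.
Qed.

Definition prim a (t : R) : R := \int[mu]_(s in `[0, t]) a s.

(** Both sides integrate [a (x - s) * b s] over the triangle [0 <= s <= x <= t]: first in [x] on the
    left, first in [s] on the right. *)
Lemma conv_prim a b t : L1 a -> L1 b -> 0 <= t <= T ->
  time_convolution (prim a) b t = prim (time_convolution a b) t.
Proof.
move=> ia ib /andP[t0 tT].
pose F (z : R * R) := \1_(`[0, t] : set R) z.1 * conv_plane a b z.
have mI : measurable_fun setT (\1_(`[0, t]%classic : set R) : R -> R).
  exact: measurable_indic.
have mF : measurable_fun setT F.
  apply: measurable_funM; last exact: measurable_conv_plane.
  by apply: (measurableT_comp mI).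
have iF : (mu \x mu)%E.-integrable setT (EFin \o F).
  apply: (le_integrable _ _ _ (integrable_conv_plane ia ib)) => //.
    exact/measurable_EFinP.
  move=> z _; rewrite /= lee_fin /F normrM ler_piMl// ger0_norm ?indicE//.
  by case: (_ \in _) => //=; rewrite ler01.
have fub := Fubini iF.
have -> : prim (time_convolution a b) t = fine (\int[mu]_x \int[mu]_y (EFin \o F) (x, y))%E.
  have /(integral_fine measurableT)[_ <-] := integrable_fubini_F iF.
  clear iF fub mF.
  rewrite /prim Rintegral_mkcond; congr fine.
  apply: eq_integral => r _; rewrite /fubini_F patchE mem_setE in_itv/=.
  congr (_%:E); case: ifPn => [/andP[r0 rt]|rt].
    rewrite time_convolutionE ?(le_trans rt)//; congr fine.
    apply: eq_integral => s _; rewrite /F/= indicE mem_setE in_itv/= r0 rt mul1r.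
    by rewrite /conv_plane.
  rewrite (eq_integral (cst 0%E)) ?integral0// => s _.
  by rewrite /F/= indicE mem_setE in_itv/= (negbTE rt) mul0r.
rewrite {}fub /time_convolution Rintegral_mkcond; congr fine.
clear iF mF.
apply: eq_integral => s _.
(* The indicator is written at [x - s + s] so that the whole integrand is a function of [x - s],
   ready for the translation by [s]. *)
have -> : (\int[mu]_x (EFin \o F) (x, s))%E =
   (\int[mu]_x (((b \_ `[0%R, T]) s)%:E * ((\1_(`[0, t] : set R) (x - s + s)%R *
        (a \_ `[0%R, T]) (x - s)%R))%:E))%E.
  apply: eq_integral => x _.
  by rewrite /F /conv_plane /= -EFinM subrK; congr EFin; ring.
have mg : measurable_fun setT (fun x : R =>
    ((b \_ `[0, T]) s)%:E * (\1_(`[0, t] : set R) (x + s) * (a \_ `[0, T]) x)%:E)%E.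
  apply: measurable_funeM; apply/measurable_EFinP; apply: measurable_funM.
    by apply: (measurableT_comp mI); exact: measurable_funD.
  by apply/(measurable_restrict _ _ _).1 => //; rewrite setTI; exact: L1_measurable.
rewrite (integral_translate s mg).
rewrite patchE mem_setE in_itv/=.
have sT : (0 <= s <= t) -> (0 <= s <= T).
  by move=> /andP[-> st]; rewrite (le_trans st tT).
case: ifPn => st.
  have -> : (b \_ `[0, T]) s = b s by rewrite patchE mem_setE in_itv/= sT.
  rewrite [RHS](_ : _ = \int[mu]_x ((b s)%:E * (EFin \o (a \_ `[0%R, (t - s)%R])) x))%E; last first.
    apply: eq_integral => x _ /=; rewrite indicE mem_setE !patchE !mem_setE !in_itv/=.
    congr (_ * _%:E)%E.
    case: ifPn => [/andP[x0 xT]|nx].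
      have -> : (0 <= x <= t - s) = (0 <= x + s <= t).
        by move: st => /andP[s0 st]; apply/idP/idP => /andP[? ?]; apply/andP; split; lra.
      by case: ifP; rewrite ?mul1r ?mul0r.
    rewrite mulr0 ifF//; apply: contraNF nx => /andP[-> ?]/=.
    by move: st => /andP[s0 st]; lra.
  rewrite integralZl//; last first.
    rewrite -restrict_EFin; apply/(integrable_mkcond _ _).1 => //.
    by apply: (L1_sub ia) => //; move: st => /andP[s0 st]; lra.
  rewrite Rintegral_EFin//; last first.
    rewrite -restrict_EFin; apply/(integrable_mkcond _ _).1 => //.
    by apply: (L1_sub ia) => //; move: st => /andP[s0 st]; lra.
  by rewrite -Rintegral_mkcond -EFinM mulrC.
rewrite (eq_integral (cst 0%E)) ?integral0// => x _.
rewrite indicE mem_setE !patchE !mem_setE !in_itv/=.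
case: ifPn => [/andP[s0 sT']|]; last by rewrite mul0e.
rewrite s0/= -ltNge in st.
case: ifPn => [/andP[x0 xT]|nx]; last by rewrite mulr0 mule0.
rewrite [(_ <= _ <= _)](_ : _ = false) ?mul0r ?mule0//.
by apply/negbTE; rewrite negb_and -!ltNge; apply/orP; right; lra.
Qed.

Lemma EFin_prim a t : L1 a -> t <= T ->
  (\int[mu]_(s in `[0%R, t]) (a s)%:E = (prim a t)%:E)%E.
Proof. by move=> ia tT; rewrite Rintegral_EFin//; exact: L1_sub. Qed.

Lemma eq_prim a b t : (forall s, 0 <= s <= t -> a s = b s) -> prim a t = prim b t.
Proof.
by move=> ab; apply: eq_Rintegral => s; rewrite inE /= in_itv/=; exact: ab.
Qed.

Lemma primD a b t : L1 a -> L1 b -> t <= T ->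
  prim (fun s => a s + b s) t = prim a t + prim b t.
Proof. by move=> ia ib tT; rewrite /prim RintegralD//; exact: L1_sub. Qed.

Lemma primB a b t : L1 a -> L1 b -> t <= T ->
  prim (fun s => a s - b s) t = prim a t - prim b t.
Proof. by move=> ia ib tT; rewrite /prim RintegralB//; exact: L1_sub. Qed.

Lemma primZ c a t : L1 a -> t <= T -> prim (fun s => c * a s) t = c * prim a t.
Proof. by move=> ia tT; rewrite /prim RintegralZl//; exact: L1_sub. Qed.

Lemma prim_cst (c t : R) : 0 <= t -> prim (cst c) t = c * t.
Proof.
move=> t0; rewrite /prim Rintegral_cst//= lebesgue_measure_itv/= lte_fin.
by case: ltP => [t1|t1]; rewrite /= ?subr0// (_ : t = 0) ?mulr0//; apply/le_anti/andP.
Qed.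

Lemma prim0 a : prim a 0 = 0.
Proof. by rewrite /prim set_itv1 Rintegral_set1. Qed.

Lemma L1D a b : L1 a -> L1 b -> L1 (fun s => a s + b s).
Proof. by move=> ia ib; exact: (integrableD _ ia ib). Qed.

Lemma L1B a b : L1 a -> L1 b -> L1 (fun s => a s - b s).
Proof. by move=> ia ib; exact: (integrableB _ ia ib). Qed.

Lemma L1Z c a : L1 a -> L1 (fun s => c * a s).
Proof. by move=> ia; exact: (integrableZl _ c ia). Qed.

Lemma L1_norm a : L1 a -> L1 (fun s => `|a s|).
Proof.
move=> ia; apply: (le_integrable _ _ _ ia) => //.
  by apply/measurable_EFinP; apply: measurableT_comp => //; exact: L1_measurable.
by move=> x _ /=; rewrite normr_id.
Qed.

Lemma le_prim a b t : L1 a -> L1 b -> t <= T ->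
  (forall s, 0 <= s <= t -> a s <= b s) -> prim a t <= prim b t.
Proof.
move=> ia ib tT ab; apply: le_Rintegral => //; exact: L1_sub.
Qed.

Lemma normr_prim a t : L1 a -> t <= T -> `|prim a t| <= prim (fun s => `|a s|) t.
Proof. by move=> ia tT; apply: le_normr_Rintegral => //; exact: L1_sub. Qed.

Lemma prim_ge0 a t : (forall s, 0 <= s <= t -> 0 <= a s) -> 0 <= prim a t.
Proof. by move=> a0; apply: Rintegral_ge0 => s /=; rewrite in_itv/=; exact: a0. Qed.

Lemma prim_mono a s t : L1 a -> (forall r, 0 <= r <= T -> 0 <= a r) ->
  0 <= s <= t -> t <= T -> prim a s <= prim a t.
Proof.
move=> ia a0 /andP[s0 st] tT; rewrite -lee_fin -!EFin_prim ?(le_trans st)//.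
apply: ge0_subset_integral => //=.
- by apply: (measurable_int mu); exact: (L1_sub ia).
- by move=> r /=; rewrite in_itv/= lee_fin => /andP[r0 rt]; rewrite a0// r0 (le_trans rt).
- by apply: subset_itv; rewrite bnd_simp.
Qed.

Lemma L1_mulbounded a b M : L1 a -> measurable_fun `[0, T] b ->
  (forall t, t \in `[0, T] -> `|b t| <= M) -> L1 (fun s => a s * b s).
Proof.
move=> ia mb bM; apply: (integrableMl _ ia mb) => //; exists M; split; first exact: num_real.
by move=> x Mx t /= tT; apply: (le_trans (bM _ tT)); exact: ltW.
Qed.

Lemma prim_continuous a : 0 <= T -> L1 a -> {within `[0, T], continuous (prim a)}.
Proof. by move=> T0 ia; exact: parameterized_integral_continuous. Qed.

Lemma prim_measurable a : 0 <= T -> L1 a -> measurable_fun `[0, T] (prim a).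
Proof.
move=> T0 ia; apply: subspace_continuous_measurable_fun => //.
exact: prim_continuous.
Qed.

Lemma prim_bounded a t : L1 a -> t \in `[0, T] -> `|prim a t| <= prim (fun s => `|a s|) T.
Proof.
move=> ia; rewrite in_itv/= => /andP[t0 tT].
apply: (le_trans (normr_prim ia tT)); apply: prim_mono => //; last by rewrite t0.
exact: L1_norm.
Qed.

Lemma L1_prim a : 0 <= T -> L1 a -> L1 (prim a).
Proof.
move=> T0 ia; apply: L1_bounded; first exact: prim_measurable.
by move=> t; exact: prim_bounded.
Qed.

End lebesgue_line.

Section primitives.
Context {R : realType}.
Notation mu := (@lebesgue_measure R).
Variables (T : R).
Implicit Types a b h : R -> R.
Implicit Types s t r c M : R.

Notation L1 := (L1 T).

(** Integration by parts for integrable derivatives, by Fubini on the triangle [y <= x]: one order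
    of integration gives the first summand, the other gives [prim a t * prim b t] minus the
    second. *)
Lemma prim_prod a b t : L1 a -> L1 b -> 0 <= t <= T ->
  prim a t * prim b t = prim (fun s => a s * prim b s + prim a s * b s) t.
Proof.
move=> ia ib /andP[t0 tT]; have T0 := le_trans t0 tT.
have iaB : L1 (fun s => a s * prim b s).
  apply: (L1_mulbounded ia); first exact: prim_measurable.
  by move=> s; exact: prim_bounded.
have ibA : L1 (fun s => prim a s * b s).
  rewrite [X in L1 X](_ : _ = fun s => b s * prim a s); last by apply/funext => s; rewrite mulrC.
  apply: (L1_mulbounded ib); first exact: prim_measurable.
  by move=> s; exact: prim_bounded.
rewrite (primD iaB ibA tT).
pose A := a \_ `[0, t]; pose B := b \_ `[0, t].
have iA : mu.-integrable setT (EFin \o A).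
  by rewrite -restrict_EFin; apply/(integrable_mkcond _ _).1 => //; exact: (L1_sub ia).
have iB : mu.-integrable setT (EFin \o B).
  by rewrite -restrict_EFin; apply/(integrable_mkcond _ _).1 => //; exact: (L1_sub ib).
have mA : measurable_fun setT A by apply/measurable_EFinP; exact: (measurable_int mu).
have mB : measurable_fun setT B by apply/measurable_EFinP; exact: (measurable_int mu).
pose F (z : R * R) := if z.2 <= z.1 then A z.1 * B z.2 else 0.
have mF : measurable_fun setT F.
  apply: measurable_fun_ifT => //.
    exact: measurable_fun_ler.
  by apply: measurable_funM; [exact: (measurableT_comp mA)|exact: (measurableT_comp mB)].
have iF : (mu \x mu)%E.-integrable setT (EFin \o F).
  apply/integrable12ltyP; first exact/measurable_EFinP.
  have /integrableP[_ Aoo] := iA; have /integrableP[_ Boo] := iB.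
  set CB := (\int[mu]_x `|(EFin \o B) x|)%E in Boo.
  have CB0 : (0 <= CB)%E by exact: integral_ge0.
  apply: (@le_lt_trans _ _ (\int[mu]_x (CB * `|(EFin \o A) x|))%E); last first.
    rewrite ge0_integralZl//; last first.
      by apply: measurableT_comp => //; exact/measurable_EFinP.
    by rewrite lte_mul_pinfty// ge0_fin_numE.
  apply: ge0_le_integral => //.
  - by move=> x _; exact: integral_ge0.
  - apply: (@measurable_fun_fubini_tonelli_F _ _ _ _ R mu (fun z => `|(EFin \o F) z|%E)) => //.
    by apply: measurableT_comp => //; exact/measurable_EFinP.
  - by apply: measurable_funeM; apply: measurableT_comp => //; exact/measurable_EFinP.
  move=> x _; rewrite muleC -ge0_integralZl//; last first.
    by apply: measurableT_comp => //; exact/measurable_EFinP.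
  apply: ge0_le_integral => //.
  - apply: measurableT_comp => //; apply/measurable_EFinP.
    by apply: (measurableT_comp mF); exact: measurable_fun_pair.
  - by apply: measurable_funeM; apply: measurableT_comp => //; exact/measurable_EFinP.
  move=> y _; rewrite /= -EFinM lee_fin /F /=; case: ifP => _; first by rewrite normrM.
  by rewrite normr0 mulr_ge0.
have := Fubini iF; clear iF mF.
have -> : (\int[mu]_x \int[mu]_y (EFin \o F) (x, y))%E = (prim (fun s => a s * prim b s) t)%:E.
  rewrite -(EFin_prim iaB tT) [RHS]integral_mkcond; apply: eq_integral => s _.
  rewrite patchE mem_setE in_itv/=; case: ifPn => [/andP[s0 st]|st].
    have As : A s = a s by rewrite /A patchE mem_setE in_itv/= s0 st.
    transitivity (\int[mu]_y ((a s)%:E * ((EFin \o (b \_ `[0%R, s%R : R])) y)))%E.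
      apply: eq_integral => y _; rewrite /F/= As /B -EFinM !patchE !mem_setE !in_itv/=.
      case: (leP y s) => ys; last by rewrite andbF mulr0.
      by rewrite (le_trans ys st) andbT.
    rewrite integralZl//; last first.
      rewrite -restrict_EFin; apply/(integrable_mkcond _ _).1 => //.
      by apply: (L1_sub ib) => //; exact: le_trans tT.
    rewrite Rintegral_EFin//; last first.
      rewrite -restrict_EFin; apply/(integrable_mkcond _ _).1 => //.
      by apply: (L1_sub ib) => //; exact: le_trans tT.
    by rewrite -Rintegral_mkcond -EFinM.
  rewrite (eq_integral (cst 0%E)) ?integral0// => y _.
  rewrite /F/= /A patchE mem_setE in_itv/= (negbTE st) mul0r; by case: ifP.
have -> : (\int[mu]_y \int[mu]_x (EFin \o F) (x, y))%E =
    (prim (fun s => prim a t * b s - prim a s * b s) t)%:E.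
  rewrite -(@EFin_prim _ T _ t _ tT); last by apply: L1B => //; exact: L1Z.
  rewrite [RHS]integral_mkcond; apply: eq_integral => s _.
  rewrite patchE mem_setE in_itv/=; case: ifPn => [/andP[s0 st]|st].
    have Bs : B s = b s by rewrite /B patchE mem_setE in_itv/= s0 st.
    transitivity (\int[mu]_y ((b s)%:E * ((EFin \o (a \_ `[(s : R), t])) y)))%E.
      apply: eq_integral => y _; rewrite /F/= Bs /A -EFinM !patchE !mem_setE !in_itv/=.
      case: (leP s y) => sy; last by rewrite mulr0.
      by rewrite (le_trans s0 sy)/= mulrC.
    rewrite integralZl//; last first.
      rewrite -restrict_EFin; apply/(integrable_mkcond _ _).1 => //.
      by apply: (L1_sub ia).
    rewrite Rintegral_EFin//; last first.
      rewrite -restrict_EFin; apply/(integrable_mkcond _ _).1 => //.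
      by apply: (L1_sub ia).
    rewrite -Rintegral_mkcond -EFinM -mulrBl mulrC; congr (_ * _)%:E.
    rewrite /prim (@Rintegral_itvB _ _ (BLeft 0) (BRight t) s) ?bnd_simp//; last exact: (L1_sub ia).
    apply/esym/Rintegral_itv_obnd_cbnd; apply: (integrableS _ _ _ (L1_sub ia s0 tT)) => //.
    exact: subset_itv_oc_cc.
  rewrite (eq_integral (cst 0%E)) ?integral0// => y _.
  by rewrite /F/= /B patchE mem_setE in_itv/= (negbTE st) mulr0; case: ifP.
move=> -[->].
by rewrite (primB (L1Z _ ib) ibA tT) (primZ _ ib tT) subrK.
Qed.

Lemma integrable_reflect t (f : R -> R) : mu.-integrable setT (EFin \o f) ->
  mu.-integrable setT (EFin \o (fun s => f (t - s))).
Proof.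
move=> /integrableP[mf foo]; apply/integrableP; split.
  have /measurable_EFinP mf' := mf; apply/measurable_EFinP.
  by apply: (measurableT_comp mf'); exact: measurable_funB.
rewrite (integral_reflect t (f := fun s => `|(f s)%:E|%E))//.
exact: measurableT_comp.
Qed.

Lemma integrable_conv_integrand a b M t : L1 a -> measurable_fun `[0, T] b ->
  (forall s, s \in `[0, T] -> `|b s| <= M) ->
  mu.-integrable setT (EFin \o (fun s => (a \_ `[0, T]) (t - s) * (b \_ `[0, T]) s)).
Proof.
move=> ia mb bM.
apply: (@integrableMl _ _ _ mu setT measurableT
  (EFin \o (fun s => (a \_ `[0, T]) (t - s))) (b \_ `[0, T])).
- by apply: (@integrable_reflect t (a \_ `[0, T])); exact: L1_restrict.
- by apply/(measurable_restrict _ _ _).1 => //; rewrite setTI.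
exists `|M|; split; first exact: num_real.
move=> x Mx s _ /=; rewrite patchE; case: ifPn => [|_].
  by rewrite inE/= => sT; rewrite (le_trans (bM _ sT))// (le_trans (ler_norm _))// ltW.
by rewrite normr0 (le_trans _ (ltW Mx)).
Qed.

Lemma time_convolution_lin a b h c M t : t <= T -> L1 a ->
  measurable_fun `[0, T] b -> measurable_fun `[0, T] h ->
  (forall s, s \in `[0, T] -> `|b s| <= M) ->
  (forall s, s \in `[0, T] -> `|h s| <= M) ->
  time_convolution a (fun s => c * b s + h s) t =
  c * time_convolution a b t + time_convolution a h t.
Proof.
move=> tT ia mb mh bM hM; rewrite !(time_convolutionE _ _ tT).
have ib := integrable_conv_integrand t ia mb bM.
have ih := integrable_conv_integrand t ia mh hM.
rewrite -RintegralZl// -RintegralD//; last exact: (integrableZl _ c ib).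
apply: eq_Rintegral => s _; set x := (a \_ _) _; rewrite !patchE.
by case: ifP => _; rewrite /point/=; ring.
Qed.

Lemma eq_time_convolution a b h t : (forall s, 0 <= s <= t -> b s = h s) ->
  time_convolution a b t = time_convolution a h t.
Proof.
by move=> bh; apply: eq_Rintegral => s; rewrite inE/= in_itv/= => st; rewrite bh.
Qed.

(** The weight is nondecreasing, so inside the convolution [expR (c * s)] is at most [expR (c * t)];
    what remains is the L^1 norm of the reflected [a]. The case [c = 0] is the plain sup bound. *)
Lemma time_convolution_bound a b M c t : 0 <= c -> 0 <= t <= T -> L1 a ->
  measurable_fun `[0, T] b ->
  (forall s, s \in `[0, T] -> `|b s| <= M * expR (c * s)) ->
  `|time_convolution a b t| <= M * expR (c * t) * prim (fun s => `|a s|) T.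
Proof.
move=> c0 /andP[t0 tT] ia mb bM.
have T0 : 0 <= T by exact: le_trans tT.
have M0 : 0 <= M.
  by have := bM 0; rewrite in_itv/= lexx T0 mulr0 expR0 mulr1 => /(_ isT); exact: le_trans.
have bM' s : s \in `[0, T] -> `|b s| <= M * expR (c * T).
  move=> sT; rewrite (le_trans (bM _ sT))// ler_wpM2l// ler_expR ler_wpM2l//.
  by move: sT; rewrite in_itv/= => /andP[].
rewrite (time_convolutionE _ _ tT).
have ii := integrable_conv_integrand t ia mb bM'.
have iA := @integrable_reflect t _ (L1_restrict (L1_norm ia)).
apply: (le_trans (le_normr_Rintegral _ ii)) => //.
have -> : prim (fun s => `|a s|) T = \int[mu]_s ((fun s => `|a s|) \_ `[0, T]) (t - s).
  rewrite /Rintegral (integral_reflect t (f := EFin \o (fun s => `|a s|) \_ `[0, T])).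
    by rewrite /prim Rintegral_mkcond.
  by apply: (measurable_int mu); exact: (L1_restrict (L1_norm ia)).
rewrite -RintegralZl//; apply: le_Rintegral => //.
- apply: (le_integrable _ _ _ ii) => //; last by move=> x _; rewrite /= normr_id.
  by apply/measurable_EFinP; apply: measurableT_comp => //; apply/measurable_EFinP;
    exact: (measurable_int mu).
- exact: (integrableZl _ _ iA).
move=> s _; rewrite normrM !patchE; case: ifPn => [ts|_]; last by rewrite normr0 !mul0r mulr0.
rewrite mulrC ler_wpM2r//; case: ifPn => [sT|_].
  move: ts sT; rewrite !inE/= => ts sT; rewrite (le_trans (bM _ sT))// ler_wpM2l//.
  by rewrite ler_expR ler_wpM2l//; move: ts; rewrite in_itv/= subr_ge0 => /andP[].
by rewrite normr0 mulr_ge0// expR_ge0.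
Qed.


Lemma prim_FTC (f F : R -> R) t : 0 <= t ->
  {within `[0, t], continuous f} -> {within `[0, t], continuous F} ->
  (forall x, x \in `]0, t[ -> is_derive x 1 F (f x)) ->
  prim f t = F t - F 0.
Proof.
rewrite le_eqVlt => /predU1P[<- _ _ _|t0 coef cF dF]; first by rewrite prim0 subrr.
have [cF1 cF2 cF3] := (continuous_within_itvP F t0).1 cF.
rewrite /prim /Rintegral (@continuous_FTC2 R f F 0 t t0)//.
- split => // x xt; have Fx := dF x xt; exact: ex_derive.
- by move=> x xt; have Fx := dF x xt; rewrite derive1E; exact: derive_val.
Qed.

(** The factor [c^-1] is what weighted norms gain: a large rate makes an integral operator small
    without restricting the length of the time interval. *)
Lemma prim_expR c t : 0 < c -> 0 <= t -> prim (fun s => expR (c * s)) t <= expR (c * t) / c.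
Proof.
move=> c0 t0.
have dF (x : R) : is_derive x 1 (fun s => expR (c * s) / c) (expR (c * x)).
  apply: is_derive_eq.
  by rewrite /GRing.scale /=; field; rewrite gt_eqF.
have cF (x : R) : {for x, continuous (fun s => expR (c * s))}.
  by apply: continuous_comp; [exact: mulrl_continuous|exact: continuous_expR].
rewrite (@prim_FTC _ (fun s => expR (c * s) / c))//.
- by rewrite lerBlDr lerDl divr_ge0 ?expR_ge0 ?ltW.
- by apply: continuous_subspaceT => x; exact: cF.
- apply: continuous_subspaceT => x; apply: differentiable_continuous.
  by apply/derivable1_diffP; apply: ex_derive.
Qed.

Lemma prim_lipschitz (g : R -> R) c s t : 0 <= s <= t -> t <= T -> L1 g ->
  (forall r, s <= r <= t -> `|g r| <= c) -> `|prim g t - prim g s| <= c * (t - s).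
Proof.
move=> /andP[s0 st] tT ig gc.
rewrite /prim (@Rintegral_itvB _ _ (BLeft 0) (BRight t) s) ?bnd_simp//; last exact: (L1_sub ig).
have ist : mu.-integrable `]s, t] (EFin \o g).
  by apply: (integrableS _ _ _ (L1_sub ig s0 tT)) => //; exact: subset_itv_oc_cc.
apply: (le_trans (le_normr_Rintegral _ ist)) => //.
have -> : c * (t - s) = \int[mu]_(r in `]s, t]) c.
  rewrite Rintegral_cst//= lebesgue_measure_itv/= lte_fin.
  case: ltP => // ts; rewrite /= (_ : t = s) ?subrr//; apply/le_anti/andP; by split.
apply: le_Rintegral => //.
- apply: (le_integrable _ _ _ ist) => //; last by move=> x _; rewrite /= normr_id.
  by apply/measurable_EFinP; apply: measurableT_comp => //; apply/measurable_EFinP;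
    exact: (measurable_int mu).
- apply: measurable_bounded_integrable => //=.
    by rewrite lebesgue_measure_itv/=; case: ifP => // _; rewrite -EFinB ltry.
  by exists `|c|; split; [exact: num_real|move=> x cx ? _; exact: ltW].
by move=> r /=; rewrite in_itv/= => /andP[sr rt]; rewrite gc// (ltW sr).
Qed.

End primitives.

(** * Derivatives relative to a closed interval *)

Section one_sided_derivative.
Context {R : realType}.
Notation mu := (@lebesgue_measure R).
Variables (T : R) (T0 : 0 < T).
Implicit Types y h : R -> R.
Implicit Types s t r c M : R.


Lemma within_dnbhsP (D P : set R) t : within D t^' P <->
  exists2 d : R, 0 < d & forall s, `|s - t| < d -> s != t -> D s -> P s.
Proof.
split.
  move=> /nbhs_ballP[d /= d0 dP]; exists d => // s std st Ds.
  by apply: dP => //; rewrite /ball/= distrC.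
move=> [d d0 dP]; apply/nbhs_ballP; exists d => //= s ts st Ds.
by apply: dP => //; move: ts; rewrite /ball/= distrC.
Qed.

Lemma within_nbhsP (D P : set R) t : within D (nbhs t) P <->
  exists2 d : R, 0 < d & forall s, `|s - t| < d -> D s -> P s.
Proof.
split.
  move=> /nbhs_ballP[d /= d0 dP]; exists d => // s std Ds.
  by apply: dP => //; rewrite /ball/= distrC.
move=> [d d0 dP]; apply/nbhs_ballP; exists d => //= s ts Ds.
by apply: dP => //; move: ts; rewrite /ball/= distrC.
Qed.

(** [deriv_on] is a [lim], and limits are unique only along a proper filter. Points near [t] are
    found on its right in the left half of the interval and on its left in the right half. *)
Let proper_within t : t \in `[0, T] -> ProperFilter (within `[0, T] t^').
Proof.
rewrite in_itv/= => /andP[t0 tT]; apply: Build_ProperFilter_ex => B.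
move=> /within_dnbhsP[d d0 dB].
pose m := Num.min (d / 2) (T / 2).
have m0 : 0 < m by rewrite lt_min !divr_gt0.
have md : m < d by rewrite gt_min; apply/orP; left; lra.
have mT : m <= T / 2 by rewrite ge_min lexx orbT.
have [t2|t2] := leP t (T / 2).
  exists (t + m); apply: dB; rewrite /= ?in_itv/=; last by apply/andP; split; lra.
    by rewrite addrC addKr gtr0_norm.
  by apply/eqP; lra.
exists (t - m); apply: dB; rewrite /= ?in_itv/=; last by apply/andP; split; lra.
  by rewrite addrC addKr normrN gtr0_norm.
by apply/eqP; lra.
Qed.

Lemma deriv_onE y t l : t \in `[0, T] ->
  ((y s - y t) / (s - t) @[s --> within `[0, T] t^'] --> l) -> deriv_on `[0, T] y t = l.
Proof. by move=> tT; have := proper_within tT => PF; exact: cvg_lim. Qed.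

Lemma derivable_onP y t : derivable_on `[0, T] y -> t \in `[0, T] ->
  (y s - y t) / (s - t) @[s --> within `[0, T] t^'] --> deriv_on `[0, T] y t.
Proof. by move=> + tT => /(_ t tT). Qed.

Lemma derivable_on_interior y t : derivable_on `[0, T] y -> t \in `]0, T[ ->
  is_derive t 1 y (deriv_on `[0, T] y t).
Proof.
move=> dy tT; have tT' := subset_itv_oo_cc tT.
have := derivable_onP dy tT'; set l := deriv_on _ _ _ => H.
have Hl : h^-1 *: (y (h *: 1 + t) - y t) @[h --> 0^'] --> l.
  apply/cvgrPdist_lt => e e0.
  have /cvgrPdist_lt/(_ e e0)/within_dnbhsP[d d0 dP] := H.
  move: tT; rewrite in_itv/= => /andP[t0 tT].
  pose m := Num.min d (Num.min t (T - t)).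
  have m0 : 0 < m by rewrite !lt_min d0 t0/= subr_gt0.
  near=> h.
  have hm : `|h| < m by near: h; exact: dnbhs0_lt.
  have h0 : h != 0 by near: h; exact: nbhs_dnbhs_neq.
  move: hm; rewrite !lt_min => /and3P[hd ht hT].
  have := dP (h + t); rewrite addrK => /(_ hd) /=.
  have -> : h%:A = h :> R by rewrite /GRing.scale/= mulr1.
  rewrite [_ *: _]mulrC; apply.
    by rewrite -subr_eq0 addrK.
  by rewrite in_itv/=; move: ht hT; rewrite !ltr_norml => /andP[? ?] /andP[? ?]; apply/andP; split; lra.
apply: DeriveDef; first by apply/cvg_ex; exists l.
exact/cvg_lim.
Unshelve. all: by end_near. Qed.

Lemma derivable_on_continuous y : derivable_on `[0, T] y -> {within `[0, T], continuous y}.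
Proof.
move=> dy; apply/subspace_continuousP => t tT.
have := derivable_onP dy tT; set l := deriv_on _ _ _ => H.
apply/cvgrPdist_lt => e e0.
have /cvgrPdist_lt/(_ 1 ltr01)/within_dnbhsP[d d0 dP] := H.
pose m := Num.min d (e / (1 + `|l|)).
have l1 : 0 < 1 + `|l| by rewrite ltr_pwDl.
have m0 : 0 < m by rewrite lt_min d0 divr_gt0.
apply/within_nbhsP; exists m => // s stm sT.
have [->|st] := eqVneq s t; first by rewrite subrr normr0.
move: stm; rewrite lt_min => /andP[sd se].
have /= := dP s sd st sT.
have st0 : s - t != 0 by rewrite subr_eq0.
have -> : l - (y s - y t) / (s - t) = (l * (s - t) - (y s - y t)) / (s - t) by field.
rewrite normrM normfV ltr_pdivrMr ?normr_gt0// mul1r => H1.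
rewrite distrC; apply: (@le_lt_trans _ _ ((1 + `|l|) * `|s - t|)).
  rewrite mulrDl mul1r -normrM.
  rewrite (_ : y s - y t = (y s - y t - l * (s - t)) + l * (s - t)); last by ring.
  by rewrite (le_trans (ler_normD _ _))// lerD2r distrC ltW.
by rewrite mulrC -ltr_pdivlMr.
Qed.

(** The error of the difference quotient is the mean of [h r - h t] between [t] and [s], hence at
    most the oscillation of [h] near [t]; this includes the endpoints. *)
Lemma derivable_on_prim y h c : {within `[0, T], continuous h} ->
  (forall t, t \in `[0, T] -> y t = c + prim h t) ->
  forall t, t \in `[0, T] ->
    (y s - y t) / (s - t) @[s --> within `[0, T] t^'] --> h t.
Proof.
move=> ch yh t tT; apply/cvgrPdist_le => e e0.
have /subspace_continuousP/(_ t tT)/cvgrPdist_le/(_ e e0)/within_nbhsP[d d0 dP] := ch.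
apply/within_dnbhsP; exists d => // s std st sT.
have st0 : s - t != 0 by rewrite subr_eq0.
have ih : L1 T h by apply: continuous_compact_integrable => //; exact: segment_compact.
have ic (x : R) : L1 T (cst x) by apply: continuous_compact_integrable;
  [exact: segment_compact|move=> ?; exact: cst_continuous].
have [tT0 tT1] : 0 <= t /\ t <= T by move: tT; rewrite in_itv/= => /andP.
have [sT0 sT1] : 0 <= s /\ s <= T by move: (sT : s \in `[0, T]); rewrite in_itv/= => /andP.
have E r : 0 <= r -> r <= T -> prim (fun r => h r - h t) r = prim h r - h t * r.
  by move=> r0 rT; rewrite (primB ih (ic (h t)) rT) prim_cst.
have -> : h t - (y s - y t) / (s - t) =
   - (prim (fun r => h r - h t) s - prim (fun r => h r - h t) t) / (s - t).
  by rewrite !E// !yh//; field.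
rewrite normrM normfV ler_pdivrMr ?normr_gt0// normrN.
have hP r : `|r - t| < d -> 0 <= r <= T -> `|h r - h t| <= e.
  by move=> rd rT; rewrite distrC; apply: dP => //=; rewrite in_itv.
have [ts|ts] := leP t s.
  rewrite (le_trans (@prim_lipschitz _ T _ e t s _ _ _ _))//; first by rewrite tT0.
  - exact: (L1B ih (ic _)).
  - move=> r /andP[tr rs]; apply: hP; last by rewrite (le_trans tT0 tr) (le_trans rs).
    move: std; rewrite !ger0_norm ?subr_ge0//; apply: le_lt_trans; by rewrite lerD2r.
  - by rewrite ler_wpM2l ?ler_norm// ltW.
rewrite distrC (le_trans (@prim_lipschitz _ T _ e s t _ _ _ _))//; first by rewrite sT0 ltW.
- exact: (L1B ih (ic _)).
- move=> r /andP[sr rt]; apply: hP; last by rewrite (le_trans sT0 sr) (le_trans rt).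
  by move: std; rewrite !ltr_norml => /andP[? ?]; apply/andP; split; lra.
- by rewrite distrC ler_wpM2l ?ler_norm// ltW.
Qed.

End one_sided_derivative.

(** * The equation of one coefficient *)

Section volterra_oscillator.
Context {R : realType}.
Notation mu := (@lebesgue_measure R).
Variables (T : R) (T0 : 0 < T).
Notation L1 := (L1 T).
Implicit Types (a b c l s t r C M : R) (f g h x y z F u v w : R -> R).

Lemma within_continuousM (A : set R) f g : {within A, continuous f} ->
  {within A, continuous g} -> {within A, continuous (fun s => f s * g s)}.
Proof. by move=> coef cg t; exact: (cvgM (coef t) (cg t)). Qed.

Lemma within_continuousD (A : set R) f g : {within A, continuous f} ->
  {within A, continuous g} -> {within A, continuous (fun s => f s + g s)}.
Proof. by move=> coef cg t; exact: (cvgD (coef t) (cg t)). Qed.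

Lemma within_continuous_cst (A : set R) c : {within A, continuous (cst c : R -> R)}.
Proof. by move=> t; exact: cst_continuous. Qed.

Lemma L1_continuous y : {within `[0, T], continuous y} -> L1 y.
Proof. by move=> cy; apply: continuous_compact_integrable => //; exact: segment_compact. Qed.

Lemma L1_cst c : L1 (cst c).
Proof. by apply: L1_continuous => ?; exact: cst_continuous. Qed.

Lemma continuous_bounded y : {within `[0, T], continuous y} ->
  exists M, forall t, t \in `[0, T] -> `|y t| <= M.
Proof.
move=> cy; have cny : {within `[0, T], continuous (fun t => `|y t|)}.
  by move=> t; apply: continuous_comp; [exact: cy|exact: norm_continuous].
have [c _ cM] := EVT_max (ltW T0) cny.
by exists `|y c|.
Qed.

Lemma continuous_measurable y : {within `[0, T], continuous y} -> measurable_fun `[0, T] y.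
Proof. by move=> cy; apply: subspace_continuous_measurable_fun. Qed.

Lemma L1_mulcontinuous y z : {within `[0, T], continuous y} -> L1 z -> L1 (fun s => y s * z s).
Proof.
move=> cy iz; have [M yM] := continuous_bounded cy.
rewrite (_ : (fun s => _) = (fun s => z s * y s)); last by apply/funext => s; rewrite mulrC.
by apply: (L1_mulbounded iz _ yM); exact: continuous_measurable.
Qed.

Lemma within_continuous_eq y z : (forall t, t \in `[0, T] -> y t = z t) ->
  {within `[0, T], continuous y} -> {within `[0, T], continuous z}.
Proof.
by move=> yz; apply: subspace_eq_continuous => t; rewrite inE => tT; exact: yz.
Qed.

Lemma primitive_continuous y z c : L1 z -> (forall t, t \in `[0, T] -> y t = c + prim z t) ->
  {within `[0, T], continuous y}.
Proof.
move=> iz yz; apply: (@within_continuous_eq (fun t => c + prim z t)).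
  by move=> t tT; rewrite yz.
move=> t; apply: (@continuousD _ _ (subspace `[0, T])); first exact: cst_continuous.
by apply: prim_continuous => //; exact: ltW.
Qed.

(** Absolutely continuous functions are given by an initial value and an integrable derivative.
    Expanding the product leaves [prim y t * prim z t], to which [prim_prod] applies. *)
Lemma product_rule y z f g a b : L1 y -> L1 z ->
  (forall t, t \in `[0, T] -> f t = a + prim y t) ->
  (forall t, t \in `[0, T] -> g t = b + prim z t) ->
  forall t, t \in `[0, T] ->
    f t * g t = a * b + prim (fun s => y s * g s + f s * z s) t.
Proof.
move=> iy iz fy gz t tT; have := tT; rewrite in_itv/= => tT'; have /andP[t0 tT1] := tT'.
have coef := primitive_continuous iy fy; have cg := primitive_continuous iz gz.
have cP := prim_continuous (ltW T0) iy; have cQ := prim_continuous (ltW T0) iz.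
rewrite fy// gz// [in RHS](@eq_prim _ _ (fun s => (b * y s + a * z s) + (y s * prim z s + prim y s * z s))).
  rewrite (primD (T := T)) ?(primD (L1Z _ iy) (L1Z _ iz) tT1)//; last 2 first.
  - exact: (L1D (L1Z _ iy) (L1Z _ iz)).
  - apply: L1D; last exact: L1_mulcontinuous.
    rewrite (_ : (fun s => _) = (fun s => prim z s * y s)); last by apply/funext => s; rewrite mulrC.
    exact: L1_mulcontinuous.
  by rewrite -(prim_prod iy iz tT') (primZ _ iy tT1) (primZ _ iz tT1); ring.
move=> s /andP[s0 st]; have sT : s \in `[0, T] by rewrite in_itv/= s0 (le_trans st).
by rewrite fy// gz//; ring.
Qed.

Lemma cos_prim l t : 0 <= t -> cos (l * t) = 1 + prim (fun s => - l * sin (l * s)) t.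
Proof.
move=> t0.
have coef : {within `[0, t], continuous (fun s => - l * sin (l * s))}.
  apply: within_continuousM; first exact: within_continuous_cst.
  by apply: continuous_subspaceT => s; apply: continuous_comp;
    [exact: mulrl_continuous|exact: continuous_sin].
have cF : {within `[0, t], continuous (fun s => cos (l * s))}.
  by apply: continuous_subspaceT => s; apply: continuous_comp;
    [exact: mulrl_continuous|exact: continuous_cos].
have dF (x : R) : x \in `]0, t[ -> is_derive x 1 (fun s => cos (l * s)) ((fun s => - l * sin (l * s)) x).
  by move=> _; apply: is_derive_eq; rewrite /GRing.scale/=; ring.
by rewrite (prim_FTC t0 coef cF dF) mulr0 cos0; ring.
Qed.

Lemma sin_prim l t : 0 <= t -> sin (l * t) = 0 + prim (fun s => l * cos (l * s)) t.
Proof.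
move=> t0.
have coef : {within `[0, t], continuous (fun s => l * cos (l * s))}.
  apply: within_continuousM; first exact: within_continuous_cst.
  by apply: continuous_subspaceT => s; apply: continuous_comp;
    [exact: mulrl_continuous|exact: continuous_cos].
have cF : {within `[0, t], continuous (fun s => sin (l * s))}.
  by apply: continuous_subspaceT => s; apply: continuous_comp;
    [exact: mulrl_continuous|exact: continuous_sin].
have dF (x : R) : x \in `]0, t[ -> is_derive x 1 (fun s => sin (l * s)) ((fun s => l * cos (l * s)) x).
  by move=> _; apply: is_derive_eq; rewrite /GRing.scale/=; ring.
by rewrite (prim_FTC t0 coef cF dF) mulr0 sin0; ring.
Qed.

Lemma continuous_cosl l : {within `[0, T], continuous (fun s => cos (l * s))}.
Proof.
by apply: continuous_subspaceT => s; apply: continuous_comp;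
  [exact: mulrl_continuous|exact: continuous_cos].
Qed.

Lemma continuous_sinl l : {within `[0, T], continuous (fun s => sin (l * s))}.
Proof.
by apply: continuous_subspaceT => s; apply: continuous_comp;
  [exact: mulrl_continuous|exact: continuous_sin].
Qed.

Variables (q : R -> R) (iq : L1 q).
Notation k := (prim q).

(* y'' + l^2 y = F - l^2 (k * y) integrated once in time, with y1 = y'. *)
Definition wsolution l a b F y y1 :=
  [/\ {within `[0, T], continuous y1},
      forall t, t \in `[0, T] -> y t = a + prim y1 t &
      forall t, t \in `[0, T] -> y1 t = b +
        prim (fun s => F s - l ^+ 2 * (y s + time_convolution k y s)) t].

Lemma wsolution_continuous l a b F y y1 : wsolution l a b F y y1 ->
  {within `[0, T], continuous y}.
Proof. by move=> [cy1 yy1 _]; apply: (primitive_continuous (L1_continuous cy1) yy1). Qed.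

Definition kernel_mass := prim (fun s => `|q s|) T.
Notation N := kernel_mass.
(* Large enough for the memory term to be absorbed in a sup norm with weight
   expR (- growth_rate * t). *)
Definition growth_rate := 8 * N + 1.

Lemma kernel_mass_ge0 : 0 <= N.
Proof. by apply: prim_ge0. Qed.

Lemma growth_rate_gt0 : 0 < growth_rate.
Proof. by rewrite ltr_wpDl// mulr_ge0// kernel_mass_ge0. Qed.

Lemma normr_prim_le g h t : L1 g -> L1 h -> 0 <= t <= T ->
  (forall s, 0 <= s <= t -> `|g s| <= h s) -> `|prim g t| <= prim h t.
Proof.
move=> ig ih /andP[t0 tT] gh; apply: (le_trans (normr_prim ig tT)).
exact: (le_prim (L1_norm ig) ih tT).
Qed.

(* p = cos(l t) y' + l sin(l t) y and r = sin(l t) y' - l cos(l t) y. As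
   k * y = prim w, an integration by parts trades one of the two factors l of
   the memory term l^2 (k * y) for a time derivative. *)
Lemma wsolution_duhamel l a b F y y1 : wsolution l a b F y y1 -> L1 F ->
  let w := time_convolution q y in
  forall t, t \in `[0, T] ->
  let p := b + prim (fun s => cos (l * s) * F s) t
    - l * (sin (l * t) * prim w t - prim (fun s => sin (l * s) * w s) t) in
  let r := - l * a + prim (fun s => sin (l * s) * F s) t
    - l * (- cos (l * t) * prim w t + prim (fun s => cos (l * s) * w s) t) in
  l * y t = sin (l * t) * p - cos (l * t) * r /\
  y1 t = cos (l * t) * p + sin (l * t) * r.
Proof.
move=> ws iF w t tT; have cy := wsolution_continuous ws; have [cy1 yE y1E] := ws.
have iy := L1_continuous cy; have iy1 := L1_continuous cy1.
have iw : L1 w by exact: L1_time_convolution.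
have tT' : 0 <= t <= T by move: tT; rewrite in_itv.
have /andP[t0 tT1] := tT'.
have sT s : 0 <= s <= t -> s \in `[0, T].
  by move=> /andP[s0 st]; rewrite in_itv/= s0 (le_trans st).
set z := (fun s => F s - l ^+ 2 * (y s + prim w s)).
have ipw : L1 (prim w) by apply: L1_prim => //; exact: ltW.
have iz : L1 z by apply: L1B => //; apply: L1Z; exact: L1D.
have y1E' s : s \in `[0, T] -> y1 s = b + prim z s.
  move=> sT'; rewrite (y1E _ sT'); apply: (congr1 (+%R b)); apply: eq_prim => r rs.
  rewrite /z (conv_prim iq iy)//.
  by move: rs sT'; rewrite in_itv/= => /andP[-> rs] /andP[s0 sT']; exact: le_trans sT'.
have cosE s : s \in `[0, T] -> cos (l * s) = 1 + prim (fun s => - l * sin (l * s)) s.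
  by rewrite in_itv/= => /andP[s0 _]; exact: cos_prim.
have sinE s : s \in `[0, T] -> sin (l * s) = 0 + prim (fun s => l * cos (l * s)) s.
  by rewrite in_itv/= => /andP[s0 _]; exact: sin_prim.
have isin : L1 (fun s => - l * sin (l * s)) by apply/L1Z/L1_continuous/continuous_sinl.
have icos : L1 (fun s => l * cos (l * s)) by apply/L1Z/L1_continuous/continuous_cosl.
have wE s : s \in `[0, T] -> prim w s = 0 + prim w s by rewrite add0r.
have ics h : L1 h -> L1 (fun s => cos (l * s) * h s).
  by apply: L1_mulcontinuous; exact: continuous_cosl.
have isn h : L1 h -> L1 (fun s => sin (l * s) * h s).
  by apply: L1_mulcontinuous; exact: continuous_sinl.
(* [E1] plus [l] times [E2] gives [p]: the integrals of [sin * y1] cancel, and that of [cos * y]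
   cancels against the one in [E7]. [E3], [E4], [E8] do the same for [r]. [E5] and [E6] are the
   integrations by parts of the memory term. *)
have := product_rule isin iz cosE y1E' tT.
rewrite (@eq_prim _ _ (fun s => - l * (sin (l * s) * y1 s) + cos (l * s) * z s)); last first.
  by move=> s _; ring.
rewrite (primD (L1Z _ (isn _ iy1)) (ics _ iz) tT1) (primZ _ (isn _ iy1) tT1) => E1.
have := product_rule icos iy1 sinE yE tT.
rewrite (@eq_prim _ _ (fun s => l * (cos (l * s) * y s) + sin (l * s) * y1 s)); last first.
  by move=> s _; ring.
rewrite (primD (L1Z _ (ics _ iy)) (isn _ iy1) tT1) (primZ _ (ics _ iy) tT1) => E2.
have := product_rule icos iz sinE y1E' tT.
rewrite (@eq_prim _ _ (fun s => l * (cos (l * s) * y1 s) + sin (l * s) * z s)); last first.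
  by move=> s _; ring.
rewrite (primD (L1Z _ (ics _ iy1)) (isn _ iz) tT1) (primZ _ (ics _ iy1) tT1) => E3.
have := product_rule isin iy1 cosE yE tT.
rewrite (@eq_prim _ _ (fun s => - l * (sin (l * s) * y s) + cos (l * s) * y1 s)); last first.
  by move=> s _; ring.
rewrite (primD (L1Z _ (isn _ iy)) (ics _ iy1) tT1) (primZ _ (isn _ iy) tT1) => E4.
have := product_rule icos iw sinE wE tT.
rewrite [X in _ = _ + X](@eq_prim _ _ (fun s => l * (cos (l * s) * prim w s) + sin (l * s) * w s)); last first.
  by move=> s _; ring.
rewrite (primD (L1Z _ (ics _ ipw)) (isn _ iw) tT1) (primZ _ (ics _ ipw) tT1) => E5.
have := product_rule isin iw cosE wE tT.
rewrite [X in _ = _ + X](@eq_prim _ _ (fun s => - l * (sin (l * s) * prim w s) + cos (l * s) * w s)); last first.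
  by move=> s _; ring.
rewrite (primD (L1Z _ (isn _ ipw)) (ics _ iw) tT1) (primZ _ (isn _ ipw) tT1) => E6.
have E7 : prim (fun s => cos (l * s) * z s) t = prim (fun s => cos (l * s) * F s) t
    - l ^+ 2 * (prim (fun s => cos (l * s) * y s) t + prim (fun s => cos (l * s) * prim w s) t).
  rewrite -(primD (ics _ iy) (ics _ ipw) tT1) -(primZ _ (L1D (ics _ iy) (ics _ ipw)) tT1).
  rewrite -(primB (ics _ iF) (L1Z _ (L1D (ics _ iy) (ics _ ipw))) tT1).
  by apply: eq_prim => s _; rewrite /z; ring.
have E8 : prim (fun s => sin (l * s) * z s) t = prim (fun s => sin (l * s) * F s) t
    - l ^+ 2 * (prim (fun s => sin (l * s) * y s) t + prim (fun s => sin (l * s) * prim w s) t).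
  rewrite -(primD (isn _ iy) (isn _ ipw) tT1) -(primZ _ (L1D (isn _ iy) (isn _ ipw)) tT1).
  rewrite -(primB (isn _ iF) (L1Z _ (L1D (isn _ iy) (isn _ ipw))) tT1).
  by apply: eq_prim => s _; rewrite /z; ring.
move=> p r.
have pE : p = cos (l * t) * y1 t + l * (sin (l * t) * y t).
  rewrite /p E1 E2 E7; move: E5; move: (prim (fun s => cos (l * s) * prim w s) t) => X1 E5.
  rewrite E5; ring.
have rE : r = sin (l * t) * y1 t - l * (cos (l * t) * y t).
  rewrite /r E3 E4 E8; move: E6; move: (prim (fun s => sin (l * s) * prim w s) t) => X1 E6.
  rewrite [- cos _ * _]mulNr E6; ring.
(* The matrix taking [(y1, l * y)] to [(p, r)] is symmetric and orthogonal, hence its own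
   inverse. *)
have cs := cos2Dsin2 (l * t).
rewrite pE rE; split.
  rewrite -[LHS]mul1r -cs; ring.
rewrite -[LHS]mul1r -cs; ring.
Qed.

End volterra_oscillator.

Section volterra_oscillator_bounds.
Context {R : realType}.
Notation mu := (@lebesgue_measure R).
Variables (T : R) (T0 : 0 < T).
Notation L1 := (L1 T).
Implicit Types (a b c l s t r C M : R) (f g h x y z F u v w : R -> R).
Variables (q : R -> R) (iq : L1 q).
Notation k := (prim q).
Notation N := (kernel_mass T q).
Notation sigma := (growth_rate T q).
Notation wsolution := (wsolution T q).

Let N_ge0 : 0 <= N := kernel_mass_ge0 T q.
Let sigma_gt0 : 0 < sigma := growth_rate_gt0 T q.
(** Let [M] be the maximum of [|y t| * expR (- (sigma * t))], attained at [c]. In the estimate at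
    time [c] the memory term contributes at most half of [l * M] times the weight and is absorbed,
    which leaves [l * M <= 2 * D]. *)
Lemma wsolution_bound l a b F y y1 : 0 < l -> L1 F -> wsolution l a b F y y1 ->
  let C := 4 * expR (sigma * T) * (l * `|a| + `|b| + prim (fun s => `|F s|) T) in
  forall t, t \in `[0, T] -> l * `|y t| <= C /\ `|y1 t| <= C.
Proof.
move=> l0 iF ws C.
have cy := wsolution_continuous T0 ws.
have [M [c [M0 cT yM McE]]] : exists M c, [/\ 0 <= M, c \in `[0, T],
    forall t, t \in `[0, T] -> `|y t| <= M * expR (sigma * t) &
    `|y c| = M * expR (sigma * c)].
  pose f t := `|y t| * expR (- (sigma * t)).
  have coef : {within `[0, T], continuous f}.
    apply: within_continuousM => t.
      by apply: continuous_comp; [exact: cy|exact: norm_continuous].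
    move: t; apply: continuous_subspaceT => t.
    apply: continuous_comp; last exact: continuous_expR.
    by apply: continuousN; exact: mulrl_continuous.
  have [c cT cM] := EVT_max (ltW T0) coef.
  exists (f c), c; split => //; first by rewrite mulr_ge0 ?expR_ge0.
    by move=> t tT; rewrite -ler_pdivrMr ?expR_gt0// -expRN; exact: cM.
  by rewrite /f -mulrA -expRD addNr expR0 mulr1.
pose w := time_convolution q y.
have my := continuous_measurable cy.
have iw : L1 w by apply: L1_time_convolution => //; exact: L1_continuous.
have wM t : 0 <= t <= T -> `|w t| <= M * N * expR (sigma * t).
  move=> tT; rewrite mulrAC; apply: time_convolution_bound => //; exact: ltW.
have iexp : L1 (fun s => expR (sigma * s)).
  apply: L1_continuous; apply: continuous_subspaceT => t.
  by apply: continuous_comp; [exact: mulrl_continuous|exact: continuous_expR].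
(* Integrating the weight gains [sigma^-1], and [N / sigma <= 1 / 8] by the choice of [growth_rate].
   Four such terms, two in [p] and two in [r], make up the half to be absorbed. *)
have E t h : 0 <= t <= T -> L1 h -> (forall s, 0 <= s <= t -> `|h s| <= `|w s|) ->
    `|prim h t| <= M / 8 * expR (sigma * t).
  move=> /[dup] tT /andP[t0 tT1] ih hw.
  apply: (@le_trans _ _ (prim (fun s => M * N * expR (sigma * s)) t)).
    apply: (normr_prim_le ih (L1Z (M * N) iexp) tT) => s /[dup] st /andP[s0 st1]; apply: (le_trans (hw _ st)); apply: wM.
    by rewrite s0 (le_trans st1).
  rewrite (primZ _ iexp tT1); apply: (@le_trans _ _ (M * N * (expR (sigma * t) / sigma))).
    by rewrite ler_wpM2l ?mulr_ge0//; exact: prim_expR.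
  rewrite -!mulrA ler_wpM2l//.
  rewrite mulrCA [leRHS]mulrC ler_wpM2l ?expR_ge0//.
  by rewrite ler_pdivrMr// /sigma; lra.
pose D := l * `|a| + `|b| + 2 * prim (fun s => `|F s|) T.
have F0 : 0 <= prim (fun s => `|F s|) T by exact: prim_ge0.
have D0 : 0 <= D by rewrite !addr_ge0// mulr_ge0// ltW.
have key t : t \in `[0, T] ->
    l * `|y t| <= D + l * M / 2 * expR (sigma * t) /\
    `|y1 t| <= D + l * M / 2 * expR (sigma * t).
  move=> tT; have tT' : 0 <= t <= T by move: tT; rewrite in_itv.
  have /andP[t0 tT1] := tT'.
  have [] := wsolution_duhamel T0 iq ws iF tT.
  rewrite -/w; set p := (b + _ - _); set r := (- l * a + _ - _) => yE y1E.
  have c1 s : `|cos (l * s)| <= 1 by exact: cos_max.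
  have s1 s : `|sin (l * s)| <= 1 by exact: sin_max.
  have Fle h : (forall s, `|h s| <= 1) -> {within `[0, T], continuous h} ->
      `|prim (fun s => h s * F s) t| <= prim (fun s => `|F s|) T.
    move=> h1 ch; apply: (@le_trans _ _ (prim (fun s => `|F s|) t)).
      apply: (normr_prim_le (L1_mulcontinuous T0 ch iF) (L1_norm iF) tT') => s _.
      by rewrite normrM ler_piMl.
    by apply: (prim_mono (L1_norm iF)) => //; rewrite t0 tT1.
  have wle h : (forall s, `|h s| <= 1) -> {within `[0, T], continuous h} ->
      `|prim (fun s => h s * w s) t| <= M / 8 * expR (sigma * t).
    move=> h1 ch; apply: E => //; first exact: (L1_mulcontinuous T0).
    by move=> s _; rewrite normrM ler_piMl.
  have Gle : `|prim w t| <= M / 8 * expR (sigma * t) by exact: E.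
  have pM : `|p| <= `|b| + prim (fun s => `|F s|) T + l * M / 4 * expR (sigma * t).
    rewrite /p; apply: (le_trans (ler_normB _ _)); apply: lerD.
      by rewrite (le_trans (ler_normD _ _))// lerD2l; apply: Fle => //; exact: continuous_cosl.
    rewrite normrM (gtr0_norm l0) -!mulrA ler_wpM2l ?(ltW l0)//.
    apply: (le_trans (ler_normB _ _)).
    rewrite (_ : M * _ = M / 8 * expR (sigma * t) + M / 8 * expR (sigma * t)); last by field.
    apply: lerD; last by apply: wle => //; exact: continuous_sinl.
    by rewrite normrM (le_trans _ Gle)// ler_piMl.
  have rM : `|r| <= l * `|a| + prim (fun s => `|F s|) T + l * M / 4 * expR (sigma * t).
    rewrite /r; apply: (le_trans (ler_normB _ _)); apply: lerD.
      rewrite (le_trans (ler_normD _ _))// normrM normrN (gtr0_norm l0) lerD2l.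
      by apply: Fle => //; exact: continuous_sinl.
    rewrite normrM (gtr0_norm l0) -!mulrA ler_wpM2l ?(ltW l0)//.
    apply: (le_trans (ler_normD _ _)).
    rewrite (_ : M * _ = M / 8 * expR (sigma * t) + M / 8 * expR (sigma * t)); last by field.
    apply: lerD; last by apply: wle => //; exact: continuous_cosl.
    by rewrite normrM normrN (le_trans _ Gle)// ler_piMl.
  have prD : `|p| + `|r| <= D + l * M / 2 * expR (sigma * t) by rewrite /D; lra.
  have cs2 X Y : `|X| <= 1 -> `|Y| <= 1 -> `|X * p| + `|Y * r| <= `|p| + `|r|.
    by move=> X1 Y1; rewrite !normrM lerD// ler_piMl.
  split.
    have -> : l * `|y t| = `|l * y t| by rewrite normrM (gtr0_norm l0).
    rewrite yE; apply: le_trans prD.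
    by apply: (le_trans (ler_normB _ _)); exact: cs2.
  rewrite y1E; apply: le_trans prD.
  by apply: (le_trans (ler_normD _ _)); exact: cs2.
have lM : l * M <= 2 * D.
  have [+ _] := key c cT.
  have ex0 := expR_gt0 (sigma * c).
  have ex1 : 1 <= expR (sigma * c).
    rewrite -expR0 ler_expR mulr_ge0//; first exact: ltW.
    by move: cT; rewrite in_itv/= => /andP[].
  rewrite McE => H; have : l * M * expR (sigma * c) <= 2 * D * expR (sigma * c); last by rewrite ler_pM2r.
  have DE : D <= D * expR (sigma * c) by rewrite ler_peMr.
  by lra.
move=> t tT.
have et : expR (sigma * t) <= expR (sigma * T).
  rewrite ler_expR ler_wpM2l//; first exact: ltW.
  by move: tT; rewrite in_itv/= => /andP[].
have e1 : 1 <= expR (sigma * T) by rewrite -expR0 ler_expR mulr_ge0 ?ltW.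
(* [D] counts the integral of [|F|] twice, for [p] and for [r], and the absorption doubles [D]:
   hence the 4 in [C]. *)
have : D + l * M / 2 * expR (sigma * t) <= C.
  apply: (@le_trans _ _ (D * expR (sigma * T) + D * expR (sigma * T))).
    apply: lerD; first by rewrite ler_peMr.
    apply: (@le_trans _ _ (D * expR (sigma * t))); last by rewrite ler_wpM2l.
    by rewrite ler_wpM2r ?expR_ge0//; lra.
  rewrite (_ : _ + _ = (2 * D) * expR (sigma * T)); last by ring.
  have -> : C = 4 * (l * `|a| + `|b| + prim (fun s => `|F s|) T) * expR (sigma * T).
    by rewrite /C; ring.
  rewrite ler_wpM2r ?expR_ge0// /D.
  have la0 : 0 <= l * `|a| by rewrite mulr_ge0// ltW.
  by have := normr_ge0 b; lra.
by have [k1 k2] := key t tT => ?; split; [exact: le_trans k1 _|exact: le_trans k2 _].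
Qed.


(** The difference solves the equation with zero data, for which the bound of [wsolution_bound] is
    0. *)
Lemma wsolution_unique l a b F y z y1 z1 : 0 < l -> L1 F ->
  wsolution l a b F y y1 -> wsolution l a b F z z1 ->
  forall t, t \in `[0, T] -> y t = z t.
Proof.
move=> l0 iF wy wz.
have cy := wsolution_continuous T0 wy; have cz := wsolution_continuous T0 wz.
have [cy1 yE y1E] := wy; have [cz1 zE z1E] := wz.
have iy := L1_continuous cy; have iz := L1_continuous cz.
have iy1 := L1_continuous cy1; have iz1 := L1_continuous cz1.
have ik : L1 k := L1_prim (ltW T0) iq.
have iky : L1 (time_convolution k y) by exact: L1_time_convolution.
have ikz : L1 (time_convolution k z) by exact: L1_time_convolution.
have [My yM] := continuous_bounded T0 cy; have [Mz zM] := continuous_bounded T0 cz.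
have wd : wsolution l 0 0 (cst 0) (fun t => - 1 * z t + y t) (fun t => -1 * z1 t + y1 t).
  split.
  - apply: within_continuousD => //; apply: within_continuousM => //.
    exact: within_continuous_cst.
  - move=> t tT; have tT1 : t <= T by move: tT; rewrite in_itv/= => /andP[].
    by rewrite (primD (L1Z (-1) iz1) iy1 tT1) (primZ _ iz1 tT1) (yE _ tT) (zE _ tT); ring.
  - move=> t tT; have tT1 : t <= T by move: tT; rewrite in_itv/= => /andP[].
    have j1 := L1B iF (L1Z (l ^+ 2) (L1D iz ikz)).
    have j2 := L1B iF (L1Z (l ^+ 2) (L1D iy iky)).
    rewrite z1E// y1E// [in RHS](@eq_prim _ _ (fun s =>
       -1 * (F s - l ^+ 2 * (z s + time_convolution k z s)) +
       (F s - l ^+ 2 * (y s + time_convolution k y s)))).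
      rewrite (primD (L1Z (-1) j1) j2 tT1) (primZ _ j1 tT1).
      set X := prim _ t; set Y := prim _ t; ring.
    move=> s /andP[s0 st].
    rewrite (@time_convolution_lin _ _ k z y (-1) (Num.max My Mz) s (le_trans st tT1))//.
    + by rewrite /cst; ring.
    + exact: continuous_measurable.
    + exact: continuous_measurable.
    + by move=> r rT; rewrite le_max zM// orbT.
    + by move=> r rT; rewrite le_max yM.
move=> t tT; have [+ _] := wsolution_bound l0 (L1_cst T 0) wd tT.
rewrite normr0 mulr0 !add0r [prim _ _](_ : _ = 0).
  rewrite mulr0 pmulr_rle0// normr_le0 => /eqP; lra.
rewrite (@eq_prim _ _ (cst 0)); last by move=> s _; rewrite /= ?normr0.
by rewrite prim_cst ?mul0r// ltW.
Qed.

Lemma small_geometric C e : 0 < e -> exists n, C * 2^-1 ^+ n < e.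
Proof.
move=> e0; have h1 : `|2^-1 : R| < 1 by rewrite gtr0_norm//; lra.
have /cvgrPdist_lt/(_ e e0)[n _ nP] := @cvg_geometric R C _ h1.
exists n; have := nP n (leqnn n); rewrite /= sub0r normrN /geometric/=.
exact/le_lt_trans/ler_norm.
Qed.

Lemma le0_geometric C c : (forall n, c <= C * 2^-1 ^+ n) -> c <= 0.
Proof.
move=> cC; rewrite leNgt; apply/negP => c0.
by have [n] := small_geometric C c0; rewrite ltNge cC.
Qed.

(* The weight expR (rate * s) makes the Picard map a contraction of ratio 1/2 on
   the whole of [0, T]. *)
Lemma picard_contraction l b F u v m t :
  let rate := 1 + 2 * (l ^+ 2 * (1 + prim (fun s => `|k s|) T)) in
  let P u s := F s - l ^+ 2 * (u s + time_convolution k u s) in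
  L1 F -> measurable_fun `[0, T] u -> measurable_fun `[0, T] v ->
  (exists M, forall s, s \in `[0, T] -> `|u s| <= M) ->
  (exists M, forall s, s \in `[0, T] -> `|v s| <= M) ->
  (forall s, s \in `[0, T] -> `|u s - v s| <= m * expR (rate * s)) ->
  t \in `[0, T] ->
  `|prim (fun r => b + prim (P u) r) t - prim (fun r => b + prim (P v) r) t| <=
  m / 2 * expR (rate * t).
Proof.
move=> rate P iF mu_ mv [Mu uM] [Mv vM] uv tT.
have ik : L1 k := L1_prim (ltW T0) iq.
have /andP[t0 tT1] : 0 <= t <= T by move: tT; rewrite in_itv.
have K0 : 0 <= prim (fun s => `|k s|) T by exact: prim_ge0.
have lK0 : 0 <= l ^+ 2 * (1 + prim (fun s => `|k s|) T).
  by rewrite mulr_ge0 ?sqr_ge0// addr_ge0.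
have rate1 : 1 <= rate by rewrite lerDl mulr_ge0.
have rate0 : 0 < rate by exact: lt_le_trans rate1.
have m0 : 0 <= m.
  have := uv 0; rewrite in_itv/= lexx (ltW T0) mulr0 expR0 mulr1 => /(_ isT).
  exact: le_trans.
have iu := L1_bounded mu_ uM; have iv := L1_bounded mv vM.
have iPu : L1 (P u) by apply: L1B => //; apply/L1Z/L1D => //; exact: L1_time_convolution.
have iPv : L1 (P v) by apply: L1B => //; apply/L1Z/L1D => //; exact: L1_time_convolution.
have iexp : L1 (fun s => expR (rate * s)).
  apply: L1_continuous; apply: continuous_subspaceT => s.
  by apply: continuous_comp; [exact: mulrl_continuous|exact: continuous_expR].
(* By the choice of [rate], the Lipschitz constant [l^2 (1 + prim |k| T)] of [P] is at most
   [rate / 2]. The inner integration divides by [rate], leaving the ratio 1/2; the outer one divides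
   by [rate] again, which is at least 1. *)
have PB s : 0 <= s <= T -> `|P u s - P v s| <= rate / 2 * m * expR (rate * s).
  move=> /andP[s0 sT1]; have sT : s \in `[0, T] by rewrite in_itv/= s0.
  have -> : P u s - P v s = - (l ^+ 2 * ((u s - v s) + time_convolution k (fun r => u r - v r) s)).
    rewrite (@eq_time_convolution _ k (fun r => u r - v r) (fun r => -1 * v r + u r)).
      rewrite (@time_convolution_lin _ _ k v u (-1) (Num.max Mu Mv) s sT1)//.
      - by rewrite /P; ring.
      - by move=> r rT; rewrite le_max vM// orbT.
      - by move=> r rT; rewrite le_max uM.
    by move=> r _; ring.
  rewrite normrN normrM ger0_norm ?sqr_ge0//.
  apply: (@le_trans _ _ (l ^+ 2 * (m * expR (rate * s) + m * expR (rate * s) * prim (fun s => `|k s|) T))).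
    rewrite ler_wpM2l ?sqr_ge0// (le_trans (ler_normD _ _))// lerD ?uv//.
    have sT' : 0 <= s <= T by rewrite s0.
    exact: (time_convolution_bound (ltW rate0) sT' ik (measurable_funB mu_ mv) uv).
  rewrite (_ : _ * _ = l ^+ 2 * (1 + prim (fun s => `|k s|) T) * (m * expR (rate * s))); last by ring.
  rewrite [leRHS](_ : _ = rate / 2 * (m * expR (rate * s))); last by ring.
  by rewrite ler_wpM2r ?mulr_ge0 ?expR_ge0// /rate; lra.
have iPP w : L1 w -> L1 (fun r => b + prim w r).
  by move=> iw; apply: (L1D (L1_cst T b)); apply: L1_prim => //; exact: ltW.
rewrite -(primB (iPP _ iPu) (iPP _ iPv) tT1).
apply: (@le_trans _ _ (prim (fun r => m / 2 * expR (rate * r)) t)).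
  apply: (normr_prim_le (L1B (iPP _ iPu) (iPP _ iPv)) (L1Z (m / 2) iexp)); first by rewrite t0.
  move=> s /andP[s0 st]; have sT1 := le_trans st tT1.
  have -> : b + prim (P u) s - (b + prim (P v) s) = prim (P u) s - prim (P v) s.
    by rewrite opprD addrACA subrr add0r.
  rewrite -(primB iPu iPv sT1).
  apply: (@le_trans _ _ (prim (fun r => rate / 2 * m * expR (rate * r)) s)).
    apply: (normr_prim_le (L1B iPu iPv) (L1Z _ iexp)); first by rewrite s0.
    by move=> r /andP[r0 rs]; apply: PB; rewrite r0 (le_trans rs).
  rewrite (primZ _ iexp sT1).
  apply: (@le_trans _ _ (rate / 2 * m * (expR (rate * s) / rate))).
    rewrite ler_wpM2l//; last exact: prim_expR.
    by rewrite mulr_ge0// divr_ge0// ltW.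
  by rewrite le_eqVlt; apply/orP; left; apply/eqP; field; rewrite gt_eqF.
rewrite (primZ _ iexp tT1) ler_wpM2l ?divr_ge0//.
apply: (le_trans (prim_expR rate0 t0)).
by rewrite ler_pdivrMr// ler_peMr// expR_ge0.
Qed.

(** The Picard iterates started at 0 converge uniformly on [[0, T]]. Their limit is used as a
    bounded measurable function, which is all that [Phi] and [picard_contraction] ask for. *)
Lemma wsolution_exists l a b F : L1 F -> exists y y1, wsolution l a b F y y1.
Proof.
move=> iF.
pose rate := 1 + 2 * (l ^+ 2 * (1 + prim (fun s => `|k s|) T)).
pose P u s := F s - l ^+ 2 * (u s + time_convolution k u s).
pose Phi u t := a + prim (fun r => b + prim (P u) r) t.
have ik : L1 k := L1_prim (ltW T0) iq.
have rate_ge0 : 0 <= rate.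
  rewrite addr_ge0// mulr_ge0// mulr_ge0 ?sqr_ge0// addr_ge0//; exact: prim_ge0.
have iP u : measurable_fun `[0, T] u -> (exists M, forall s, s \in `[0, T] -> `|u s| <= M) ->
    L1 (P u).
  move=> mu_ [M uM]; have iu := L1_bounded mu_ uM.
  by apply: L1B => //; apply/L1Z/L1D => //; exact: L1_time_convolution.
have cPP u : L1 (P u) -> {within `[0, T], continuous (fun r => b + prim (P u) r)}.
  by move=> iPu; apply: (@primitive_continuous _ T T0 _ (P u) b).
have cPhi u : L1 (P u) -> {within `[0, T], continuous (Phi u)}.
  move=> iPu; apply: (@primitive_continuous _ T T0 _ (fun r => b + prim (P u) r) a) => //.
  by apply: L1_continuous; exact: cPP.
pose U n := iter n Phi (cst 0).
have cU n : {within `[0, T], continuous (U n)}.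
  elim: n => [|n IH] /=; first exact: within_continuous_cst.
  apply/cPhi/iP; first exact: continuous_measurable.
  exact: continuous_bounded.
have [M0 UM0] := continuous_bounded T0 (cU 1%N).
have M00 : 0 <= M0 by apply: le_trans (UM0 0 _); rewrite // in_itv/= lexx ltW.
have Ud n t : t \in `[0, T] -> `|U n.+1 t - U n t| <= M0 * 2^-1 ^+ n * expR (rate * t).
  elim: n t => [|n IH] t tT.
    rewrite subr0 expr0 mulr1 (le_trans (UM0 _ tT))// ler_peMr//.
    rewrite -expR0 ler_expR mulr_ge0//; by move: tT; rewrite in_itv/= => /andP[].
  rewrite [U n.+2]/(Phi (U n.+1)) {2}[U n.+1]/(Phi (U n)) /Phi opprD addrACA subrr add0r.
  rewrite exprSr mulrA.
  apply: picard_contraction => //; try exact: continuous_measurable; exact: continuous_bounded.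
pose B := M0 * expR (rate * T).
have B0 : 0 <= B by rewrite mulr_ge0 ?expR_ge0.
(* The factor [1 - 2^-1 ^+ m] keeps the exact value of the geometric sum, so that the induction on
   [m] closes. *)
have Un n m t : t \in `[0, T] -> `|U (n + m)%N t - U n t| <= 2 * B * 2^-1 ^+ n * (1 - 2^-1 ^+ m).
  move=> tT; elim: m => [|m IH]; first by rewrite addn0 !subrr normr0 mulr0.
  rewrite addnS (_ : _ - _ = (U (n + m).+1 t - U (n + m)%N t) + (U (n + m)%N t - U n t)); last by ring.
  apply: (le_trans (ler_normD _ _)).
  apply: (@le_trans _ _ (B * 2^-1 ^+ (n + m) + 2 * B * 2^-1 ^+ n * (1 - 2^-1 ^+ m))).
    apply: lerD => //; apply: (le_trans (Ud _ _ tT)).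
    rewrite /B mulrAC ler_wpM2r ?exprn_ge0// ler_wpM2l// ler_expR.
    rewrite ler_wpM2l//; by move: tT; rewrite in_itv/= => /andP[].
  by rewrite exprD exprS le_eqVlt; apply/orP; left; apply/eqP; field.
have cvgU t : t \in `[0, T] -> cvgn (U^~ t).
  move=> tT; apply/cauchy_cvgP/cauchy_exP => e e0.
  have [n nP] := small_geometric (2 * B) e0.
  exists (U n t); exists n => // m /= nm; rewrite /ball/= distrC.
  rewrite -(subnKC nm); apply: le_lt_trans (Un _ _ _ tT) _.
  apply: le_lt_trans nP; rewrite ler_piMr ?mulr_ge0 ?exprn_ge0// ?lerBlDr ?lerDl ?exprn_ge0.
pose y t := limn (U^~ t).
have yU n t : t \in `[0, T] -> `|y t - U n t| <= 2 * B * 2^-1 ^+ n.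
  move=> tT.
  have H : (U (n + m)%N t - U n t) @[m --> \oo] --> y t - U n t.
    apply: cvgB; last exact: cvg_cst.
    have H0 : U m t @[m --> \oo] --> y t by exact: cvgU.
    have H1 : U (m + n)%N t @[m --> \oo] --> y t by move: H0; rewrite -(cvg_shiftn n).
    by under eq_fun do rewrite addnC.
  apply/ler_addgt0Pr => e e0.
  have /cvgrPdist_le/(_ e e0)[m _ /(_ m (leqnn m))/= He] := H.
  have -> : y t - U n t = (U (n + m)%N t - U n t) + (y t - U n t - (U (n + m)%N t - U n t)).
    by rewrite [RHS]addrC subrK.
  apply: (le_trans (ler_normD _ _)); apply: lerD => //.
  apply: (le_trans (Un _ _ _ tT)).
  by rewrite ler_piMr ?mulr_ge0 ?exprn_ge0// ?lerBlDr ?lerDl ?exprn_ge0.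
have my : measurable_fun `[0, T] y.
  apply: (@measurable_fun_cvg _ _ _ _ U) => // n.
  exact: continuous_measurable.
have ybd : exists M, forall s, s \in `[0, T] -> `|y s| <= M.
  exists (2 * B) => s sT; have := yU 0%N s sT; by rewrite /= subr0 expr0 mulr1.
have iPy := iP _ my ybd.
(* [Phi y] is chosen rather than [y], with which it agrees on [[0, T]]: it is a primitive by
   construction. *)
exists (Phi y), (fun r => b + prim (P y) r).
have yPhi t : t \in `[0, T] -> y t = Phi y t.
  move=> tT; apply/eqP; rewrite -subr_eq0 -normr_le0.
  have H n : `|y t - Phi y t| <= 4 * B * expR (rate * T) * 2^-1 ^+ n.
    have -> : y t - Phi y t = (y t - U n.+1 t) - (Phi y t - Phi (U n) t).
      have -> : U n.+1 t = Phi (U n) t by [].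
      by move: (Phi (U n) t) (Phi y t) (y t) => A1 A2 A3; ring.
    apply: (le_trans (ler_normB _ _)).
    have H2 : `|Phi y t - Phi (U n) t| <= 2 * B * 2^-1 ^+ n / 2 * expR (rate * t).
      rewrite /Phi opprD addrACA subrr add0r.
      apply: picard_contraction => //.
      - exact: continuous_measurable.
      - exact: continuous_bounded.
      move=> s sT; apply: (le_trans (yU n s sT)).
      rewrite -/rate ler_peMr ?mulr_ge0 ?exprn_ge0// -expR0 ler_expR mulr_ge0//.
      by move: sT; rewrite in_itv/= => /andP[].
    have H1 := yU n.+1 t tT.
    have E1 : 1 <= expR (rate * T) by rewrite -expR0 ler_expR mulr_ge0// ltW.
    have Et : expR (rate * t) <= expR (rate * T).
      by rewrite ler_expR ler_wpM2l//; move: tT; rewrite in_itv/= => /andP[].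
    have X0 : 0 <= B * 2^-1 ^+ n by rewrite mulr_ge0 ?exprn_ge0.
    apply: (@le_trans _ _ (B * 2^-1 ^+ n * expR (rate * T) + B * 2^-1 ^+ n * expR (rate * T))).
      apply: lerD.
        apply: (le_trans H1); rewrite exprS; apply: le_trans (ler_peMr X0 E1).
        by rewrite le_eqVlt; apply/orP; left; apply/eqP; field.
      apply: (le_trans H2); apply: le_trans (ler_wpM2l X0 Et).
      by rewrite le_eqVlt; apply/orP; left; apply/eqP; field.
    rewrite (_ : _ + _ = 2 * (B * 2^-1 ^+ n * expR (rate * T))); last by ring.
    rewrite (_ : 4 * _ * _ * _ = 4 * (B * 2^-1 ^+ n * expR (rate * T))); last by ring.
    by rewrite ler_wpM2r ?mulr_ge0 ?expR_ge0 ?exprn_ge0//; lra.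
  exact: le0_geometric H.
split; [exact: cPP|by move=> t _|].
move=> t tT; apply: (congr1 (+%R b)); apply: eq_prim => s /andP[s0 st].
have sT : s \in `[0, T].
  by move: tT; rewrite !in_itv/= s0 => /andP[_ tT]; rewrite (le_trans st).
rewrite /P -yPhi//; congr (_ - _ * (_ + _)); apply: eq_time_convolution => r /andP[r0 rs].
by rewrite yPhi//; move: sT; rewrite !in_itv/= r0 => /andP[_ ?]; rewrite (le_trans rs).
Qed.

End volterra_oscillator_bounds.

(** * The space L^2(Omega) *)

Section L2_space.
Context {R : realType} {d : nat} {Omega : set 'rV[R]_d}.
Notation mu := (lebesgue_rV R d).
Notation L2 := (L2 Omega).
Notation inner := (inner Omega).
Implicit Types (p q r w : 'rV[R]_d -> R) (a b c : R).

Lemma restrictE q x : (q \_ Omega) x = if x \in Omega then q x else 0.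
Proof. by rewrite patchE. Qed.

(** Computations on Omega are carried out with extensions by 0, so that measurability and
    integrability are those of functions on the whole space. *)
Lemma innerE q r : inner q r = \int[mu]_x ((q \_ Omega) x * (r \_ Omega) x).
Proof.
rewrite /inner Rintegral_mkcond; apply: eq_Rintegral => x _.
by rewrite !patchE; case: ifP => // _; rewrite mulr0.
Qed.

Lemma L2P q : L2 q <-> measurable_fun setT (q \_ Omega) /\
  mu.-integrable setT (EFin \o (fun x => (q \_ Omega) x ^+ 2)).
Proof.
split=> [qL|[mq iq]].
  split; last exact: Lfun2_integrable_sqr.
  by move: qL; rewrite /L2 inE => /andP[/[!inE]].
rewrite /L2 inE; apply/andP; split; rewrite inE//=.
rewrite /finite_norm unlock /Lnorm.
have /integrableP[_ qoo] := iq.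
rewrite poweR_lty// (le_lt_trans _ qoo)// le_eqVlt; apply/orP; left; apply/eqP.
apply: eq_integral => x _.
by rewrite /= powR_mulrn// real_normK ?num_real// ger0_norm// sqr_ge0.
Qed.

Lemma L2_measurable q : L2 q -> measurable_fun setT (q \_ Omega).
Proof. by case/L2P. Qed.

Lemma L2_integrable_mul q r : L2 q -> L2 r ->
  mu.-integrable setT (EFin \o (fun x => (q \_ Omega) x * (r \_ Omega) x)).
Proof.
move=> /L2P[mq iq] /L2P[mr ir].
apply: (le_integrable _ _ _ (integrableD measurableT iq ir)) => //.
  by apply/measurable_EFinP; exact: measurable_funM.
move=> x _; rewrite /= lee_fin [leRHS]ger0_norm ?addr_ge0 ?sqr_ge0//.
move: ((q \_ _) x) ((r \_ _) x) => u v; rewrite [`|u * v|]normrM -(real_normK (num_real u)) -(real_normK (num_real v)).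
have := sqr_ge0 (`|u| - `|v|); have := sqr_ge0 (`|u| + `|v|); rewrite sqrrB sqrrD.
by have := mulr_ge0 (normr_ge0 u) (normr_ge0 v); lra.
Qed.

Lemma L2_lin a q r : L2 q -> L2 r -> L2 (fun x => a * q x + r x).
Proof.
move=> qL rL; have /L2P[mq iq] := qL; have /L2P[mr ir] := rL.
have E : (fun x => a * q x + r x) \_ Omega = (fun x => a * (q \_ Omega) x + (r \_ Omega) x).
  by apply/funext => x; rewrite !restrictE; case: ifP => // _; rewrite mulr0 addr0.
apply/L2P; rewrite E; split.
  by apply: measurable_funD => //; exact: measurable_funM.
have := integrableD measurableT (integrableD measurableT (integrableZl measurableT (a ^+ 2) iq)
  (integrableZl measurableT (2 * a) (L2_integrable_mul qL rL))) ir.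
by apply: eq_integrable => // x _; rewrite /= -!EFinM -!EFinD; congr EFin; ring.
Qed.

Lemma L2_0 : L2 (cst 0).
Proof.
have E : (cst 0) \_ Omega = (cst 0 : 'rV[R]_d -> R).
  by apply/funext => x; rewrite restrictE; case: ifP.
apply/L2P; rewrite E; split => //.
rewrite [X in mu.-integrable _ X](_ : _ = cst 0%E); first exact: integrable0.
by apply/funext => x /=; rewrite expr0n.
Qed.

Lemma eq_L2 q r : (forall x, Omega x -> q x = r x) -> L2 q -> L2 r.
Proof.
move=> qr; rewrite /Defs.L2 (_ : q \_ Omega = r \_ Omega)//.
by apply/funext => x; rewrite !restrictE; case: ifPn => // /set_mem; exact: qr.
Qed.

Lemma L2D q r : L2 q -> L2 r -> L2 (fun x => q x + r x).
Proof. by move=> qL rL; apply: eq_L2 (L2_lin 1 qL rL) => x _; rewrite mul1r. Qed.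

Lemma L2B q r : L2 q -> L2 r -> L2 (fun x => q x - r x).
Proof. by move=> qL rL; apply: eq_L2 (L2_lin (-1) rL qL) => x _; ring. Qed.

Lemma L2Z a q : L2 q -> L2 (fun x => a * q x).
Proof. by move=> qL; apply: eq_L2 (L2_lin a qL L2_0) => x _; rewrite addr0. Qed.

Lemma L2_sum n (q : 'I_n -> 'rV[R]_d -> R) : (forall i, L2 (q i)) ->
  L2 (fun x => \sum_(i < n) q i x).
Proof.
elim: n q => [|n IH] q qL; first by apply: eq_L2 L2_0 => x _; rewrite big_ord0.
apply: eq_L2 (L2D (IH (fun i => q (widen_ord (leqnSn n) i)) (fun i => qL _)) (qL ord_max)) => x _.
by rewrite big_ord_recr.
Qed.

Lemma innerC q r : inner q r = inner r q.
Proof. by rewrite !innerE; apply: eq_Rintegral => x _; rewrite mulrC. Qed.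

Lemma eq_inner q q' r : (forall x, Omega x -> q x = q' x) -> inner q r = inner q' r.
Proof.
move=> qq; rewrite !innerE; apply: eq_Rintegral => x _; congr (_ * _).
by rewrite !restrictE; case: ifPn => // /set_mem; exact: qq.
Qed.

Lemma inner_lin a q r w : L2 q -> L2 r -> L2 w ->
  inner (fun x => a * q x + r x) w = a * inner q w + inner r w.
Proof.
move=> qL rL wL; have iq := L2_integrable_mul qL wL; have ir := L2_integrable_mul rL wL.
rewrite !innerE -RintegralZl// -RintegralD//; last exact: (integrableZl _ a iq).
apply: eq_Rintegral => x _; rewrite !restrictE; case: ifP => _; ring.
Qed.

Lemma innerDl q r w : L2 q -> L2 r -> L2 w ->
  inner (fun x => q x + r x) w = inner q w + inner r w.
Proof.
move=> qL rL wL; rewrite -[inner q w]mul1r -inner_lin//.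
by apply: eq_inner => x _; rewrite mul1r.
Qed.

Lemma innerBl q r w : L2 q -> L2 r -> L2 w ->
  inner (fun x => q x - r x) w = inner q w - inner r w.
Proof.
move=> qL rL wL; rewrite addrC -mulN1r -inner_lin//.
by apply: eq_inner => x _; ring.
Qed.

Lemma inner0l w : inner (cst 0) w = 0.
Proof.
rewrite innerE (@eq_Rintegral _ _ _ mu setT (cst 0)).
  by rewrite Rintegral_cst// mul0r.
by move=> x _; rewrite restrictE /= if_same mul0r.
Qed.

Lemma innerZl a q w : L2 q -> L2 w -> inner (fun x => a * q x) w = a * inner q w.
Proof.
move=> qL wL; rewrite -[RHS]addr0 -(inner0l w) -inner_lin//; last exact: L2_0.
by apply: eq_inner => x _; rewrite addr0.
Qed.

Lemma inner_suml n (q : 'I_n -> 'rV[R]_d -> R) w : (forall i, L2 (q i)) -> L2 w ->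
  inner (fun x => \sum_(i < n) q i x) w = \sum_(i < n) inner (q i) w.
Proof.
move=> + wL; elim: n q => [|n IH] q qL.
  by rewrite [RHS]big_ord0 -[RHS](inner0l w); apply: eq_inner => x _; rewrite big_ord0.
rewrite big_ord_recr/= -IH// -innerDl//; last exact: L2_sum.
by apply: eq_inner => x _; rewrite big_ord_recr.
Qed.

Lemma inner_ge0 q : 0 <= inner q q.
Proof. by rewrite innerE; apply: Rintegral_ge0 => x _; rewrite -expr2 sqr_ge0. Qed.

Lemma innerBB q r : L2 q -> L2 r ->
  inner (fun x => q x - r x) (fun x => q x - r x) = inner q q - 2 * inner q r + inner r r.
Proof.
move=> qL rL; have qrL := L2B qL rL.
rewrite innerBl// innerC (innerC r) !innerBl// (innerC r q); ring.
Qed.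

Lemma inner_cauchy_schwarz q r : L2 q -> L2 r -> inner q r ^+ 2 <= inner q q * inner r r.
Proof.
move=> qL rL.
have H a : 0 <= inner q q - 2 * a * inner q r + a ^+ 2 * inner r r.
  have arL := L2Z a rL; have := inner_ge0 (fun x => q x - a * r x).
  rewrite innerBB// innerC (innerZl a rL qL) (innerZl a rL arL) innerC (innerC r).
  by rewrite (innerZl a rL rL); congr (_ <= _); ring.
have q0 := inner_ge0 q; have r0 := inner_ge0 r.
have [rr0|rr0] := eqVneq (inner r r) 0.
  rewrite rr0 mulr0; have [->|qr0] := eqVneq (inner q r) 0; first by rewrite expr0n.
  (* When [inner r r = 0] the quadratic in [a] is affine, and it is negative at this value of
     [a]. *)
  have := H ((inner q q + 1) / inner q r); rewrite rr0 mulr0 addr0 -mulrA divfK//; lra.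
have := H (inner q r / inner r r).
have -> : inner q q - 2 * (inner q r / inner r r) * inner q r +
   (inner q r / inner r r) ^+ 2 * inner r r =
   (inner q q * inner r r - inner q r ^+ 2) / inner r r by field.
have rp : 0 < inner r r by rewrite lt_neqAle eq_sym rr0.
by rewrite pmulr_lge0 ?invr_gt0// subr_ge0.
Qed.

(** The parallelogram identity, with the square of [q - r] dropped. *)
Lemma innerDD_le q r : L2 q -> L2 r ->
  inner (fun x => q x + r x) (fun x => q x + r x) <= 2 * inner q q + 2 * inner r r.
Proof.
move=> qL rL; have qrL := L2D qL rL.
have := inner_ge0 (fun x => q x - r x); rewrite innerBB//.
have -> : inner (fun x => q x + r x) (fun x => q x + r x) =
    inner q q + 2 * inner q r + inner r r.
  rewrite (innerDl qL rL qrL) innerC (innerDl qL rL qL) innerC.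
  by rewrite (innerC r (fun x => _)) (innerDl qL rL rL); ring.
lra.
Qed.

Lemma L2_normE q : L2 q -> L2_norm Omega q = (Num.sqrt (inner q q))%:E.
Proof.
move=> qL; have iqq := L2_integrable_mul qL qL.
rewrite /L2_norm unlock /Lnorm innerE.
have -> : (\int[mu]_x (`|(EFin \o q \_ Omega) x| `^ 2) =
   (\int[mu]_x ((q \_ Omega) x * (q \_ Omega) x))%:E)%E.
  rewrite /Rintegral fineK; last exact: integrable_fin_num.
  apply: eq_integral => x _.
  by rewrite /= powR_mulrn// real_normK ?num_real// expr2.
by rewrite poweR_EFin -powR12_sqrt// -innerE inner_ge0.
Qed.

Lemma L2_norm_cvg0 (q : nat -> 'rV[R]_d -> R) : (forall n, L2 (q n)) ->
  L2_norm Omega (q n) @[n --> \oo] --> 0%E <-> inner (q n) (q n) @[n --> \oo] --> 0.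
Proof.
move=> qL; under eq_fun do rewrite L2_normE//.
split.
  move=> /fine_cvgP[_ /= H].
  have : Num.sqrt (inner (q n) (q n)) * Num.sqrt (inner (q n) (q n)) @[n --> \oo] --> (0 * 0 : R).
    exact: cvgM.
  rewrite mulr0; apply: cvg_trans; apply: near_eq_cvg; apply: nearW => n.
  by rewrite -expr2 sqr_sqrtr// inner_ge0.
move=> H; apply: cvg_EFin; first exact: nearW.
rewrite -(@sqrtr0 R); apply: continuous_cvg => //; exact: sqrt_continuous.
Qed.

End L2_space.

Section series.
Context {R : realType}.

Lemma nneseries_le (u : nat -> \bar R) (M : \bar R) : (forall n, 0 <= u n)%E ->
  (forall n, (\sum_(0 <= i < n) u i)%R <= M)%E -> (\sum_(0 <= i <oo) u i <= M)%E.
Proof.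
move=> u0 uM; apply: lime_le; last exact: nearW.
by apply: is_cvg_nneseries.
Qed.

Lemma nneseries_term_le (u : nat -> \bar R) k : (forall n, 0 <= u n)%E ->
  (u k <= \sum_(0 <= i <oo) u i)%E.
Proof.
move=> u0; apply: le_trans (nneseries_lim_ge k.+1 (fun n _ _ => u0 n)).
by rewrite big_nat_recr//= leeDr// sume_ge0.
Qed.

Lemma sum_halves_le n : (\sum_(0 <= k < n) 2^-1 ^+ k <= 2 :> R).
Proof.
suff -> : \sum_(0 <= k < n) 2^-1 ^+ k = 2 - 2 * 2^-1 ^+ n :> R.
  by rewrite lerBlDr lerDl mulr_ge0// exprn_ge0// invr_ge0.
elim: n => [|n IH]; first by rewrite big_nil expr0; lra.
by rewrite big_nat_recr//= IH exprS; lra.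
Qed.

Lemma geometric_limit (f : nat -> R) (M : R) :
  (forall k, `|f k.+1 - f k| <= M * 2^-1 ^+ k) ->
  cvgn f /\ forall k, `|limn f - f k| <= 2 * M * 2^-1 ^+ k.
Proof.
move=> fM.
have bnd k m : `|f (k + m)%N - f k| <= 2 * M * 2^-1 ^+ k - 2 * M * 2^-1 ^+ (k + m).
  elim: m => [|m IH]; first by rewrite addn0 !subrr normr0.
  rewrite addnS; have := fM (k + m)%N; rewrite exprS.
  have := ler_normD (f (k + m).+1 - f (k + m)%N) (f (k + m)%N - f k).
  rewrite [X in `|X| <= _](_ : _ = f (k + m).+1 - f k); last by rewrite addrA subrK.
  by move: (2^-1 ^+ (k + m)) (2^-1 ^+ k) IH => u v; lra.
have M0 : 0 <= M by have := fM 0%N; rewrite expr0 mulr1; apply: le_trans.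
have bnd' k m : (k <= m)%N -> `|f m - f k| <= 2 * M * 2^-1 ^+ k.
  move=> km; rewrite -(subnKC km); apply: le_trans (bnd _ _) _.
  by rewrite lerBlDr lerDl !mulr_ge0// exprn_ge0// invr_ge0.
have coef : cvgn f.
  rewrite (_ : f = (fun n => f 0%N + series (fun k => f k.+1 - f k) n)).
    apply: is_cvgD; first exact: is_cvg_cst.
    apply: normed_cvg; apply: (@series_le_cvg _ _ (geometric M 2^-1)).
    - by move=> n; exact: normr_ge0.
    - by move=> n; rewrite /= mulr_ge0// exprn_ge0// invr_ge0.
    - exact: fM.
    - by apply: is_cvg_geometric_series; rewrite ger0_norm ?invr_ge0// invf_lt1// ltr1n.
  by apply/funext => n; rewrite /series/= telescope_sumr// addrC subrK.
split => // k; have : `|f n - f k| @[n --> \oo] --> `|limn f - f k|.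
  by apply: cvg_norm; apply: cvgB => //; exact: cvg_cst.
move=> /cvgr_to_le; apply; near=> n; apply: bnd'; near: n; exact: nbhs_infty_ge.
Unshelve. all: end_near. Qed.

End series.

(** * Completeness of L^2(Omega) *)

Section L2_complete.
Context {R : realType} {d : nat} {Omega : set 'rV[R]_d}.
Notation mu := (lebesgue_rV R d).
Notation L2 := (L2 Omega).
Notation inner := (inner Omega).
Implicit Types (p q r w : 'rV[R]_d -> R) (a b : R) (c : nat -> R).

Lemma EFin_inner q : L2 q ->
  (inner q q)%:E = (\int[mu]_x ((q \_ Omega) x ^+ 2)%:E)%E.
Proof.
move=> qL; rewrite innerE /Rintegral fineK//.
  exact: (integrable_fin_num _ (L2_integrable_mul qL qL)).
Qed.

(* H = sum_k 4^k (f_(k+1) - f_k)^2 has a finite integral; where H is finite, f_k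
   converges to q with (q - f_k)^2 <= 4 * 4^-k * H. *)
Lemma L2_fast_cauchy (f : nat -> 'rV[R]_d -> R) : (forall k, L2 (f k)) ->
  (forall k, inner (fun x => f k.+1 x - f k x) (fun x => f k.+1 x - f k x) <= 8^-1 ^+ k) ->
  exists2 q, L2 q & forall k,
    inner (fun x => q x - f k x) (fun x => q x - f k x) <= 8 * 4^-1 ^+ k.
Proof.
move=> fL fC; pose g k := f k \_ Omega.
have mg k : measurable_fun setT (g k) by exact: L2_measurable.
(* Of the rate [8^-1 ^+ k], the weight [4 ^+ k] leaves [2^-1 ^+ k], which sums the integrals to at
   most 2; the square root of the weight gives the pointwise increments the summable factor
   [2^-1 ^+ k]. *)
pose h k x : \bar R := (4 ^+ k * (g k.+1 x - g k x) ^+ 2)%:E.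
have h0 k x : (0 <= h k x)%E by rewrite lee_fin mulr_ge0 ?sqr_ge0// exprn_ge0.
have mh k : measurable_fun setT (h k).
  by apply/measurable_EFinP; apply: measurable_funM => //; apply: measurable_funX; exact: measurable_funB.
pose H x : \bar R := (\sum_(0 <= k <oo) h k x)%E.
have H0 x : (0 <= H x)%E by apply: nneseries_ge0.
have mH : measurable_fun setT H by apply: ge0_emeasurable_sum => //.
have intH : (\int[mu]_x H x <= 2%:E)%E.
  rewrite /H integral_nneseries//; apply: nneseries_le => [k|n].
    exact: integral_ge0.
  apply: le_trans (_ : (\sum_(0 <= k < n) (2^-1 ^+ k)%:E)%R <= _)%E; last first.
    by rewrite sumEFin lee_fin sum_halves_le.
  apply: lee_sum => k _; rewrite /h; under eq_integral do rewrite EFinM.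
  have fkL := L2B (fL k.+1) (fL k).
  rewrite ge0_integralZl ?lee_fin ?exprn_ge0//; first last.
  - by move=> x _; rewrite lee_fin sqr_ge0.
  - by apply/measurable_EFinP; apply: measurable_funX; exact: measurable_funB.
  have -> : (\int[mu]_x ((g k.+1 x - g k x) ^+ 2)%:E)%E =
      (inner (fun x => f k.+1 x - f k x) (fun x => f k.+1 x - f k x))%:E.
    rewrite EFin_inner//; apply: eq_integral => x _.
    by rewrite /g !restrictE; case: ifP => // _; rewrite subrr.
  rewrite -EFinM lee_fin; apply: le_trans (ler_wpM2l (exprn_ge0 _ _) (fC k)) _ => //.
  by rewrite -exprMn lerXn2r// ?nnegrE; lra.
have key x : (H x < +oo)%E -> let M := Num.sqrt (fine (H x)) in
    forall k, `|g k.+1 x - g k x| <= M * 2^-1 ^+ k.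
  move=> Hoo M k; have Hf : H x \is a fin_num by rewrite ge0_fin_numE.
  have : (h k x <= H x)%E by apply: nneseries_term_le.
  rewrite -(fineK Hf) lee_fin => hM.
  rewrite -ler_sqr ?nnegrE ?mulr_ge0 ?sqrtr_ge0 ?exprn_ge0 ?invr_ge0//.
  rewrite exprMn sqr_sqrtr ?fine_ge0// real_normK ?num_real// -exprM mulnC exprM.
  have -> : (2^-1 ^+ 2 : R) ^+ k = (4 ^+ k)^-1 by rewrite -exprVn; congr (_ ^+ _); field.
  by rewrite ler_pdivlMr ?exprn_gt0// mulrC.
pose E : set 'rV[R]_d := [set x | (H x < +oo)%E].
have mE : measurable E by rewrite -[E]setTI; exact: emeasurable_fun_infty_o.
(* Where [H] is infinite the default value 0 is harmless: the bound [qH] is trivial there. *)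
pose q x := if x \in E then limn (g ^~ x) else 0.
have qE x : E x -> q x = limn (g ^~ x) by move=> Ex; rewrite /q mem_set.
have mq : measurable_fun setT q.
  apply: (@measurable_fun_cvg _ _ _ _ (fun k x => \1_E x * g k x)) => [k|x _].
    by apply: measurable_funM => //; exact: measurable_indic.
  rewrite /q indicE; case: ifPn => [/set_mem Ex|_]; last first.
    by under eq_fun do rewrite mul0r; exact: cvg_cst.
  by under eq_fun do rewrite mul1r; exact: (geometric_limit (key x Ex)).1.
have qO : q \_ Omega = q.
  apply/funext => x; rewrite restrictE; case: ifPn => // xO.
  have g0 : g ^~ x = cst 0 by apply/funext => k; rewrite /g restrictE (negbTE xO).
  by rewrite /q g0 lim_cst// if_same.
have qg k : (fun x => q x - f k x) \_ Omega = (fun x => q x - g k x).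
  apply/funext => x; rewrite -[in RHS]qO /g !restrictE; case: ifP => // _.
  by rewrite subrr.
have qH k x : (((q x - g k x) ^+ 2)%:E <= (4 * 4^-1 ^+ k)%:E * H x)%E.
  have [Hoo|] := ltP (H x) +oo%E; last first.
    rewrite leye_eq => /eqP ->; rewrite gt0_muley ?leey//.
  have Hf : H x \is a fin_num by rewrite ge0_fin_numE.
  have := (geometric_limit (key x Hoo)).2 k; rewrite -qE// -{2}(fineK Hf) -EFinM lee_fin.
  have := fine_ge0 (H0 x); set M := fine (H x) => M0 qM.
  rewrite -real_normK ?num_real//.
  have /le_trans : `|q x - g k x| ^+ 2 <= (2 * Num.sqrt M * 2^-1 ^+ k) ^+ 2.
    by rewrite lerXn2r// nnegrE !mulr_ge0// exprn_ge0// invr_ge0.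
  apply; rewrite !exprMn sqr_sqrtr// -exprM mulnC exprM.
  rewrite (_ : (2^-1 ^+ 2 : R) = 4^-1) 1?le_eqVlt; last by field.
  by apply/orP; left; apply/eqP; ring.
have intq k : (\int[mu]_x (((q x - g k x) ^+ 2)%:E) <= (8 * 4^-1 ^+ k)%:E)%E.
  apply: le_trans (_ : (4 * 4^-1 ^+ k)%:E * \int[mu]_x H x <= _)%E.
    rewrite -ge0_integralZl// ?lee_fin ?mulr_ge0 ?exprn_ge0 ?invr_ge0//.
    apply: ge0_le_integral => //.
    - by move=> x _; rewrite lee_fin sqr_ge0.
    - by apply/measurable_EFinP; apply: measurable_funX; exact: measurable_funB.
    - exact: measurable_funeM.
  apply: le_trans (lee_wpmul2l _ intH) _.
    by rewrite lee_fin mulr_ge0// exprn_ge0// invr_ge0.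
  by rewrite -EFinM lee_fin; lra.
have qfL k : L2 (fun x => q x - f k x).
  apply/L2P; rewrite qg; split; first exact: measurable_funB.
  apply/integrableP; split.
    by apply/measurable_EFinP; apply: measurable_funX; exact: measurable_funB.
  under eq_integral do rewrite /= ger0_norm ?sqr_ge0//.
  exact: le_lt_trans (intq k) (ltry _).
exists q.
  by apply: eq_L2 (L2D (qfL 0%N) (fL 0%N)) => x _; rewrite subrK.
by move=> k; rewrite -lee_fin EFin_inner// qg.
Qed.
End L2_complete.

(** * Orthonormal expansions: Parseval and Riesz-Fischer *)

Section orthonormal.
Context {R : realType} {d : nat} {Omega : set 'rV[R]_d}.
Variable phi : nat -> 'rV[R]_d -> R.
Hypothesis onb : orthonormal_basis Omega phi.
Notation mu := (lebesgue_rV R d).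
Notation L2 := (L2 Omega).
Notation inner := (inner Omega).
Implicit Types (p q r w : 'rV[R]_d -> R) (a b : R) (c : nat -> R).

Definition comb n c x : R := \sum_(i < n) c i * phi i x.

Lemma basis_L2 i : L2 (phi i). Proof. by case: onb. Qed.

Lemma comb_L2 n c : L2 (comb n c).
Proof. by apply: L2_sum => i; apply: L2Z; exact: basis_L2. Qed.

Lemma inner_comb n c w : L2 w -> inner (comb n c) w = \sum_(i < n) c i * inner (phi i) w.
Proof.
move=> wL; rewrite inner_suml//; last by move=> i; apply: L2Z; exact: basis_L2.
by apply: eq_bigr => i _; rewrite innerZl//; exact: basis_L2.
Qed.

Lemma inner_comb_phi n c j : inner (comb n c) (phi j) = if (j < n)%N then c j else 0.
Proof.
rewrite inner_comb; last exact: basis_L2.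
have o i : inner (phi i) (phi j) = (i == j)%:R by case: onb.
case: ltnP => jn.
  rewrite (bigD1 (Ordinal jn))//= o eqxx mulr1 big1 ?addr0// => i ij.
  by rewrite o; case: eqVneq => [ji|]; rewrite ?mulr0//; move/eqP: ij; case; exact: val_inj.
rewrite big1// => i _; rewrite o; case: eqVneq => [ij|]; last by rewrite mulr0.
by move: (ltn_ord i); rewrite ij ltnNge jn.
Qed.

Lemma inner_combl n c q : L2 q -> (forall i, inner q (phi i) = c i) ->
  inner q (comb n c) = \sum_(i < n) c i ^+ 2.
Proof.
move=> qL qc; rewrite innerC inner_comb//; apply: eq_bigr => i _.
by rewrite innerC qc expr2.
Qed.

Lemma inner_comb_comb n m c : (n <= m)%N ->
  inner (comb n c) (comb m c) = \sum_(i < n) c i ^+ 2.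
Proof.
move=> nm; rewrite inner_comb; last exact: comb_L2.
apply: eq_bigr => i _; rewrite innerC inner_comb_phi.
by rewrite (leq_trans (ltn_ord i) nm) expr2.
Qed.

Lemma inner_combB n m c : (n <= m)%N ->
  inner (fun x => comb m c x - comb n c x) (fun x => comb m c x - comb n c x) =
  \sum_(i < m) c i ^+ 2 - \sum_(i < n) c i ^+ 2.
Proof.
move=> nm; rewrite innerBB; try exact: comb_L2.
by rewrite (innerC (comb m c)) !inner_comb_comb//; ring.
Qed.

Lemma inner_proj n q : L2 q -> let P := comb n (fun i => inner q (phi i)) in
  inner (fun x => q x - P x) (fun x => q x - P x) =
  inner q q - \sum_(i < n) inner q (phi i) ^+ 2.
Proof.
move=> qL P; rewrite innerBB//; last exact: comb_L2.
by rewrite inner_comb_comb// (inner_combl n (c := fun i => inner q (phi i)))//; ring.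
Qed.

Lemma proj_cvg q : L2 q ->
  inner q q - \sum_(i < n) inner q (phi i) ^+ 2 @[n --> \oo] --> 0.
Proof.
move=> qL; case: onb => _ _ /(_ q qL) H.
have := (L2_norm_cvg0 (fun n => L2B qL (comb_L2 n (fun i => inner q (phi i))))).1 H.
by under eq_fun do rewrite inner_proj//.
Qed.

Lemma parseval q : L2 q ->
  (\sum_(0 <= i <oo) (inner q (phi i) ^+ 2)%:E)%E = (inner q q)%:E.
Proof.
move=> qL; apply/cvg_lim => //.
apply: (@cvg_trans _ ((fun n => (\sum_(i < n) inner q (phi i) ^+ 2)%:E) @ \oo)).
  by apply: near_eq_cvg; near=> n; rewrite big_mkord sumEFin.
apply: cvg_EFin; first exact: nearW.
rewrite -[X in _ --> X]subr0 (_ : _ \o _ =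
    (fun n => inner q q - (inner q q - \sum_(i < n) inner q (phi i) ^+ 2))).
  by apply: cvgB; [exact: cvg_cst|exact: proj_cvg].
by apply/funext => n; rewrite /= subKr.
Unshelve. all: end_near. Qed.

Lemma L2_eq0 q : L2 q -> (forall i, inner q (phi i) = 0) -> inner q q = 0.
Proof.
move=> qL q0; apply: EFin_inj; rewrite -parseval//.
by apply: eseries0 => i _ _; rewrite q0 expr0n.
Qed.

(** The partial sums are Cauchy; the rate asked by [L2_fast_cauchy] is reached along indices [nk k]
    at which the tail of the series is at most [8^-1 ^+ k]. Cauchy-Schwarz against [phi i] then
    identifies the coefficients of the limit. *)
Lemma riesz_fischer c : (\sum_(0 <= i <oo) (c i ^+ 2)%:E < +oo)%E ->
  exists2 q, L2 q & forall i, inner q (phi i) = c i.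
Proof.
move=> coo; pose p n := \sum_(i < n) c i ^+ 2.
have p_mono : {homo p : n m / (n <= m)%N >-> n <= m}.
  move=> n m nm; rewrite /p -!(big_mkord xpredT (fun i => c i ^+ 2)).
  rewrite (@big_cat_nat _ _ _ n 0 m)//= lerDl; apply: sumr_ge0 => i _; exact: sqr_ge0.
pose s := fine (\sum_(0 <= i <oo) (c i ^+ 2)%:E)%E.
have ps n : p n <= s.
  rewrite -lee_fin /s fineK; last first.
    by rewrite ge0_fin_numE// nneseries_ge0// => i _; rewrite lee_fin sqr_ge0.
  rewrite /p -sumEFin -(big_mkord xpredT (fun i => (c i ^+ 2)%:E)).
  by apply: nneseries_lim_ge => i _ _; rewrite lee_fin sqr_ge0.
have cp : p @ \oo --> limn p.
  by apply: nondecreasing_is_cvgn => //; exists s => _ [n _ <-].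
set l := limn p in cp.
have pl n : p n <= l by apply: nondecreasing_cvgn_le => //; apply/cvg_ex; exists l.
have [nk nkP] : {nk : nat -> nat & forall k, (k <= nk k)%N /\ l - p (nk k) <= 8^-1 ^+ k}.
  apply: (@boolp.choice _ _ (fun k n => (k <= n)%N /\ l - p n <= 8^-1 ^+ k)) => k.
  have /cvgrPdist_le/(_ (8^-1 ^+ k)) := cp.
  rewrite exprn_gt0 ?invr_gt0// => /(_ isT)[N _ NP].
  exists (maxn k N); split; first exact: leq_maxl.
  by have := NP (maxn k N) (leq_maxr _ _); rewrite ger0_norm// subr_ge0.
have fC k : inner (fun x => comb (nk k.+1) c x - comb (nk k) c x)
    (fun x => comb (nk k.+1) c x - comb (nk k) c x) <= 8^-1 ^+ k.
  have [_ h1] := nkP k; have [_ h2] := nkP k.+1.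
  have h3 := pl (nk k); have h4 := pl (nk k.+1).
  (* Nothing makes [nk] monotone. In either order the squared distance is a difference of two
     partial sums of squares, at most the tail beyond the smaller index. *)
  have [nm|/ltnW nm] := leqP (nk k) (nk k.+1).
    by rewrite inner_combB//; rewrite -/(p _) -/(p _); lra.
  rewrite (_ : inner _ _ = inner (fun x => comb (nk k) c x - comb (nk k.+1) c x)
    (fun x => comb (nk k) c x - comb (nk k.+1) c x)); last first.
    by rewrite !innerE; apply: eq_Rintegral => x _; rewrite !restrictE; case: ifP => _ //; ring.
  rewrite inner_combB//; rewrite -/(p _) -/(p _).
  have : 8^-1 ^+ k.+1 <= 8^-1 ^+ k :> R.
    by rewrite exprS ler_piMl ?exprn_ge0 ?invr_ge0// invf_le1// ler1n.
  lra.
have [q qL qC] := L2_fast_cauchy (fun k => comb_L2 (nk k) c) fC.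
exists q => // i; apply/eqP; rewrite -subr_eq0 -sqrf_eq0; apply/eqP.
apply/eqP; rewrite eq_le sqr_ge0 andbT; apply/ler_addgt0Pl => e e0; rewrite addr0.
have /cvgrPdist_le/(_ e e0)[N _ NP] : 8 * 4^-1 ^+ k @[k --> \oo] --> (8 * 0 : R).
  apply: cvgM; first exact: cvg_cst.
  by apply: cvg_expr; rewrite ger0_norm ?invr_ge0// invf_lt1// ltr1n.
(* As [nk k >= k > i], the combination of index [nk k] already has the coefficient [c i] along
   [phi i]. *)
pose k := maxn N i.+1; have := NP k (leq_maxl _ _).
rewrite mulr0 sub0r normrN ger0_norm ?mulr_ge0 ?exprn_ge0 ?invr_ge0//.
apply: le_trans; apply: le_trans (qC k).
have kL := comb_L2 (nk k) c; have qkL := L2B qL kL.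
have := inner_cauchy_schwarz qkL (basis_L2 i).
have -> : inner (phi i) (phi i) = 1 by case: onb => _ -> _; rewrite eqxx.
rewrite mulr1 innerBl//; last exact: basis_L2.
rewrite inner_comb_phi (leq_trans _ (nkP k).1)//.
exact: leq_maxr.
Qed.

End orthonormal.

(** * Bochner measurability *)

Section simple_functions.
Context {R : realType} {d : nat} {Omega : set 'rV[R]_d}.
Notation L2 := (L2 Omega).
Notation inner := (inner Omega).
Notation simple_L2 := (simple_L2 Omega).
Implicit Types (g h : R -> 'rV[R]_d -> R) (w : 'rV[R]_d -> R).

Lemma simple_L2_indic (A : set R) w : measurable (A : set (measurableTypeR R)) -> L2 w ->
  simple_L2 (fun t x => \1_A t * w x).
Proof.
move=> mA wL; exists 1%N, (fun=> A), (fun=> w); split => // t x.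
by rewrite big_ord1.
Qed.

Lemma simple_L2D g h : simple_L2 g -> simple_L2 h -> simple_L2 (fun t x => g t x + h t x).
Proof.
move=> [n [A [v [mA vL gE]]]] [m [B [w [mB wL hE]]]].
exists (n + m)%N, (fun j => match fintype.split j with inl i => A i | inr i => B i end).
exists (fun j => match fintype.split j with inl i => v i | inr i => w i end); split.
- by move=> j; case: fintype.split.
- by move=> j; case: fintype.split.
- move=> t x; rewrite gE hE big_split_ord/=; congr (_ + _); apply: eq_bigr => i _.
    by rewrite (unsplitK (inl i)).
  by rewrite (unsplitK (inr i)).
Qed.

Lemma simple_L2_sum n (g : 'I_n -> R -> 'rV[R]_d -> R) : (forall i, simple_L2 (g i)) ->
  simple_L2 (fun t x => \sum_(i < n) g i t x).
Proof.
elim: n g => [|n IH] g sg.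
  exists 0%N, (fun=> set0), (fun=> cst 0); split => // [j|t x]; first exact: L2_0.
  by rewrite !big_ord0.
have := simple_L2D (IH (fun i => g (widen_ord (leqnSn n) i)) (fun i => sg _)) (sg ord_max).
congr (simple_L2 _); apply/funext => t; apply/funext => x.
by rewrite big_ord_recr.
Qed.

Lemma simple_L2_measurable g w : simple_L2 g -> L2 w ->
  measurable_fun setT (fun t : measurableTypeR R => inner (g t) w).
Proof.
move=> [n [A [v [mA vL gE]]]] wL.
rewrite (_ : (fun t => _) = (fun t => \sum_(j < n) \1_(A j) t * inner (v j) w)).
  by apply: measurable_sum => j; apply: measurable_funM.
apply/funext => t; under eq_bigr do rewrite -innerZl//.
rewrite -inner_suml//; last by move=> i; exact: L2Z.
by apply: eq_inner => x _; rewrite gE.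
Qed.

Lemma simple_L2_L2 g t : simple_L2 g -> L2 (g t).
Proof.
move=> [n [A [v [mA vL gE]]]].
apply: (@eq_L2 _ _ _ (fun x => \sum_(j < n) \1_(A j) t * v j x)) => [x _|].
  by rewrite gE.
by apply: L2_sum => j; exact: L2Z.
Qed.

End simple_functions.

Section quantization.
Context {R : realType}.
Implicit Types (h z : R).

(* Rounds z <= N h to a multiple of h. Being a sum of indicators of superlevel
   sets, it turns a measurable function into a simple one. *)
Definition staircase h N z := \sum_(j < N) h * (j.+1%:R * h <= z)%R%:R.

Lemma staircase_full h N z : 0 < h -> N%:R * h <= z -> staircase h N z = N%:R * h.
Proof.
move=> h0; elim: N => [|N IH] Nz; first by rewrite /staircase big_ord0 mul0r.
rewrite /staircase big_ord_recr/= Nz mulr1 -/(staircase h N z) IH.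
  by rewrite -natr1 mulrDl mul1r.
by apply: le_trans Nz; rewrite ler_wpM2r ?(ltW h0)// ler_nat.
Qed.

Lemma staircase_approx h N z : 0 < h -> 0 <= z -> z <= N%:R * h ->
  `|staircase h N z - z| <= h.
Proof.
move=> h0 z0; elim: N => [|N IH] zN.
  by move: zN; rewrite mul0r => zN; rewrite /staircase big_ord0 ler_norml; apply/andP; split; lra.
have [Nz|zN1] := leP (N.+1%:R * h) z.
  by rewrite staircase_full// ler_norml; move: (_ * h) zN Nz => y; lra.
have E : staircase h N.+1 z = staircase h N z.
  by rewrite /staircase big_ord_recr/= leNgt zN1 mulr0 addr0.
rewrite E; have [zN2|/ltW Nz] := leP z (N%:R * h); first exact: IH.
rewrite staircase_full//; move: zN1; rewrite -natr1 mulrDl mul1r ler_norml.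
by move: (_ * h) Nz => y; lra.
Qed.

End quantization.

Section strong_measurability.
Context {R : realType} {d : nat} {Omega : set 'rV[R]_d}.
Variables (phi : nat -> 'rV[R]_d -> R) (T : R).
Hypotheses (onb : orthonormal_basis Omega phi) (T0 : 0 < T).
Notation L2 := (L2 Omega).
Notation inner := (inner Omega).
Notation lm := (@lebesgue_measure R).
Implicit Types (g h : R -> 'rV[R]_d -> R) (w : 'rV[R]_d -> R).

(** By Cauchy-Schwarz, convergence of the simple functions in L^2(Omega) implies that of their inner
    products with [w], which are measurable. *)
Lemma strongly_measurable_inner g w : strongly_measurable Omega T g ->
  (forall t : R, t \in `[0, T] -> L2 (g t)) -> L2 w ->
  measurable_fun (`[0, T]%classic : set (measurableTypeR R)) (fun t => inner (g t) w).
Proof.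
move=> [s [ss sg]] gL wL.
apply: (@measurable_fun_cvg _ _ _ _ (fun n t => inner (s n t) w)) => [n|t tT].
  apply: measurable_funTS; exact: simple_L2_measurable.
have snL n : L2 (s n t \- g t) by apply: L2B; [exact: simple_L2_L2|exact: gL].
have /(L2_norm_cvg0 snL) H := sg t tT.
apply/cvgrPdist_le => e e0.
have w0 := inner_ge0 (Omega := Omega) w.
(* The added 1 covers the case [inner w w = 0]. *)
have e1 : 0 < e ^+ 2 / (inner w w + 1) by rewrite divr_gt0 ?exprn_gt0//; lra.
have /cvgrPdist_le/(_ _ e1)[N _ NP] := H; exists N => // n Nn /=.
have := NP n Nn; rewrite sub0r normrN ger0_norm ?inner_ge0// ler_pdivlMr; last by lra.
have := inner_cauchy_schwarz (snL n) wL.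
rewrite (innerBl (simple_L2_L2 t (ss n)) (gL t tT) wL) => cs le.
rewrite -ler_sqr ?nnegrE ?(ltW e0)// real_normK ?num_real// -sqrrN opprB.
apply: le_trans cs (le_trans _ le); rewrite mulrDr mulr1 lerDl.
exact: inner_ge0.
Qed.

(** Pettis' theorem in coordinates: the [n]-th simple function keeps the first [n] coefficients,
    rounded by a staircase of step 1/(n+1) on the range [[- n, n]]. *)
Lemma coefs_strongly_measurable g :
  (forall t : R, t \in `[0, T] -> L2 (g t)) ->
  (forall i, measurable_fun (`[0, T]%classic : set (measurableTypeR R))
               (fun t => inner (g t) (phi i))) ->
  strongly_measurable Omega T g.
Proof.
move=> gL mg.
(* So many steps of height 1/(n+1) cover [[0, 2 n]], the range of a coefficient of [[- n, n]]
   shifted by [n]. The shift makes the argument of the staircase nonnegative and is undone in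
   [c]. *)
pose N n := (2 * n * n.+1)%N.
pose A n i j : set R := `[0, T]%classic `&`
  [set t | j.+1%:R * n.+1%:R^-1 <= inner (g t) (phi i) + n%:R].
have mA n i j : measurable (A n i j : set (measurableTypeR R)).
  have := mg i (measurable_itv _) _
    (measurable_itv `[j.+1%:R * n.+1%:R^-1 - n%:R, +oo[).
  congr (measurable (_ `&` _)); apply/funext => t.
  by rewrite /preimage/= in_itv/= andbT lerBlDr.
pose c n t i : R := \sum_(j < N n) \1_(A n i j) t * n.+1%:R^-1 - n%:R.
exists (fun n t => comb phi n (c n t)); split => [n|t tT].
  rewrite (_ : (fun t => _) = (fun t x => \sum_(i < n) (\sum_(j < N n)
     (\1_(A n i j) t * (n.+1%:R^-1 * phi i x)) + \1_setT t * (- n%:R * phi i x)))).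
    apply: simple_L2_sum => i; apply: simple_L2D.
      apply: simple_L2_sum => j; apply: (simple_L2_indic (mA n i j)).
      by apply: L2Z; exact: basis_L2 onb _.
    by apply: simple_L2_indic => //; apply: L2Z; exact: basis_L2 onb _.
  apply/funext => t; apply/funext => x; rewrite /comb; apply: eq_bigr => i _.
  rewrite /c indicT mul1r mulrBl mulr_suml mulNr; congr (_ - _).
  by apply: eq_bigr => j _; rewrite mulrA.
have sgL n : L2 (comb phi n (c n t) \- g t) by apply: L2B; [exact: comb_L2|exact: gL].
apply/(L2_norm_cvg0 sgL).
pose b i := inner (g t) (phi i).
have cb n i : `|b i| <= n%:R -> `|c n t i - b i| <= n.+1%:R^-1.
  rewrite ler_norml => /andP[b1 b2].
  have -> : c n t i - b i = staircase n.+1%:R^-1 (N n) (b i + n%:R) - (b i + n%:R).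
    rewrite /c /staircase; rewrite (eq_bigr (fun j : 'I_(N n) =>
      n.+1%:R^-1 * (j.+1%:R * n.+1%:R^-1 <= b i + n%:R)%R%:R)); first by ring.
    move=> j _; rewrite mulrC; congr (_ * _); rewrite indicE; congr (_%:R).
    by congr nat_of_bool; apply/idP/idP => [/set_mem[]//|h]; apply/mem_set; split.
  apply: staircase_approx; rewrite ?invr_gt0 ?ltr0n//; first lra.
  rewrite /N natrM -mulrA divff ?pnatr_eq0// mulr1 natrM; lra.
pose P n := comb phi n b.
have PL n : L2 (P n) by exact: comb_L2.
have gg0 := inner_ge0 (Omega := Omega) (g t).
(* The bound is uniform in [i]: for [n] large all the coefficients at time [t] are in the range of
   the staircase. *)
have b_le i : `|b i| <= inner (g t) (g t) + 1.
  have := inner_cauchy_schwarz (gL t tT) (basis_L2 onb i).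
  have -> : inner (phi i) (phi i) = 1 by case: onb => _ -> _; rewrite eqxx.
  rewrite mulr1 -/(b i) -real_normK ?num_real// => h.
  have := sqr_ge0 (`|b i| - 1); rewrite sqrrB1; lra.
have pc := proj_cvg onb (gL t tT).
apply/cvgrPdist_le => e e0; near=> n; rewrite sub0r normrN ger0_norm ?inner_ge0//.
have bn i : `|b i| <= n%:R.
  by apply: le_trans (b_le i) _; near: n; exact: nbhs_infty_ger.
(* The errors of [n] coefficients, at most 1/(n+1) each, have a sum of squares below 1/(n+1): the
   step has to shrink as the number of coefficients grows. *)
have sP : inner (fun x => comb phi n (c n t) x - P n x)
    (fun x => comb phi n (c n t) x - P n x) <= n.+1%:R^-1.
  pose D i := c n t i - b i.
  have DE x : comb phi n (c n t) x - P n x = comb phi n D x.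
    rewrite /comb [RHS](eq_bigr (fun i : 'I_n => c n t i * phi i x - b i * phi i x)).
      by rewrite sumrB.
    by move=> i _; exact: mulrBl.
  have -> : (fun x => comb phi n (c n t) x - P n x) = comb phi n D.
    by apply/funext => x; exact: DE.
  rewrite (inner_comb_comb onb)//.
  apply: le_trans (_ : \sum_(i < n) n.+1%:R^-1 ^+ 2 <= _).
    apply: ler_sum => i _; rewrite -real_normK ?num_real// lerXn2r ?nnegrE//.
    exact: cb.
  rewrite sumr_const card_ord -[leLHS]mulr_natr expr2 -mulrA ler_piMr ?invr_ge0//.
  by rewrite mulrC ler_pdivrMr ?ltr0n// mul1r ler_nat.
have gP : inner (fun x => g t x - P n x) (fun x => g t x - P n x) <= e / 4.
  rewrite (inner_proj onb)//; last exact: gL.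
  rewrite -[leLHS]ger0_norm; last first.
    by rewrite -(inner_proj onb) ?inner_ge0//; exact: gL.
  rewrite -normrN -sub0r; near: n.
  by move/cvgrPdist_le : pc; apply; rewrite divr_gt0.
have ne : n.+1%:R^-1 <= e / 4.
  rewrite -[leLHS]ger0_norm ?invr_ge0// -normrN -sub0r; near: n.
  have := @cvg_harmonic R; move/cvgrPdist_le; apply.
  by rewrite divr_gt0.
have := innerDD_le (L2B (comb_L2 onb n (c n t)) (PL n)) (L2B (PL n) (gL t tT)).
have -> : inner (fun x => P n x - g t x) (fun x => P n x - g t x) =
    inner (fun x => g t x - P n x) (fun x => g t x - P n x).
  by rewrite !innerE; apply: eq_Rintegral => x _; rewrite !restrictE; case: ifP => _ //; ring.
have -> : (fun x => comb phi n (c n t) x - P n x + (P n x - g t x)) =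
    comb phi n (c n t) \- g t by apply/funext => x /=; rewrite addrA subrK.
move: (inner _ _) (inner _ _) (inner _ _) (n.+1%:R^-1) sP gP ne => x y z v; lra.
Unshelve. all: end_near. Qed.

End strong_measurability.

(** * Paths in L^2(Omega) through their coefficients *)

Section square_integrable.
Context {R : realType} {T : R}.
Hypothesis T0 : 0 < T.
Notation L1 := (L1 T).
Notation lm := (@lebesgue_measure R).
Notation msr := (measurable_fun (`[0, T]%classic : set (measurableTypeR R))).
Implicit Types (c e h : R -> R) (s t : R).

Definition sq c : \bar R := (\int[lm]_(t in `[0%R, T]) (c t ^+ 2)%:E)%E.

Lemma measurable_sqr c : msr c -> msr (fun t => (c t ^+ 2)%:E).
Proof. by move=> mc; apply/measurable_EFinP; exact: measurable_funX. Qed.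

Lemma sq_ge0 c : (0 <= sq c)%E.
Proof. by apply: integral_ge0 => t _; rewrite lee_fin sqr_ge0. Qed.

Lemma le_sq c e : msr c -> msr e ->
  (forall t : R, t \in `[0, T] -> `|c t| <= `|e t|) -> (sq c <= sq e)%E.
Proof.
move=> mc me ce; apply: ge0_le_integral => //.
- by move=> t _; rewrite lee_fin sqr_ge0.
- exact: measurable_sqr.
- exact: measurable_sqr.
- move=> t /ce h; rewrite lee_fin -real_normK ?num_real// -[leRHS]real_normK ?num_real//.
  by rewrite lerXn2r// nnegrE.
Qed.

Lemma sq_cst (M : R) : sq (cst M) = (T * M ^+ 2)%:E.
Proof.
rewrite -[LHS]/(\int[lm]_(t in `[0%R, T]) cst (M ^+ 2)%:E t)%E integral_cst//= lebesgue_measure_itv/= lte_fin T0 oppr0 adde0 -EFinM.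
by rewrite mulrC.
Qed.

Lemma sq_bounded c (M : R) : msr c ->
  (forall t : R, t \in `[0, T] -> `|c t| <= M) -> (sq c <= (T * M ^+ 2)%:E)%E.
Proof.
move=> mc cM; rewrite -sq_cst; apply: le_sq => // t tT.
exact: le_trans (cM t tT) (ler_norm _).
Qed.

Lemma sqD c e : msr c -> msr e ->
  (sq (fun t => (c t + e t)%R) <= 2%:E * sq c + 2%:E * sq e)%E.
Proof.
move=> mc me; rewrite -!ge0_integralZl//; first last.
- by move=> t _; rewrite lee_fin sqr_ge0.
- exact: measurable_sqr.
- by move=> t _; rewrite lee_fin sqr_ge0.
- exact: measurable_sqr.
have m1 : msr (fun t => (2%:E * (c t ^+ 2)%:E)%E) by apply: measurable_funeM; exact: measurable_sqr.
have m2 : msr (fun t => (2%:E * (e t ^+ 2)%:E)%E) by apply: measurable_funeM; exact: measurable_sqr.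
rewrite -ge0_integralD//; first last.
- by move=> t _; rewrite -EFinM lee_fin mulr_ge0// sqr_ge0.
- by move=> t _; rewrite -EFinM lee_fin mulr_ge0// sqr_ge0.
apply: ge0_le_integral => //.
- by move=> t _; rewrite lee_fin sqr_ge0.
- by apply: measurable_sqr; exact: measurable_funD.
- exact: emeasurable_funD.
- move=> t _; rewrite -!EFinM -EFinD lee_fin.
  by have := sqr_ge0 (c t - e t); rewrite sqrrB sqrrD; lra.
Qed.

Lemma sqZ (l : R) c : msr c -> sq (fun t => l * c t) = ((l ^+ 2)%:E * sq c)%E.
Proof.
move=> mc; rewrite -ge0_integralZl ?lee_fin ?sqr_ge0//.
- by apply: eq_integral => t _; rewrite exprMn EFinM.
- exact: measurable_sqr.
- by move=> t _; rewrite lee_fin sqr_ge0.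
Qed.

(** Integrating [|c| <= c^2 / M + M] for [M >= N] bounds the L^1 norm by [(1 + T) * M]. As [N] may
    be 0, [M] is taken slightly larger and then decreased to [N]. *)
Lemma sq_norm_bound c (N : R) : msr c -> 0 <= N -> sq c = (N ^+ 2)%:E ->
  L1 c /\ prim (fun s => `|c s|) T <= (1 + T) * N.
Proof.
move=> mc N0 cN.
have H (M : R) : N <= M -> 0 < M ->
    (\int[lm]_(t in `[0%R, T]) `|c t|%:E <= ((1 + T) * M)%:E)%E.
  move=> NM M0.
  apply: le_trans (_ : \int[lm]_(t in `[0%R, T]) (M^-1 * c t ^+ 2 + M)%:E <= _)%E.
    apply: ge0_le_integral => //.
    - by apply/measurable_EFinP; exact: measurableT_comp.
    - apply/measurable_EFinP; apply: measurable_funD => //.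
      by apply: measurable_funM => //; exact: measurable_funX.
    - move=> t _; rewrite lee_fin -real_normK ?num_real//.
      rewrite -(ler_pM2l M0) mulrDr mulrA divff ?gt_eqF// mul1r.
      by have := sqr_ge0 (M - `|c t|); rewrite sqrrB; have := mulr_ge0 (ltW M0) (normr_ge0 (c t)); lra.
  under eq_integral do rewrite EFinD.
  rewrite ge0_integralD//; first last.
  - by move=> t _; rewrite lee_fin (ltW M0).
  - by apply/measurable_EFinP; apply: measurable_funM => //; exact: measurable_funX.
  - by move=> t _; rewrite lee_fin mulr_ge0 ?invr_ge0 ?(ltW M0)// sqr_ge0.
  under eq_integral do rewrite EFinM.
  rewrite ge0_integralZl ?lee_fin ?invr_ge0 ?(ltW M0)//; first last.
  - by move=> t _; rewrite lee_fin sqr_ge0.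
  - exact: measurable_sqr.
  rewrite -/(sq c) cN -[X in (_ + X)%E]/(\int[lm]_(t in `[0%R, T]) cst M%:E t)%E integral_cst//= lebesgue_measure_itv/= lte_fin T0 oppr0 adde0.
  rewrite -!EFinM -EFinD lee_fin mulrDl mul1r mulrC [T * M]mulrC lerD2r.
  by rewrite ler_pdivrMr// -expr2 lerXn2r// nnegrE// ltW.
have L1c : L1 c.
  apply/integrableP; split; first exact/measurable_EFinP.
  by apply: le_lt_trans (H (N + 1) _ _) (ltry _) => //; lra.
split => //; apply/ler_addgt0Pl => x x0.
have T1 : 0 < 1 + T := ltr_pwDl ltr01 (ltW T0).
have e0 : 0 < x / (1 + T) := divr_gt0 x0 T1.
have := H (N + x / (1 + T)); rewrite (EFin_prim (L1_norm L1c) (lexx T)).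
rewrite lee_fin mulrDr (mulrCA (1 + T) x) divff ?gt_eqF// mulr1 [_ + x]addrC; move: (x / (1 + T)) e0 => z z0; apply.
  by rewrite lerDl ltW.
by rewrite ltr_wpDl.
Qed.

Definition weak_derivative1 c e := forall psi : R -> R,
  test_function `]0, T[ (psi : R^o -> R) ->
  \int[lm]_(t in `]0, T[) (c t * derive1 psi t) = - \int[lm]_(t in `]0, T[) (e t * psi t).

Lemma test_functionP (psi : R -> R) : test_function `]0, T[ (psi : R^o -> R) ->
  [/\ {within `[0, T], continuous psi}, {within `[0, T], continuous (derive1 psi)},
      psi T = 0 & forall t : R, t \in `[0, T] -> psi t = 0 + prim (derive1 psi) t].
Proof.
move=> [psm [C [cC CT psi0]]].
have [cpsi /(_ 1)[dpsi [cdpsi _]]] := psm 2%N.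
have p0 : psi 0 = 0 by apply: psi0 => /CT; rewrite /= in_itv/= ltxx.
have pT : psi T = 0 by apply: psi0 => /CT; rewrite /= in_itv/= ltxx andbF.
have dE : derive1 psi = (fun x => 'D_1 (psi : R^o -> R) x) by apply/funext => x; rewrite derive1E.
have cc : {within `[0, T], continuous psi} by apply: continuous_subspaceT; exact: cpsi.
have cd : {within `[0, T], continuous (derive1 psi)}.
  by apply: continuous_subspaceT; rewrite dE; exact: cdpsi.
split => // t; rewrite in_itv/= => /andP[t0 tT].
have sub : `[0, t] `<=` `[0, T].
  by move=> x /=; rewrite !in_itv/= => /andP[-> xt]; exact: le_trans xt tT.
have ft : forall x : R, x \in `]0, t[ -> is_derive x 1 psi (derive1 psi x).
  by move=> x _; rewrite dE; apply: DeriveDef; [exact: dpsi|].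
rewrite (prim_FTC t0 (continuous_subspaceW sub cd) (continuous_subspaceW sub cc) ft).
by rewrite p0 subr0 add0r.
Qed.

Lemma Rintegral_prim c : L1 c -> \int[lm]_(t in `]0, T[) c t = prim c T.
Proof.
move=> ic; have io : lm.-integrable `]0, T] (EFin \o c).
  by apply: integrableS ic => //; apply: subset_itvr; rewrite bnd_simp.
have ioo : lm.-integrable `]0, T[ (EFin \o c).
  by apply: integrableS ic => //; exact: subset_itv_oo_cc.
by rewrite Rintegral_itv_bndo_bndc// Rintegral_itv_obnd_cbnd.
Qed.

(** This is the product rule for [c * psi] at time [T], where [psi] vanishes as it does at 0. *)
Lemma weak_derivative1_prim (a : R) c e : L1 e ->
  (forall t : R, t \in `[0, T] -> c t = a + prim e t) -> weak_derivative1 c e.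
Proof.
move=> ie cE psi /test_functionP[cpsi cdpsi psiT psiE].
have id := L1_continuous cdpsi.
have ied : L1 (fun s => e s * psi s).
  rewrite (_ : (fun s => _) = (fun s => psi s * e s)); last by apply/funext => s; rewrite mulrC.
  exact: L1_mulcontinuous.
have icd : L1 (fun s => c s * derive1 psi s).
  by apply: L1_mulcontinuous => //; exact: (primitive_continuous T0 ie cE).
rewrite !Rintegral_prim//; apply/eqP; rewrite -subr_eq0 opprK addrC.
have TT : T \in `[0, T] by rewrite in_itv/= lexx ltW.
have := product_rule T0 ie id cE psiE TT.
by rewrite psiT mulr0 mulr0 add0r (primD ied icd (lexx T)) => <-.
Qed.

Lemma weak_derivative1_lin (l : R) c c' e e' : L1 c -> L1 c' -> L1 e -> L1 e' ->
  weak_derivative1 c c' -> weak_derivative1 e e' ->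
  weak_derivative1 (fun t => l * c t + e t) (fun t => l * c' t + e' t).
Proof.
move=> ic ic' ie ie' wc we psi tpsi.
have [cpsi cdpsi _ _] := test_functionP tpsi.
have mulL (p h : R -> R) : L1 h -> {within `[0, T], continuous p} -> L1 (fun s => h s * p s).
  move=> ih cp; rewrite (_ : (fun s => _) = (fun s => p s * h s)).
    exact: L1_mulcontinuous.
  by apply/funext => s; rewrite mulrC.
have := wc psi tpsi; have := we psi tpsi.
rewrite !Rintegral_prim; try by apply: mulL => //; apply: L1D => //; exact: L1Z.
have split (p h1 h2 : R -> R) : L1 h1 -> L1 h2 -> {within `[0, T], continuous p} ->
   prim (fun t => (l * h1 t + h2 t) * p t) T =
   l * prim (fun t => h1 t * p t) T + prim (fun t => h2 t * p t) T.
  move=> i1 i2 cp; rewrite -(primZ l (mulL _ _ i1 cp) (lexx T)).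
  rewrite -(primD (L1Z l (mulL _ _ i1 cp)) (mulL _ _ i2 cp) (lexx T)).
  by apply: eq_prim => s _; ring.
rewrite !split// => -> ->; ring.
Qed.

Lemma eq_weak_derivative1 c c' e e' :
  (forall t : R, t \in `]0, T[ -> c t = c' t) ->
  (forall t : R, t \in `]0, T[ -> e t = e' t) ->
  weak_derivative1 c e -> weak_derivative1 c' e'.
Proof.
move=> cE eE we psi tpsi.
have <- : \int[lm]_(t in `]0, T[) (c t * derive1 psi t) = \int[lm]_(t in `]0, T[) (c' t * derive1 psi t).
  by apply: eq_Rintegral => t /set_mem tT; rewrite cE.
have <- : \int[lm]_(t in `]0, T[) (e t * psi t) = \int[lm]_(t in `]0, T[) (e' t * psi t).
  by apply: eq_Rintegral => t /set_mem tT; rewrite eE.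
exact: we.
Qed.

Lemma ae_weak_derivative1 c c' e e' : msr c -> msr c' -> msr e -> msr e' ->
  {ae lm, forall t : R, t \in `[0, T] -> c t = c' t} ->
  {ae lm, forall t : R, t \in `[0, T] -> e t = e' t} ->
  weak_derivative1 c e -> weak_derivative1 c' e'.
Proof.
move=> mc mc' me me' cE eE we psi tpsi.
have [cpsi cdpsi _ _] := test_functionP tpsi.
have ae (h1 h2 p : R -> R) : msr h1 -> msr h2 -> {within `[0, T], continuous p} ->
    {ae lm, forall t : R, t \in `[0, T] -> h1 t = h2 t} ->
    \int[lm]_(t in `]0, T[) (h1 t * p t) = \int[lm]_(t in `]0, T[) (h2 t * p t).
  move=> m1 m2 /continuous_measurable mp hE; congr fine.
  have sub : `]0, T[ `<=` (`[0, T]%classic : set (measurableTypeR R)).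
    by exact: subset_itv_oo_cc.
  apply: ae_eq_integral => //.
  - by apply/measurable_EFinP; apply: measurable_funM; [exact: measurable_funS sub m1|exact: measurable_funS sub mp].
  - by apply/measurable_EFinP; apply: measurable_funM; [exact: measurable_funS sub m2|exact: measurable_funS sub mp].
  - by apply: (@filterS _ _ (ae_filter_ringOfSetsType lm) _ _ _ hE) => t + tT => -> //; exact: sub.
by rewrite -(ae _ _ _ mc mc' cdpsi cE) -(ae _ _ _ me me' cpsi eE); exact: we.
Qed.

End square_integrable.

Arguments sq {R} T c.
Arguments weak_derivative1 {R} T c e.

Section bochner_coefficients.
Context {R : realType} {d : nat} {Omega : set 'rV[R]_d}.
Variables (phi : nat -> 'rV[R]_d -> R) (lam : nat -> R) (T : R).
Hypotheses (onb : orthonormal_basis Omega phi) (T0 : 0 < T).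
Hypotheses (lam_gt0 : forall i, 0 < lam i) (lam_ge : forall i, lam 0%N <= lam i).
Notation L2 := (L2 Omega).
Notation inner := (inner Omega).
Notation lm := (@lebesgue_measure R).
Notation msr := (measurable_fun (`[0, T]%classic : set (measurableTypeR R))).
Notation NH := (checkH_norm Omega lam phi).
Implicit Types (g h : R -> 'rV[R]_d -> R) (w : 'rV[R]_d -> R) (X : nat -> R -> R).

Definition coef g i t := inner (g t) (phi i).

(** The square of the norm of L^2(0, T; X) for the space of order [n], read on coefficients. The sum
    stands outside the time integral, so that estimates of single coefficients add up directly;
    [coef_norm2E] exchanges the two by Tonelli. *)
Definition coef_norm2 n X : \bar R :=
  (\sum_(0 <= i <oo) ((lam i ^+ (2 * n))%:E * sq T (X i)))%E.

Notation V := coef_norm2.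

Definition L2_path g := (forall t : R, t \in `[0, T] -> L2 (g t)) /\
  strongly_measurable Omega T g.

Lemma sqr_poweR_half (x : \bar R) : (0 <= x)%E -> ((x `^ 2^-1) `^ 2 = x)%E.
Proof. by move=> x0; rewrite -poweRrM mulVf ?pnatr_eq0// poweRe1. Qed.

Lemma checkH_norm_nat n q : NH n%:R q =
  ((\sum_(0 <= i <oo) (lam i ^+ (2 * n) * inner q (phi i) ^+ 2)%:E) `^ 2^-1)%E.
Proof.
rewrite /checkH_norm; congr (_ `^ _)%E; apply: eq_eseriesr => i _.
by rewrite -natrM powR_mulrn// ltW.
Qed.

Lemma weight_ge0 n i : 0 <= lam i ^+ (2 * n).
Proof. by rewrite exprn_ge0// ltW. Qed.

(** By Parseval the norm of order 0 is that of L^2(Omega); every estimate can then be stated once,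
    for [NH n%:R]. *)
Lemma checkH_norm0 q : L2 q -> NH 0 q = L2_norm Omega q.
Proof.
move=> qL; rewrite (checkH_norm_nat 0) L2_normE//.
under eq_eseriesr do rewrite muln0 expr0 mul1r.
by rewrite (parseval onb)// poweR_EFin powR12_sqrt// inner_ge0.
Qed.

Lemma measurable_coef g i : L2_path g -> msr (coef g i).
Proof.
move=> [gL gs]; apply: (strongly_measurable_inner gs gL).
exact: basis_L2 onb i.
Qed.

Lemma coef_norm2E n X : (forall i, msr (X i)) -> V n X =
  (\int[lm]_(t in `[0%R, T]) \sum_(0 <= i <oo) (lam i ^+ (2 * n) * X i t ^+ 2)%:E)%E.
Proof.
move=> mX; rewrite integral_nneseries//; first last.
- by move=> i t _; rewrite lee_fin mulr_ge0 ?weight_ge0 ?sqr_ge0.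
- move=> i; apply/measurable_EFinP; apply: measurable_funM => //.
  exact: measurable_funX.
apply: eq_eseriesr => i _; rewrite -ge0_integralZl ?lee_fin ?weight_ge0//.
- exact: measurable_sqr.
- by move=> t _; rewrite lee_fin sqr_ge0.
Qed.

Lemma coef_norm2_ge0 n X : (0 <= V n X)%E.
Proof. by apply: nneseries_ge0 => i _ _; rewrite mule_ge0 ?lee_fin ?weight_ge0 ?sq_ge0. Qed.

Lemma L2X_normE n g : L2_path g -> (L2X_norm T (NH n%:R) g `^ 2 = V n (coef g))%E.
Proof.
move=> gp; rewrite /L2X_norm sqr_poweR_half; last by apply: integral_ge0 => t _; exact: poweR_ge0.
rewrite coef_norm2E; last by move=> i; exact: measurable_coef.
apply: eq_integral => t _; rewrite checkH_norm_nat sqr_poweR_half//.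
by apply: nneseries_ge0 => i _ _; rewrite lee_fin mulr_ge0 ?weight_ge0 ?sqr_ge0.
Qed.

Lemma L2X_norm_half n g : L2_path g -> L2X_norm T (NH n%:R) g = (V n (coef g) `^ 2^-1)%E.
Proof.
move=> gp; rewrite -L2X_normE// -poweRrM mulfV ?pnatr_eq0// poweRe1//.
exact: poweR_ge0.
Qed.

Lemma L2X_NHP n g : L2X Omega T (NH n%:R) g <-> L2_path g /\ (V n (coef g) < +oo)%E.
Proof.
split=> [[gL gs goo]|[gp Voo]].
  have gp : L2_path g by [].
  by split => //; rewrite -L2X_normE// poweR_lty.
by case: (gp) => gL gs; split => //; rewrite L2X_norm_half// poweR_lty.
Qed.

Lemma L2X_norm_L2 g : (forall t : R, t \in `[0, T] -> L2 (g t)) ->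
  L2X_norm T (L2_norm Omega) g = L2X_norm T (NH 0) g.
Proof.
move=> gL; congr (_ `^ _)%E; apply: eq_integral => t /set_mem tT.
by rewrite checkH_norm0//; exact: gL.
Qed.

Lemma L2X_L2 g : L2X Omega T (L2_norm Omega) g <-> L2X Omega T (NH 0) g.
Proof. by split=> -[gL gs goo]; split => //; rewrite ?L2X_norm_L2// -L2X_norm_L2. Qed.

Lemma Hm_derivatives_L2 m g D :
  Hm_derivatives Omega T m (L2_norm Omega) g D <-> Hm_derivatives Omega T m (NH 0) g D.
Proof. by split=> -[D0 DL Dw]; split => // j jm; apply/L2X_L2; exact: DL. Qed.

Lemma HmX_L2 m g : HmX Omega T m (L2_norm Omega) g <-> HmX Omega T m (NH 0) g.
Proof. by split=> -[D HD]; exists D; apply/Hm_derivatives_L2. Qed.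

Lemma HmX_norm_L2 m g : HmX_norm Omega T m (L2_norm Omega) g = HmX_norm Omega T m (NH 0) g.
Proof.
congr ereal_inf; apply/seteqP; split => _ [D HD <-]; exists D.
- exact/Hm_derivatives_L2.
- congr (_ `^ _)%E; apply: eq_bigr => j _; congr (_ `^ _)%E.
  by rewrite L2X_norm_L2//; case: HD => _ /(_ j (leq_ord j))[].
- exact/Hm_derivatives_L2.
- congr (_ `^ _)%E; apply: eq_bigr => j _; congr (_ `^ _)%E.
  by rewrite L2X_norm_L2//; case: HD => _ /(_ j (leq_ord j))[].
Qed.

(** The weights satisfy [lam i >= lam 0 > 0], so a missing power of [lam i] costs a power of
    [lam 0]. *)
Lemma coef_norm2_weight m n X : (m <= n)%N ->
  (V m X <= (lam 0%N ^- (2 * (n - m)))%:E * V n X)%E.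
Proof.
move=> mn; have l0 := lam_gt0 0%N; rewrite -nneseriesZl; last first.
  by move=> i _; rewrite mule_ge0 ?lee_fin ?weight_ge0 ?sq_ge0.
apply: lee_nneseries => i _.
  by rewrite mule_ge0 ?lee_fin ?weight_ge0 ?sq_ge0.
rewrite muleA -EFinM; apply: lee_wpmul2r; first exact: sq_ge0.
rewrite lee_fin ler_pdivlMl ?exprn_gt0// -{2}(subnK mn) mulnDr exprD.
rewrite ler_wpM2r ?weight_ge0// lerXn2r ?nnegrE ?(ltW l0)//.
by rewrite ltW.
Qed.

Lemma L2_pathP g : (forall t : R, t \in `[0, T] -> L2 (g t)) ->
  (forall i, msr (coef g i)) -> L2_path g.
Proof. by move=> gL mg; split => //; exact: coefs_strongly_measurable onb _ gL mg. Qed.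

(* The value is 0 at the times, forming a null set, where sum_i (X i t)^2 = +oo. *)
Lemma L2_path_realize X : (forall i, msr (X i)) -> (V 0 X < +oo)%E ->
  exists2 g, L2_path g & forall i,
    {ae lm, forall t : R, t \in `[0, T] -> coef g i t = X i t}.
Proof.
move=> mX; rewrite coef_norm2E// => Xoo.
pose S (t : R) : \bar R := (\sum_(0 <= i <oo) (lam i ^+ (2 * 0) * X i t ^+ 2)%:E)%E.
pose E : set R := `[0, T]%classic `&` [set t | (S t < +oo)%E].
have S0 t : (0 <= S t)%E.
  by apply: nneseries_ge0 => i _ _; rewrite lee_fin mulr_ge0 ?weight_ge0 ?sqr_ge0.
have mS : measurable_fun (`[0, T]%classic : set (measurableTypeR R)) S.
  apply: ge0_emeasurable_sum => i.
    by move=> t _ _; rewrite lee_fin mulr_ge0 ?weight_ge0 ?sqr_ge0.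
  move=> _; apply/measurable_EFinP; apply: measurable_funM => //.
  exact: measurable_funX.
have mE : measurable (E : set (measurableTypeR R)) by exact: emeasurable_fun_infty_o.
have H (t : R) : exists q, L2 q /\ forall i, inner q (phi i) = \1_E t * X i t.
  have [|q qL qE] := @riesz_fischer _ _ _ _ onb (fun i => \1_E t * X i t).
    have [Et|nEt] := pselect (E t); last first.
      by rewrite eseries0// => i _ _; rewrite indicE memNset// mul0r expr0n.
    apply: le_lt_trans Et.2; rewrite le_eqVlt; apply/orP; left; apply/eqP.
    by apply: eq_eseriesr => i _; rewrite indicE mem_set// mul1r muln0 expr0 mul1r.
  by exists q.
have [g gP] := boolp.choice H.
have gL t : L2 (g t) := (gP t).1.
exists g.
  apply: L2_pathP => // i; rewrite (_ : coef g i = (fun t => \1_E t * X i t)).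
    by apply: measurable_funM.
  by apply/funext => t; rewrite /coef (gP t).2.
move=> i.
have iS : lm.-integrable `[0, T] S.
  by apply/integrableP; split => //; under eq_integral do rewrite gee0_abs//.
have := @integrable_ae _ _ _ lm `[0, T]%classic (measurable_itv _) S iS.
apply: (@filterS _ _ (ae_filter_ringOfSetsType lm)) => t + tT.
move=> /(_ tT) Sf; rewrite /coef (gP t).2 indicE mem_set ?mul1r//.
by split => //=; rewrite -ge0_fin_numE.
Qed.

Lemma sq_inner g w : L2_path g -> L2 w -> (V 0 (coef g) < +oo)%E ->
  sq T (fun t => inner (g t) w) =
    (Num.sqrt (fine (sq T (fun t => inner (g t) w))) ^+ 2)%:E /\
  Num.sqrt (fine (sq T (fun t => inner (g t) w))) <=
    Num.sqrt (inner w w) * Num.sqrt (fine (V 0 (coef g))).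
Proof.
move=> gp wL goo; have [gL gs] := gp; have mw := strongly_measurable_inner gs gL wL.
have Vf : V 0 (coef g) \is a fin_num by rewrite ge0_fin_numE ?coef_norm2_ge0.
have H : (sq T (fun t => inner (g t) w) <= (inner w w)%:E * V 0 (coef g))%E.
  rewrite coef_norm2E; last by move=> i; exact: measurable_coef.
  have mS : measurable_fun (`[0, T]%classic : set (measurableTypeR R))
     (fun t => \sum_(0 <= i <oo) (lam i ^+ (2 * 0) * coef g i t ^+ 2)%:E)%E.
    apply: ge0_emeasurable_sum => i.
      by move=> t _ _; rewrite lee_fin mulr_ge0 ?weight_ge0 ?sqr_ge0.
    move=> _; apply/measurable_EFinP; apply: measurable_funM => //.
    by apply: measurable_funX; exact: measurable_coef.
  have S0 t : (0 <= \sum_(0 <= i <oo) (lam i ^+ (2 * 0) * coef g i t ^+ 2)%:E)%E.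
    by apply: nneseries_ge0 => i _ _; rewrite lee_fin mulr_ge0 ?weight_ge0 ?sqr_ge0.
  rewrite -ge0_integralZl ?lee_fin ?inner_ge0//.
  apply: ge0_le_integral => //.
  - by move=> t _; rewrite lee_fin sqr_ge0.
  - exact: measurable_sqr.
  - exact: measurable_funeM.
  - move=> t /= tT; under eq_eseriesr do rewrite muln0 expr0 mul1r.
    rewrite (parseval onb); last exact: gL.
    by rewrite -EFinM lee_fin mulrC; apply: inner_cauchy_schwarz => //; exact: gL.
have sf : sq T (fun t => inner (g t) w) \is a fin_num.
  rewrite ge0_fin_numE ?sq_ge0//; apply: le_lt_trans H _.
  by rewrite -(fineK Vf) -EFinM ltry.
split; first by rewrite sqr_sqrtr ?fineK// fine_ge0// sq_ge0.
rewrite -sqrtrM ?inner_ge0// ler_wsqrtr// -lee_fin fineK//.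
by rewrite EFinM (fineK Vf); exact: H.
Qed.

(** Continuity in [w] of the two sides of the identity that defines weak derivatives. *)
Lemma integral_inner_bound g w (p : R -> R) (M : R) :
  L2_path g -> L2 w -> (V 0 (coef g) < +oo)%E ->
  {within `[0, T], continuous p} -> (forall t : R, t \in `[0, T] -> `|p t| <= M) ->
  L1 T (fun t => inner (g t) w * p t) /\
  `|prim (fun t => inner (g t) w * p t) T| <=
    M * (1 + T) * Num.sqrt (fine (V 0 (coef g))) * Num.sqrt (inner w w).
Proof.
move=> gp wL goo cp pM; have [gL gs] := gp.
have mw := strongly_measurable_inner gs gL wL.
have [sE sN] := sq_inner gp wL goo.
have [iw ipw] := sq_norm_bound T0 mw (sqrtr_ge0 _) sE.
have M0 : 0 <= M by apply: le_trans (pM 0 _); rewrite ?normr_ge0// in_itv/= lexx ltW.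
have TT : 0 <= T <= T by rewrite lexx ltW.
have iwp : L1 T (fun t => inner (g t) w * p t).
  exact: L1_mulbounded iw (continuous_measurable cp) pM.
split => //.
have := normr_prim_le iwp (L1Z M (L1_norm iw)) TT.
move=> /(_ _) /le_trans; apply.
  move=> s sT; rewrite normrM mulrC ler_wpM2r//; apply: pM.
  by rewrite in_itv.
rewrite (primZ M (L1_norm iw) (lexx T)) -!mulrA ler_wpM2l//; apply: le_trans ipw _.
by rewrite [leRHS](_ : _ = (1 + T) * (Num.sqrt (inner w w) * Num.sqrt (fine (V 0 (coef g)))));
  [rewrite ler_wpM2l// addr_ge0// ltW|congr (_ * _); exact: mulrC].
Qed.

(* Both sides of the identity are continuous in w for the norm of L^2(Omega) and
   agree on finite combinations of the phi i. *)
Lemma coefs_weak_derivative g h : L2_path g -> L2_path h ->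
  (V 0 (coef g) < +oo)%E -> (V 0 (coef h) < +oo)%E ->
  (forall i, weak_derivative1 T (coef g i) (coef h i)) -> weak_derivative Omega T g h.
Proof.
move=> gp hp goo hoo wgh psi w tpsi wL.
have [cp cdp _ _] := test_functionP tpsi.
have [M1 M1P] := continuous_bounded T0 cp; have [M2 M2P] := continuous_bounded T0 cdp.
pose A v := prim (fun t => inner (g t) v * derive1 psi t) T + prim (fun t => inner (h t) v * psi t) T.
have [Kg Ag] : exists Kg, forall v, L2 v -> L1 T (fun t => inner (g t) v * derive1 psi t) /\
    `|prim (fun t => inner (g t) v * derive1 psi t) T| <= Kg * Num.sqrt (inner v v).
  by eexists => v vL; exact: integral_inner_bound gp vL goo cdp M2P.
have [Kh Ah] : exists Kh, forall v, L2 v -> L1 T (fun t => inner (h t) v * psi t) /\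
    `|prim (fun t => inner (h t) v * psi t) T| <= Kh * Num.sqrt (inner v v).
  by eexists => v vL; exact: integral_inner_bound hp vL hoo cp M1P.
have Alin a v1 v2 : L2 v1 -> L2 v2 -> A (fun x => a * v1 x + v2 x) = a * A v1 + A v2.
  move=> L1v L2v.
  have E (f : R -> 'rV[R]_d -> R) (p : R -> R) : L2_path f -> 
      L1 T (fun t => inner (f t) v1 * p t) -> L1 T (fun t => inner (f t) v2 * p t) ->
      prim (fun t => inner (f t) (fun x => a * v1 x + v2 x) * p t) T =
      a * prim (fun t => inner (f t) v1 * p t) T + prim (fun t => inner (f t) v2 * p t) T.
    move=> [fL _] i1 i2; rewrite -(primZ a i1 (lexx T)) -(primD (L1Z a i1) i2 (lexx T)).
    apply: eq_prim => s sT; rewrite innerC inner_lin//; last by apply: fL; rewrite in_itv.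
    by rewrite !(innerC _ (f s)); ring.
  rewrite /A (E g _ gp (Ag v1 L1v).1 (Ag v2 L2v).1) (E h _ hp (Ah v1 L1v).1 (Ah v2 L2v).1).
  rewrite mulrDr; exact: addrACA.
have Aphi i : A (phi i) = 0.
  have pL := basis_L2 onb i.
  have := wgh i psi tpsi; rewrite !Rintegral_prim//; [|exact: (Ah _ pL).1|exact: (Ag _ pL).1].
  by rewrite /A /coef => ->; rewrite addNr.
have Acomb n c : A (comb phi n c) = 0.
  elim: n => [|n IH].
    have := Alin 0 (comb phi 0 c) (comb phi 0 c) (comb_L2 onb _ _) (comb_L2 onb _ _).
    rewrite mul0r add0r.
    have : A (cst 0) = 0.
      have z (p : R -> R) (f : R -> 'rV[R]_d -> R) :
          prim (fun t => inner (f t) (cst 0) * p t) T = 0.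
        rewrite (@eq_prim _ _ (cst 0)) ?prim_cst ?mul0r ?(ltW T0)// => s _.
        by rewrite innerC inner0l mul0r.
      by rewrite /A !z addr0.
    by move=> <- _; congr A; apply/funext => x; rewrite /comb big_ord0.
  have -> : comb phi n.+1 c = (fun x => c n * phi n x + comb phi n c x).
    by apply/funext => x; rewrite /comb big_ord_recr/= addrC.
  by rewrite Alin ?Aphi ?IH ?mulr0 ?addr0//; [exact: basis_L2 onb n|exact: comb_L2 onb _ _].
suff A0 : A w = 0.
  rewrite !Rintegral_prim//; [|exact: (Ah _ wL).1|exact: (Ag _ wL).1].
  by apply/eqP; rewrite -subr_eq0 opprK; apply/eqP.
pose K := Kg + Kh.
have AK v : L2 v -> `|A v| <= K * Num.sqrt (inner v v).
  move=> vL; apply: le_trans (ler_normD _ _) _; rewrite mulrDl.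
  exact: lerD (Ag v vL).2 (Ah v vL).2.
apply/eqP; rewrite -sqrf_eq0 eq_le sqr_ge0 andbT.
(* The squared distance from [w] to its projection [Pw] on the first [n] basis functions. As [A]
   vanishes on [Pw], the square of [A w] is at most [K ^+ 2 * x n], which tends to 0. *)
pose x n := inner w w - \sum_(i < n) inner w (phi i) ^+ 2.
have cx : K ^+ 2 * x n @[n --> \oo] --> K ^+ 2 * 0.
  by apply: cvgM; [exact: cvg_cst|exact: proj_cvg].
rewrite mulr0 in cx; apply: (cvgr_to_ge cx); apply: nearW => n.
pose Pw := comb phi n (fun i => inner w (phi i)).
have PL : L2 Pw by exact: comb_L2 onb _ _.
have wPL := L2B wL PL.
have -> : A w = A (fun x => w x - Pw x).
  have -> : (fun x => w x - Pw x) = (fun x => (-1) * Pw x + w x).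
    by apply/funext => y; rewrite mulN1r addrC.
  by rewrite Alin// Acomb mulr0 add0r.
rewrite -real_normK ?num_real//.
apply: le_trans (_ : (K * Num.sqrt (x n)) ^+ 2 <= _).
  have := AK _ wPL; rewrite (inner_proj onb)// -/(x n) => le.
  by rewrite lerXn2r ?nnegrE// (le_trans _ le).
by rewrite exprMn sqr_sqrtr// /x -(inner_proj onb)// inner_ge0.
Qed.

Lemma weak_derivative_coefs g h i : weak_derivative Omega T g h ->
  weak_derivative1 T (coef g i) (coef h i).
Proof. by move=> wgh psi tpsi; apply: wgh => //; exact: basis_L2 onb i. Qed.

Lemma eq_coef_norm2 n X Y : (forall i, msr (X i)) -> (forall i, msr (Y i)) ->
  (forall i, {ae lm, forall t : R, t \in `[0, T] -> X i t = Y i t}) -> V n X = V n Y.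
Proof.
move=> mX mY XY; apply: eq_eseriesr => i _; congr (_ * _)%E.
apply: ae_eq_integral => //; [exact: measurable_sqr|exact: measurable_sqr|].
apply: (@filterS _ _ (ae_filter_ringOfSetsType lm) _ _ _ (XY i)) => t + tT.
by move=> /(_ tT) ->.
Qed.

(** Riesz-Fischer turns each [X j] into a path with these coefficients almost everywhere, a change
    that neither weak derivatives nor norms detect. The norm of [HmX] being an infimum, this one
    family bounds it. *)
Lemma HmX_coefs m n g (X : nat -> nat -> R -> R) : L2_path g ->
  (forall i t, t \in `[0, T] -> X 0%N i t = coef g i t) ->
  (forall j, (j <= m)%N -> forall i, msr (X j i)) ->
  (forall j, (j <= m)%N -> (V n (X j) < +oo)%E) ->
  (forall j, (j < m)%N -> forall i, weak_derivative1 T (X j i) (X j.+1 i)) ->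
  HmX Omega T m (NH n%:R) g /\
  (HmX_norm Omega T m (NH n%:R) g <= (\sum_(j < m.+1) V n (X j)) `^ 2^-1)%E.
Proof.
move=> gp X0 mX Xoo wX.
have V0oo j : (j <= m)%N -> (V 0 (X j) < +oo)%E.
  move=> jm; apply: le_lt_trans (coef_norm2_weight _ (leq0n n)) _.
  have Vf : V n (X j) \is a fin_num by rewrite ge0_fin_numE ?coef_norm2_ge0// Xoo.
  by rewrite -(fineK Vf) -EFinM ltry.
have [D DP] : {D : nat -> R -> 'rV[R]_d -> R & forall j, (j <= m)%N ->
    [/\ L2_path (D j), (j = 0%N -> D j = g) & forall i,
      {ae lm, forall t : R, t \in `[0, T] -> coef (D j) i t = X j i t}]}.
  (* For [j = 0] the path has to be [g] itself, since [Hm_derivatives] asks for [D 0 = g]; the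
     others are free up to null sets. *)
  apply: (@boolp.choice _ _ (fun j Dj => (j <= m)%N ->
    [/\ L2_path Dj, (j = 0%N -> Dj = g) & forall i,
      {ae lm, forall t : R, t \in `[0, T] -> coef Dj i t = X j i t}])) => j.
  case: j => [|j].
    by exists g => _; split => // i; apply: aeW => t tT; rewrite X0.
  have [jm|jm] := leqP j.+1 m; last by exists g => h; move: jm; rewrite ltnNge h.
  by have [h hp hE] := L2_path_realize (mX _ jm) (V0oo _ jm); exists h.
have mD j i : (j <= m)%N -> msr (coef (D j) i).
  by move=> jm; apply: measurable_coef; have [] := DP j jm.
have DX k j : (j <= m)%N -> V k (coef (D j)) = V k (X j).
  move=> jm; apply: eq_coef_norm2 => i; [exact: mD|exact: mX|].
  by have [_ _] := DP j jm; apply.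
have HD : Hm_derivatives Omega T m (NH n%:R) g D.
  split.
  - by have [_ ->] := DP 0%N (leq0n m).
  - by move=> j jm; apply/L2X_NHP; split; [have [] := DP j jm|rewrite DX// Xoo].
  - move=> j jm; have jm' := ltnW jm.
    have [p1 _ e1] := DP j jm'; have [p2 _ e2] := DP j.+1 jm.
    apply: coefs_weak_derivative => //; rewrite ?DX ?V0oo// => i.
    apply: (ae_weak_derivative1 (mX j jm' i) (mD j i jm') (mX j.+1 jm i) (mD j.+1 i jm) _ _ (wX j jm i)).
    + by apply: (@filterS _ _ (ae_filter_ringOfSetsType lm) _ _ _ (e1 i)) => t + tT => ->.
    + by apply: (@filterS _ _ (ae_filter_ringOfSetsType lm) _ _ _ (e2 i)) => t + tT => ->.
split; first by exists D.
apply: ereal_inf_lbound; exists D => //; congr (_ `^ _)%E; apply: eq_bigr => j _.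
have jm := leq_ord j; rewrite L2X_normE ?DX//.
by have [] := DP j jm.
Qed.

End bochner_coefficients.

(** * The Gamma function and the memory kernel *)

Section gamma_function.
Context {R : realType}.
Notation mu := (@lebesgue_measure R).
Implicit Types (b c t u v z : R).

Lemma powR_expR t r : 0 < t -> t `^ r = expR (r * ln t).
Proof. by move=> t0; rewrite /powR gt_eqF. Qed.

Lemma measurable_expR_ln c (D : set R) : measurable_fun D (fun t => expR (c * ln t)).
Proof.
apply: (@measurable_funS _ _ _ _ setT) => //.
apply: measurableT_comp; first exact: measurable_expR.
by apply: measurable_funM => //; exact: measurable_ln.
Qed.

Lemma is_derive_expR_ln c t : 0 < t ->
  is_derive t 1 (fun s => expR (c * ln s)) (c * expR ((c - 1) * ln t)).
Proof.
move=> t0; have dln := is_derive1_ln t0.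
apply: is_derive_eq; rewrite /GRing.scale/= mulrBl expRB mul1r lnK//.
by field; rewrite gt_eqF.
Qed.

(** The interval is exhausted by [[n.+1%:R^-1, b]], on which [t^c / c] is a regular primitive; the
    integrals stay below [b^c / c]. *)
Lemma integrable_power c b : 0 < c ->
  mu.-integrable `]0, b] (EFin \o (fun t => expR ((c - 1) * ln t))).
Proof.
move=> c0; apply/integrableP; split.
  by apply/measurable_EFinP; exact: measurable_expR_ln.
under eq_integral do rewrite /= ger0_norm ?expR_ge0//.
have [b0|b0] := leP b 0; first by rewrite set_itv_ge ?integral_set0// bnd_simp -leNgt.
pose F n : set R := `[n.+1%:R^-1, b]%classic.
have FE : `]0, b]%classic = \bigcup_n F n.
  apply/seteqP; split => [t /=|t [n _]].
    rewrite in_itv/= => /andP[t0 tb].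
    exists (Num.truncn t^-1) => //; rewrite /F/= in_itv/= tb andbT.
    by rewrite invf_ple ?posrE// ltW// truncnS_gt.
  rewrite /F/= !in_itv/= => /andP[nt ->]; rewrite andbT.
  by apply: lt_le_trans nt.
have mF n : measurable (F n : set (measurableTypeR R)) by exact: measurable_itv.
have H := @ge0_nondecreasing_set_cvg_integral _ (measurableTypeR R) R F
  (fun t => (expR ((c - 1) * ln t))%:E) mu.
have ndF : {homo F : n m / (n <= m)%N >-> (n <= m)%O}.
  move=> n m nm; apply/subsetPset; apply: subset_itvr; rewrite bnd_simp.
  by rewrite lef_pV2 ?posrE// ler_nat.
have mE i : measurable_fun (F i) (fun t => (expR ((c - 1) * ln t))%:E).
  by apply/measurable_EFinP; exact: measurable_expR_ln.
have {}H := H ndF mF mE (fun i x _ => expR_ge0 _).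
rewrite FE -(cvg_lim _ H)//.
apply: (@le_lt_trans _ _ (expR (c * ln b) / c)%:E); last exact: ltry.
apply: lime_le; first by apply: cvgP; exact: H.
apply: nearW => n.
have n0 : 0 < n.+1%:R^-1 :> R by rewrite invr_gt0.
have [nb|nb] := ltP n.+1%:R^-1 b; last first.
  rewrite le_eqVlt in nb; case/predU1P: nb => [nb|nb].
    by rewrite /F -nb set_itv1 integral_set1 lee_fin divr_ge0 ?expR_ge0 ?ltW.
  rewrite /F set_itv_ge ?bnd_simp -?ltNge//.
  by rewrite integral_set0 lee_fin divr_ge0 ?expR_ge0 ?ltW.
have dF (x : R) : 0 < x -> is_derive x 1 (fun s => expR (c * ln s) / c) (expR ((c - 1) * ln x)).
  move=> x0; have dx := is_derive_expR_ln c x0.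
  by apply: is_derive_eq; rewrite /GRing.scale/=; field; rewrite gt_eqF.
have cF (a x : R) : 0 < x -> {for x, continuous (fun s => expR (a * ln s))}.
  move=> x0; have dx := is_derive_expR_ln a x0.
  by apply/differentiable_continuous/derivable1_diffP; exact: ex_derive.
have xn (x : R) : x \in `[n.+1%:R^-1, b] -> 0 < x.
  by rewrite in_itv/= => /andP[nx _]; exact: lt_le_trans nx.
have cF' (x : R) : 0 < x -> {for x, continuous (fun s => expR (c * ln s) / c)}.
  move=> x0; have dx := dF _ x0.
  by apply/differentiable_continuous/derivable1_diffP; exact: ex_derive.
rewrite (@continuous_FTC2 _ _ (fun s => expR (c * ln s) / c) _ _ nb).
- by rewrite lee_fin lerBlDr lerDl divr_ge0 ?expR_ge0 ?ltW.
- apply: continuous_in_subspaceT => x; rewrite inE => /xn; exact: cF.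
- split.
  + by move=> x /subset_itv_oo_cc /xn /dF dx; exact: ex_derive.
  + apply: cvg_at_right_filter; apply: cF' => //.
  + apply: cvg_at_left_filter; exact: cF'.
- move=> x /subset_itv_oo_cc /xn /dF dx; rewrite derive1E; exact: derive_val.
Qed.

Lemma integrable_expN c : 0 < c ->
  mu.-integrable `]0, +oo[ (EFin \o (fun t => expR (- (c * t)))).
Proof.
move=> c0; have H : mu.-integrable `]0, +oo[ (EFin \o exponential_pdf c).
  by apply: (integrableS _ _ _ (integrable_exponential_pdf c0)).
have {}H := fun D => integrableZl D c^-1 H; apply: eq_integrable (H _) => //.
move=> x; rewrite inE/= in_itv/= andbT => x0; rewrite /exponential_pdf.
rewrite patchE mem_setE in_itv/= (ltW x0) -EFinM mulKf ?gt_eqF//.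
by rewrite mulNr.
Qed.

(** The integrand is dominated by [t^(c - 1)] on []0, 1]] and by a multiple of [expR (- t / 2)]
    beyond. *)
Lemma integrable_gamma c : 0 < c ->
  mu.-integrable `]0, +oo[ (EFin \o (fun t => expR ((c - 1) * ln t) * expR (- t))).
Proof.
move=> c0.
(* For this slope, [ln (s * t) <= s * t - 1] reads [c * ln t <= t / 2 + K]: half of the exponential
   decay absorbs the power. *)
pose s : R := (2 * c)^-1; pose K := - c * (1 + ln s).
have s0 : 0 < s by rewrite invr_gt0 mulr_gt0.
have lnle t : 0 < t -> c * ln t <= t / 2 + K.
  move=> t0; have : ln (1 + (s * t - 1)) <= s * t - 1.
    by apply: le_ln1Dx; have := mulr_gt0 s0 t0; lra.
  rewrite addrC subrK lnM ?posrE// => H.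
  have -> : t / 2 = c * (s * t) by rewrite /s; field; rewrite gt_eqF.
  by rewrite /K; nra.
have i1 : mu.-integrable `]0, +oo[ (EFin \o (fun t => expR ((c - 1) * ln t)) \_ `]0, 1]).
  rewrite -restrict_EFin; apply/(integrable_restrict _ _ _ _).1 => //.
  by rewrite setIidr; [exact: integrable_power|apply: subset_itvl].
have h0 : 0 < 2^-1 :> R by rewrite invr_gt0.
have i2 := fun D => integrableZl D (expR K) (integrable_expN h0).
have i3 := fun D => integrableD D i1 (i2 D).
apply: le_integrable (i3 _) => //.
- apply/measurable_EFinP; apply: measurable_funM; first exact: measurable_expR_ln.
  by apply: measurableT_comp => //; exact: measurable_expR.
- move=> t /=; rewrite in_itv/= andbT => t0.
  rewrite lee_fin !ger0_norm ?mulr_ge0 ?expR_ge0//; last first.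
    by rewrite addr_ge0// ?mulr_ge0 ?expR_ge0// patchE; case: ifP => // _; exact: expR_ge0.
  rewrite patchE mem_setE in_itv/= t0/=; case: ifPn => [t1|].
    rewrite ler_wpDr ?mulr_ge0 ?expR_ge0// ler_piMr ?expR_ge0//.
    by rewrite -expR0 ler_expR oppr_le0 ltW.
  rewrite -ltNge => t1; rewrite /point/= add0r -!expRD ler_expR.
  have := lnle t t0; have : 0 <= ln t by rewrite ln_ge0// ltW.
  by lra.
Qed.


Definition gamma_deriv (n : nat) (z : R) : R :=
  \int[mu]_(t in `]0, +oo[) (expR ((z - 1) * ln t) * ln t ^+ n * expR (- t)).

Lemma GammaE z : Gamma z = gamma_deriv 0 z.
Proof.
apply: eq_Rintegral => t; rewrite inE/= in_itv/= andbT => t0.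
by rewrite powR_expR// expr0 mulr1.
Qed.

Lemma ler_expn_expR (x : R) n : 0 <= x -> x ^+ n <= n`!%:R * expR x.
Proof.
move=> x0; case: n => [|n].
  by rewrite expr0 fact0 mul1r -expR0 ler_expR.
rewrite mulrC -ler_pdivrMr ?ltr0n ?fact_gt0//.
by apply: le_trans (expR_ge1Dxn n x0); rewrite lerDr.
Qed.

(** Powers of the logarithm cost an arbitrarily small power of [t], positive at infinity and
    negative at 0. *)
Lemma normr_lnX_le e t n : 0 < e -> `|ln t ^+ n| <=
  n`!%:R / e ^+ n * (expR (e * ln t) + expR (- e * ln t)).
Proof.
move=> e0; rewrite normrX.
have -> : `|ln t| ^+ n = (e * `|ln t|) ^+ n / e ^+ n.
  by rewrite exprMn mulrAC divff ?mul1r// expf_neq0// gt_eqF.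
rewrite mulrAC ler_wpM2r ?invr_ge0 ?exprn_ge0 ?(ltW e0)//.
apply: (le_trans (ler_expn_expR _ _)); first by rewrite mulr_ge0// ltW.
rewrite ler_wpM2l//; have [l0|l0] := leP 0 (ln t).
  by rewrite ger0_norm// lerDl expR_ge0.
by rewrite ltr0_norm// mulrN -mulNr lerDr expR_ge0.
Qed.

Lemma expR_ln_between u v z t : u <= z <= v ->
  expR ((z - 1) * ln t) <= expR ((u - 1) * ln t) + expR ((v - 1) * ln t).
Proof.
move=> /andP[uz zv]; have [l0|l0] := leP 0 (ln t).
  by rewrite ler_wpDl ?expR_ge0// ler_expR ler_wpM2r// lerD2r.
by rewrite ler_wpDr ?expR_ge0// ler_expR ler_wnM2r ?lerD2r// ltW.
Qed.

(** A majorant for all [z] in [[u, v]] at once: [expR_ln_between] replaces [z] by the two ends, and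
    the logarithms cost the power [u / 2]. This is small enough for the integrands to keep the form
    [t^(c - 1) * expR (- t)] with [c > 0]. *)
Definition gamma_dominator (n : nat) u v t :=
  n`!%:R / (u / 2) ^+ n *
  ((expR ((u / 2 - 1) * ln t) + expR ((u + u / 2 - 1) * ln t)
    + expR ((v - u / 2 - 1) * ln t) + expR ((v + u / 2 - 1) * ln t)) * expR (- t)).

Lemma gamma_dominatorP n u v z t : 0 < u -> u <= z <= v ->
  `|expR ((z - 1) * ln t) * ln t ^+ n * expR (- t)| <= gamma_dominator n u v t.
Proof.
move=> u0 uzv; have u20 : 0 < u / 2 by rewrite divr_gt0.
rewrite 2!normrM ![`|expR _|]ger0_norm ?expR_ge0//.
have H1 := expR_ln_between t uzv; have H2 := normr_lnX_le t n u20.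
rewrite /gamma_dominator mulrA ler_wpM2r ?expR_ge0//.
apply: (le_trans (ler_pM (expR_ge0 _) (normr_ge0 _) H1 H2)).
rewrite mulrCA ler_wpM2l ?divr_ge0 ?exprn_ge0 ?(ltW u20)//.
rewrite mulrDl !mulrDr -!expRD -!mulrDl.
rewrite le_eqVlt; apply/orP; left; apply/eqP.
rewrite (_ : u - 1 + u / 2 = u + u / 2 - 1); last by ring.
rewrite (_ : u - 1 + - (u / 2) = u / 2 - 1); last by field.
rewrite (_ : v - 1 + u / 2 = v + u / 2 - 1); last by ring.
rewrite (_ : v - 1 + - (u / 2) = v - u / 2 - 1); last by ring.
by ring.
Qed.

Lemma integrable_gamma_dominator n u v : 0 < u -> u <= v ->
  mu.-integrable `]0, +oo[ (EFin \o gamma_dominator n u v).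
Proof.
move=> u0 uv.
have i1 : mu.-integrable `]0, +oo[ (EFin \o (fun t => expR ((u / 2 - 1) * ln t) * expR (- t))).
  by apply: integrable_gamma; lra.
have i2 : mu.-integrable `]0, +oo[ (EFin \o (fun t => expR ((u + u / 2 - 1) * ln t) * expR (- t))).
  by apply: integrable_gamma; lra.
have i3 : mu.-integrable `]0, +oo[ (EFin \o (fun t => expR ((v - u / 2 - 1) * ln t) * expR (- t))).
  by apply: integrable_gamma; lra.
have i4 : mu.-integrable `]0, +oo[ (EFin \o (fun t => expR ((v + u / 2 - 1) * ln t) * expR (- t))).
  by apply: integrable_gamma; lra.
have mI : measurable (`]0%R, +oo[%classic : set (measurableTypeR R)) by exact: measurable_itv.
have := integrableZl mI (n`!%:R / (u / 2) ^+ n)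
  (integrableD mI (integrableD mI (integrableD mI i1 i2) i3) i4).
apply: eq_integrable => // t _; rewrite /gamma_dominator /=.
by rewrite -!EFinD -EFinM !mulrDl.
Qed.

Lemma integrable_gamma_deriv n z : 0 < z ->
  mu.-integrable `]0, +oo[ (EFin \o (fun t => expR ((z - 1) * ln t) * ln t ^+ n * expR (- t))).
Proof.
move=> z0; apply: le_integrable (integrable_gamma_dominator n z0 (lexx z)) => //.
  apply/measurable_EFinP; apply: measurable_funM.
    apply: measurable_funM; first exact: measurable_expR_ln.
    have mln : measurable_fun (`]0, +oo[%classic : set R) (@ln R).
      exact: (measurable_funTS (@measurable_ln R)).
    exact: (measurable_funX n mln).
  by apply: measurableT_comp => //; exact: measurable_expR.
move=> t _; rewrite /= lee_fin.
rewrite [leRHS]ger0_norm; first by apply: gamma_dominatorP => //; rewrite lexx.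
have := @gamma_dominatorP n z z z t z0; rewrite lexx => /(_ isT).
exact: le_trans.
Qed.

Lemma gamma_deriv_bound n u v : 0 < u -> u <= v ->
  exists M, forall z, u <= z <= v -> `|gamma_deriv n z| <= M.
Proof.
move=> u0 uv; exists (\int[mu]_(t in `]0, +oo[) gamma_dominator n u v t) => z uzv.
have z0 : 0 < z by apply: lt_le_trans u0 _; case/andP: uzv.
have ii := integrable_gamma_deriv n z0.
apply: (le_trans (le_normr_Rintegral _ ii)) => //.
apply: le_Rintegral => //; last by move=> t _; exact: gamma_dominatorP.
  apply: le_integrable ii => //; last by move=> t _; rewrite /= normr_id.
  by apply/measurable_EFinP; apply: measurableT_comp => //; apply/measurable_EFinP;
    exact: (measurable_int mu (integrable_gamma_deriv n z0)).
exact: integrable_gamma_dominator.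
Qed.

(** Differentiation under the integral sign on []z / 2, z + 1[], which stays away from 0, so that
    one dominator serves all its points. *)
Lemma is_derive_gamma_deriv n z : 0 < z ->
  is_derive z 1 (gamma_deriv n) (gamma_deriv n.+1 z).
Proof.
move=> z0.
pose f z t := expR ((z - 1) * ln t) * ln t ^+ n * expR (- t).
have df (x t : R) : is_derive x 1 (f^~ t) (expR ((x - 1) * ln t) * ln t ^+ n.+1 * expR (- t)).
  by apply: is_derive_eq; rewrite /GRing.scale/= exprS; ring.
have Iz : (`]z / 2, z + 1[%classic : set R) z by rewrite /= in_itv/=; apply/andP; split; lra.
have z20 : 0 < z / 2 by lra.
have intf (x : R) : (`]z / 2, z + 1[%classic : set R) x -> mu.-integrable `]0, +oo[ (EFin \o f x).
  rewrite /= in_itv/= => /andP[x0 _]; apply: integrable_gamma_deriv; lra.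
have derf (x t : R) : (`]z / 2, z + 1[%classic : set R) x -> (`]0, +oo[%classic : set R) t ->
    derivable (f^~ t) x 1.
  by move=> _ _; have dx := df x t; exact: ex_derive.
pose D := gamma_dominator n.+1 (z / 2) (z + 1).
have D0 t : 0 <= D t.
  have := @gamma_dominatorP n.+1 (z / 2) (z + 1) z t z20; rewrite -/(D t).
  have -> : (z / 2 <= z <= z + 1) by apply/andP; split; lra.
  by move=> /(_ isT); exact: le_trans.
have iD : mu.-integrable `]0, +oo[ (EFin \o D).
  by apply: integrable_gamma_dominator => //; lra.
have Dub (x t : R) : (`]z / 2, z + 1[%classic : set R) x -> (`]0, +oo[%classic : set R) t ->
    `|partial1of2 f x t| <= D t.
  rewrite /= in_itv/= => /andP[x1 x2] _; rewrite partial1of2E.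
  have dx := df x t; rewrite derive_val; apply: gamma_dominatorP => //.
  by rewrite (ltW x1) (ltW x2).
have mI : measurable (`]0%R, +oo[%classic : set (measurableTypeR R)) by exact: measurable_itv.
have H1 := @derivable_under_integral _ _ _ mu f _ mI _ _ _ Iz intf derf D D0 iD Dub.
have H2 := @differentiation_under_integral _ _ _ mu f _ mI _ _ _ Iz intf derf D D0 iD Dub.
apply: DeriveDef => //; rewrite -derive1E H2.
apply: eq_Rintegral => t _; rewrite partial1of2E; have dx := df z t; exact: derive_val.
Qed.

(** On [[1, 2]] one has [t^(z - 1) >= 1 / t >= 1 / 2] for every [z > 0]. The bound is uniform in [z]
    and so bounds the reciprocal of Gamma. *)
Lemma gamma_lower_bound z : 0 < z -> expR (- 2) / 2 <= gamma_deriv 0 z.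
Proof.
move=> z0; have ii := integrable_gamma_deriv 0 z0.
have mI : measurable (`]0%R, +oo[%classic : set (measurableTypeR R)) by exact: measurable_itv.
have -> : expR (- 2) / 2 = \int[mu]_(t in `[1, 2]) (expR (- 2) / 2) :> R.
  rewrite Rintegral_cst//= lebesgue_measure_itv/= lte_fin ltr1n -EFinB/=.
  by rewrite (_ : 2 - 1 = 1) ?mulr1//; ring.
have sub : `[1, 2]%classic `<=` (`]0, +oo[%classic : set R).
  by apply: subset_itv; rewrite bnd_simp.
have mJ : measurable (`[1%R, 2%R]%classic : set (measurableTypeR R)) by exact: measurable_itv.
have ii12 := integrableS mI mJ sub ii.
apply: (@le_trans _ _ (\int[mu]_(t in `[1, 2]) (expR ((z - 1) * ln t) * ln t ^+ 0 * expR (- t)))).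
  apply: le_Rintegral => //.
    apply: measurable_bounded_integrable => //=.
      by rewrite lebesgue_measure_itv/=; case: ifP => // _; rewrite -EFinB ltry.
    by exists `|expR (- 2) / 2|; split; [exact: num_real|move=> x cx ? _; exact: ltW].
  move=> t /=; rewrite in_itv/= => /andP[t1 t2]; rewrite expr0 mulr1 mulrC.
  have t0 : 0 < t by exact: lt_le_trans t1.
  have lt0 : 0 <= ln t by rewrite ln_ge0.
  apply: ler_pM; rewrite ?invr_ge0 ?expR_ge0//; last by rewrite ler_expR lerN2.
  apply: (@le_trans _ _ (expR (- ln t))).
    by rewrite expRN lnK// lef_pV2 ?posrE.
  by rewrite ler_expR; nra.
rewrite -lee_fin /gamma_deriv /Rintegral !fineK ?integrable_fin_num//.
apply: ge0_subset_integral => //.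
- exact: (measurable_int mu ii).
- by move=> t _; rewrite lee_fin expr0 mulr1 mulr_ge0 ?expR_ge0.
Qed.

End gamma_function.

(** * The fundamental theorem for a derivative singular at 0 *)

Section dominated_fundamental_theorem.
Context {R : realType}.
Notation mu := (@lebesgue_measure R).
Implicit Types (b c t u x e h T : R) (K q g : R -> R).

Lemma is_derive_near K x l e : is_derive x 1 K l -> 0 < e ->
  exists2 d, 0 < d & forall h, h != 0 -> `|h| < d -> `|(K (x + h) - K x) / h - l| < e.
Proof.
move=> dK e0; have [/cvg_ex[l' Hl'] Dl] := dK.
have ll' : l' = l by rewrite -Dl; apply/esym; exact: cvg_lim Hl'.
rewrite {}ll' in Hl'.
have /cvgrPdist_lt/(_ e e0)/nbhs_ballP[d /= d0 dP] := Hl'.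
exists d => // h h0 hd; have := dP h; rewrite /ball/= sub0r normrN => /(_ hd h0).
have -> : h%:A = h :> R by rewrite /GRing.scale/= mulr1.
by rewrite distrC (addrC x h) [_ *: _]mulrC.
Qed.

Lemma harmonic_small e : 0 < e -> \forall n \near \oo, n.+1%:R^-1 < e :> R.
Proof.
move=> e0; have /cvgrPdist_lt/(_ e e0) := @cvg_harmonic R.
apply: filterS => n /=; rewrite /harmonic/= sub0r normrN gtr0_norm ?invr_gt0//.
Qed.

Lemma quotient_cvg K x l : is_derive x 1 K l ->
  (K (x + n.+1%:R^-1) - K x) / n.+1%:R^-1 @[n --> \oo] --> l.
Proof.
move=> dK; apply/cvgrPdist_lt => e e0; have [d d0 dP] := is_derive_near dK e0.
have := harmonic_small d0; apply: filterS => n nd; rewrite distrC; apply: dP.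
  by rewrite invr_eq0 pnatr_eq0.
by rewrite gtr0_norm ?invr_gt0.
Qed.

(** A derivative is a limit of difference quotients. [K] is extended by 0 to make them measurable;
    near a given interior point the extension is not felt once the step is small. *)
Lemma measurable_derivative K q T : measurable_fun `[0, T] K ->
  (forall x, x \in `]0, T[ -> is_derive x 1 K (q x)) -> measurable_fun `]0, T[ q.
Proof.
move=> mK dK.
have mK' : measurable_fun setT (K \_ `[0, T]).
  by apply/(measurable_restrict _ _ _).1 => //; rewrite setTI.
apply: (@measurable_fun_cvg _ _ _ _
  (fun n x => ((K \_ `[0, T]) (x + n.+1%:R^-1) - (K \_ `[0, T]) x) / n.+1%:R^-1)) => //.
  move=> n; apply: measurable_funM => //; apply: measurable_funB.
    apply: (measurable_funTS (f := (K \_ `[0, T]) \o (fun x => x + n.+1%:R^-1))).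
    by apply: measurableT_comp => //; exact: measurable_funD.
  exact: measurable_funTS.
move=> x /= xT; have H := quotient_cvg (dK x xT).
move: xT; rewrite in_itv/= => /andP[x0 xT].
apply: cvg_trans H; apply: near_eq_cvg.
have : 0 < T - x by lra.
move=> /harmonic_small; apply: filterS => n nT.
have n0 : 0 < n.+1%:R^-1 :> R by rewrite invr_gt0.
by move: (n.+1%:R^-1) nT n0 => e nT e0; rewrite !patchE !mem_setE !in_itv/= !ifT//; apply/andP; split; lra.
Qed.

Lemma Rintegral_translate K b h T : 0 <= b -> 0 <= h -> b + h <= T -> L1 T K ->
  \int[mu]_(x in `]0, b]) K (x + h) = prim K (b + h) - prim K h.
Proof.
move=> b0 h0 bT iK; have ibh := L1_sub iK (lexx 0) bT.
rewrite /prim (@Rintegral_itvB _ _ (BLeft 0) (BRight (b + h)) h) ?bnd_simp//; last by lra.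
rewrite Rintegral_mkcond [RHS]Rintegral_mkcond.
have mF : measurable_fun setT (EFin \o (K \_ `]h, b + h])).
  apply/measurable_EFinP; apply/(measurable_restrict _ _ _).1 => //; rewrite setTI.
  apply: (@measurable_funS _ _ _ _ `[0, T]) => //; last exact: L1_measurable.
  by apply: subset_itv; rewrite bnd_simp.
rewrite /Rintegral -(integral_translate (- h) mF); congr fine.
apply: eq_integral => x _; congr (_%:E); rewrite !patchE !mem_setE !in_itv/= opprK.
have -> : (0 < x <= b) = (h < x + h <= b + h) by rewrite ltrDr lerD2r.
by [].
Qed.

(** By the mean value theorem the forward quotient at [x] is [q c] for some [c > x], hence at most
    [g c <= g x] as [g] is nonincreasing: dominated convergence applies although [q] may be
    unbounded at 0. Taking [b < T] leaves room for the forward step. *)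
Lemma dominated_FTC K q g T b : 0 <= b < T ->
  {within `[0, T], continuous K} -> L1 T g -> measurable_fun `[0, T] q ->
  (forall x, x \in `]0, T[ -> is_derive x 1 K (q x)) ->
  (forall x, x \in `]0, T[ -> `|q x| <= g x) ->
  (forall x y, 0 < x -> x <= y -> y < T -> g y <= g x) ->
  prim q b = K b - K 0.
Proof.
move=> /andP[b0 bT] cK ig mq dK qg ng.
have T0 : 0 < T by exact: le_lt_trans bT.
have iK := L1_continuous cK.
have bT0 : 0 < T - b by rewrite subr_gt0.
have [N _ NP] := harmonic_small bT0.
(* The shift by [N] keeps [b + h n] below [T] for every [n]. *)
pose h n : R := (n + N).+1%:R^-1.
have h0 n : 0 < h n by rewrite invr_gt0.
have hT n : b + h n < T by rewrite addrC -ltrBrDr; exact: NP (leq_addl n N).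
pose D n x := (K (x + h n) - K x) / h n.
have b'T x : x \in `]0, b] -> x \in `]0, T[.
  by rewrite !in_itv/= => /andP[-> xb]; exact: le_lt_trans bT.
have mI : measurable (`]0, b]%classic : set (measurableTypeR R)) by exact: measurable_itv.
have iKb : mu.-integrable `]0, b] (EFin \o K).
  apply: (integrableS _ _ _ iK) => //; apply: subset_itv; rewrite bnd_simp//; exact: ltW.
have iKh n : mu.-integrable `]0, b] (EFin \o (fun x => K (x + h n))).
  have i1 := L1_restrict iK.
  have := @integrable_reflect _ 0 _ (@integrable_reflect _ (h n) _ i1).
  move=> /(integrableS measurableT mI (@subsetT _ _)); apply: eq_integrable => // x.
  rewrite inE/= in_itv/= => /andP[x0 xb]; rewrite patchE mem_setE in_itv/=.
  have -> : h n - (0 - x) = x + h n by rewrite sub0r opprK addrC.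
  rewrite ifT//; apply/andP; split; first by rewrite addr_ge0// ltW.
  by have := hT n; lra.
have iD n : mu.-integrable `]0, b] (EFin \o D n).
  have := integrableZl mI (h n)^-1 (integrableB mI (iKh n) iKb).
  by apply: eq_integrable => // x _; rewrite /D /= mulrC.
have mD n : measurable_fun (`]0, b] : set (measurableTypeR R)) (EFin \o D n).
  exact: (measurable_int mu).
have igb : mu.-integrable `]0, b] (EFin \o g).
  apply: (integrableS _ _ _ ig) => //; apply: subset_itv; rewrite bnd_simp//; exact: ltW.
have mqb : measurable_fun (`]0, b] : set (measurableTypeR R)) (EFin \o q).
  apply/measurable_EFinP; apply: measurable_funS mq => //.
  by apply: subset_itv; rewrite bnd_simp//; exact: ltW.
have cvgD : {ae mu, forall x, `]0, b]%classic x -> (EFin \o D n) x @[n --> \oo] --> (EFin \o q) x}.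
  apply/aeW => x /b'T xT; apply: cvg_EFin; first exact: nearW.
  have := quotient_cvg (dK x xT).
  by rewrite -(cvg_shiftn N).
have domD : {ae mu, forall x n, `]0, b]%classic x -> (`|(EFin \o D n) x| <= (EFin \o g) x)%E}.
  apply/aeW => x n xb; have xT := b'T _ xb; rewrite /= lee_fin /D normrM normfV.
  have xh : x < x + h n by rewrite ltrDl.
  have [x0 xhT] : 0 < x /\ x + h n < T.
    by move: xb (hT n) => /=; rewrite in_itv/= => /andP[-> xb] ?; split=> //; lra.
  have sub y : y \in `[x, x + h n] -> y \in `]0, T[.
    rewrite !in_itv/= => /andP[xy yx]; rewrite (lt_le_trans x0 xy)/=.
    exact: le_lt_trans xhT.
  have dKs y : y \in `]x, x + h n[ -> is_derive y 1 K (q y).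
    by move=> /subset_itv_oo_cc /sub; exact: dK.
  have cKs : {within `[x, x + h n], continuous K}.
    apply: continuous_subspaceW cK; apply: subset_itv; rewrite bnd_simp ltW//.
  have [c cI ->] := MVT xh dKs cKs.
  have -> : x + h n - x = h n by rewrite addrC addKr.
  rewrite normrM mulfK ?normr_eq0 ?gt_eqF//.
  have cT := sub _ (subset_itv_oo_cc cI); apply: (le_trans (qg _ cT)).
  move: cI cT; rewrite !in_itv/= => /andP[xc _] /andP[_ cT].
  by apply: ng => //; exact: ltW.
have [_ _ DC] := dominated_convergence mI mD mqb cvgD igb domD.
have intq : mu.-integrable `]0, b] (EFin \o q).
  apply: le_integrable igb => // x /b'T xT /=; rewrite lee_fin.
  by rewrite (le_trans (qg _ xT))// ler_norm.
have -> : prim q b = \int[mu]_(x in `]0, b]) q x by rewrite /prim -Rintegral_itv_obnd_cbnd.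
(* By cancellation on the overlap, the integral of the quotient is the mean of [K] over
   [[b, b + h n]] minus its mean over [[0, h n]], and these tend to [K b] and [K 0]. *)
have DE n : \int[mu]_(x in `]0, b]) D n x =
    (prim K (b + h n) - prim K b) / h n - (prim K (0 + h n) - prim K 0) / h n.
  rewrite (_ : D n = fun x => (K (x + h n) - K x) * (h n)^-1)//.
  rewrite RintegralZr//; last exact: (integrableB mI (iKh n) iKb).
  rewrite RintegralB// (Rintegral_translate b0 (ltW (h0 n)) (ltW (hT n)) iK).
  have -> : \int[mu]_(x in `]0, b]) K x = prim K b by rewrite /prim -Rintegral_itv_obnd_cbnd.
  by rewrite prim0 add0r; ring.
have dprim t : 0 <= t -> t <= b -> (prim K (t + h n) - prim K t) / h n @[n --> \oo] --> K t.
  move=> t0 tb; have tT : t \in `[0, T] by rewrite in_itv/= t0 ltW// (le_lt_trans tb).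
  have H := @derivable_on_prim _ T (prim K) K 0 cK (fun s _ => esym (add0r _)) t tT.
  apply/cvgrPdist_lt => e e0.
  have /cvgrPdist_lt/(_ e e0)/within_dnbhsP[d d0 dP] := H.
  have [M _ MP] := harmonic_small d0.
  exists M => // n /= Mn; have := dP (t + h n).
  have -> : t + h n - t = h n by rewrite addrC addKr.
  apply.
  - by rewrite gtr0_norm//; apply: MP; rewrite /= (leq_trans Mn)// leq_addr.
  - by rewrite -subr_eq0 addrC addKr gt_eqF.
  - by move: (h n) (hT n) (h0 n) => y yT y0; rewrite /= in_itv/=; apply/andP; split; lra.
have L1' : \int[mu]_(x in `]0, b]) D n x @[n --> \oo] --> K b - K 0.
  under eq_fun do rewrite DE.
  by apply: cvgB; apply: dprim.
have L2' : \int[mu]_(x in `]0, b]) D n x @[n --> \oo] --> \int[mu]_(x in `]0, b]) q x.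
  move: DC; rewrite /= Rintegral_EFin//.
  under eq_fun do rewrite Rintegral_EFin//.
  by move=> /fine_cvg.
exact: (cvg_unique _ L2' L1').
Qed.

End dominated_fundamental_theorem.

Section weighted_bounds.
Context {R : realType}.
Implicit Types (T : R) (w f g : R -> R).

Definition bounded_by T w f := exists2 C, 0 <= C & forall t, 0 < t < T -> `|f t| <= C * w t.

Lemma bounded_byD T w f g : bounded_by T w f -> bounded_by T w g ->
  bounded_by T w (fun t => f t + g t).
Proof.
move=> [C C0 fC] [D D0 gD]; exists (C + D); first exact: addr_ge0.
by move=> t tT; rewrite mulrDl (le_trans (ler_normD _ _))// lerD ?fC ?gD.
Qed.

Lemma bounded_byM T w f g : bounded_by T (cst 1) f -> bounded_by T w g ->
  bounded_by T w (fun t => f t * g t).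
Proof.
move=> [C C0 fC] [D D0 gD]; exists (C * D); first exact: mulr_ge0.
move=> t tT; rewrite normrM -mulrA ler_pM ?gD//.
by have := fC t tT; rewrite /= mulr1.
Qed.

Lemma bounded_byW T w w' f : (exists2 C, 0 <= C & forall t, 0 < t < T -> w t <= C * w' t) ->
  bounded_by T w f -> bounded_by T w' f.
Proof.
move=> [C C0 wC] [D D0 fD]; exists (D * C); first exact: mulr_ge0.
move=> t tT; apply: (le_trans (fD t tT)); rewrite -mulrA ler_wpM2l//; exact: wC.
Qed.

Lemma bounded_byN T w f : bounded_by T w f -> bounded_by T w (fun t => - f t).
Proof. by move=> [C C0 fC]; exists C => // t tT; rewrite normrN fC. Qed.

Lemma eq_bounded_by T w f g : (forall t, 0 < t < T -> f t = g t) ->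
  bounded_by T w f -> bounded_by T w g.
Proof. by move=> fg [C C0 fC]; exists C => // t tT; rewrite -fg// fC. Qed.

End weighted_bounds.

Section reciprocal_gamma.
Context {R : realType}.

(** The kernel is a first derivative and [q] a second one, so two derivatives of the reciprocal are
    needed. The condition [a <= a0 < 1] keeps [1 - a] away from 0, which bounds the derivatives of
    Gamma; [gamma_lower_bound] bounds the reciprocal. *)
Lemma reciprocal_gamma (a0 : R) : a0 < 1 -> exists g1 g2 : R -> R, exists M : R,
  [/\ forall a : R, a < 1 -> is_derive a 1 (fun a : R => (Gamma (1 - a))^-1) (g1 a),
      forall a : R, a < 1 -> is_derive a 1 g1 (g2 a) &
      forall a : R, 0 <= a <= a0 -> [/\ `|(Gamma (1 - a))^-1| <= M, `|g1 a| <= M & `|g2 a| <= M]].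
Proof.
move=> a01.
pose G n a := @gamma_deriv R n (1 - a).
have dG n (a : R) : a < 1 -> is_derive a 1 (G n) (- G n.+1 a).
  move=> a1; have z0 : 0 < 1 - a by rewrite subr_gt0.
  have dz := is_derive_gamma_deriv n z0.
  by rewrite /G; apply: is_derive_eq; ring.
have G0 (a : R) : a < 1 -> expR (- 2) / 2 <= G 0%N a.
  by move=> a1; apply: gamma_lower_bound; rewrite subr_gt0.
have e0 : 0 < expR (- 2) / 2 :> R by rewrite divr_gt0 ?expR_gt0.
have Gn0 (a : R) : a < 1 -> G 0%N a != 0.
  by move=> a1; rewrite gt_eqF// (lt_le_trans e0)// G0.
have MB n : exists M, forall a : R, 0 <= a <= a0 -> `|G n a| <= M.
  have [||M MP] := @gamma_deriv_bound R n (1 - a0) (Num.max (1 - a0) 1).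
  - by rewrite subr_gt0.
  - by rewrite le_max lexx.
  exists M => a /andP[a_ge0 aa]; apply: MP; rewrite le_max lerD2l lerN2 aa/=.
  by apply/orP; right; rewrite gerBl.
have [M1 M1P] := MB 1%N; have [M2 M2P] := MB 2%N.
have GE : (fun a => (Gamma (1 - a))^-1) = (fun a => (G 0%N a)^-1).
  by apply/funext => a; rewrite GammaE.
pose I a := (G 0%N a)^-1.
exists (fun a => I a ^+ 2 * G 1%N a).
exists (fun a => 2 * I a ^+ 3 * G 1%N a ^+ 2 - I a ^+ 2 * G 2%N a).
have dI (a : R) : a < 1 -> is_derive a 1 I (I a ^+ 2 * G 1%N a).
  move=> a1; have d0 := dG 0%N a a1; have g0 := Gn0 a a1.
  by apply: (is_derive_eq (is_deriveV g0 d0)); rewrite /GRing.scale/= /I exprVn; ring.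
pose e := (expR (- 2) / 2 : R)^-1.
have I0 (a : R) : 0 <= a <= a0 -> `|I a| <= e.
  move=> /andP[_ aa]; have a1 : a < 1 by exact: le_lt_trans a01.
  have H := G0 a a1; have H0 := lt_le_trans e0 H.
  by rewrite /I normfV gtr0_norm// lef_pV2 ?posrE.
exists (Num.max e (Num.max (e ^+ 2 * M1) (2 * e ^+ 3 * M1 ^+ 2 + e ^+ 2 * M2))).
rewrite GE; split => //.
- move=> a a1; have d0 := dI a a1; have d1 := dG 1%N a a1.
  by apply: is_derive_eq; rewrite /GRing.scale/=; ring.
- move=> a aa; rewrite !le_max; split.
  + by rewrite GammaE -/(G 0%N a) -/(I a) I0.
  + apply/orP; right; apply/orP; left; rewrite normrM normrX ler_pM ?exprn_ge0 ?M1P//.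
    by rewrite lerXn2r ?nnegrE ?I0// (le_trans _ (I0 _ aa)).
  + apply/orP; right; apply/orP; right; apply: (le_trans (ler_normB _ _)).
    have IX n : `|I a| ^+ n <= e ^+ n by rewrite lerXn2r ?nnegrE ?I0// (le_trans _ (I0 _ aa)).
    rewrite 2!normrM [`|I a ^+ 2 * _|]normrM !normrX ger0_norm//; apply: lerD; apply: ler_pM; rewrite ?mulr_ge0 ?exprn_ge0 ?M2P ?IX//.
    * by rewrite ler_wpM2l.
    * by rewrite lerXn2r ?nnegrE ?M1P// (le_trans _ (M1P _ aa)).
Qed.

End reciprocal_gamma.

Section derivatives_on_intervals.
Context {R : realType}.
Notation mu := (@lebesgue_measure R).

Lemma deriv_on_is_derive (D : set R) (y : R -> R) (t l : R) :
  (\forall s \near t, D s) -> is_derive t 1 y l -> deriv_on D y t = l.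
Proof.
move=> /nbhs_ballP[d' /= d'0 dD] dy.
have PF : ProperFilter (within D t^').
  apply: Build_ProperFilter_ex => B /within_dnbhsP[d d0 dB].
  pose e := Num.min d d' / 2.
  have m0 : 0 < Num.min d d' by rewrite lt_min d0.
  have e0 : 0 < e by rewrite divr_gt0.
  have em : e < Num.min d d' by rewrite /e; lra.
  exists (t + e); apply: dB.
  - by rewrite addrC addKr gtr0_norm// (lt_le_trans em)// ge_min lexx.
  - by rewrite -subr_eq0 addrC addKr gt_eqF.
  - by apply: dD; rewrite /ball/= opprD addNKr normrN gtr0_norm// (lt_le_trans em)// ge_min lexx orbT.
apply: cvg_lim => //; apply/cvgrPdist_lt => e e0.
have [d d0 dP] := is_derive_near dy e0.
apply/within_dnbhsP; exists d => // s std st Ds; rewrite distrC.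
by have := dP (s - t); rewrite [t + _]addrC subrK; apply; rewrite ?subr_eq0.
Qed.

Lemma L1_power_bound (T c C : R) (f : R -> R) : 0 < c -> measurable_fun `[0, T] f ->
  (forall t, 0 < t < T -> `|f t| <= C * expR ((c - 1) * ln t)) ->
  (forall t, ~~ (0 < t < T) -> f t = 0) -> L1 T f.
Proof.
move=> c0 mf fC f0.
have i1 : mu.-integrable `[0, T] ((EFin \o (fun t => expR ((c - 1) * ln t))) \_ `]0, T]).
  apply/(integrable_restrict _ _ _ _).1 => //; rewrite setIidr; first exact: integrable_power.
  by apply: subset_itv; rewrite bnd_simp.
have i2 := fun D => integrableZl D C i1.
apply: (le_integrable _ _ _ (i2 _)) => //; first exact/measurable_EFinP.
move=> t _; case: (boolP (0 < t < T)) => tT; last first.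
  by rewrite /comp f0// abse0; exact: abse_ge0.
rewrite patchE mem_setE in_itv/=; have /andP[t0 tT1] := tT.
rewrite t0 (ltW tT1)/= lee_fin; apply: (le_trans (fC _ tT)); exact: ler_norm.
Qed.

End derivatives_on_intervals.

(** * The memory kernel as a primitive *)

Section memory_kernel.
Context {R : realType}.
Notation mu := (@lebesgue_measure R).
Variables (T : R) (T0 : 0 < T) (alpha : R -> R) (alphastar Q : R).
Implicit Types (t s x c L C : R) (f df : R -> R).
Hypothesis alphastar_lt1 : alphastar < 1.
Hypothesis alpha_bound : forall t : R, t \in `[0, T] -> 0 <= alpha t <= alphastar.
Hypothesis alpha_derivable : derivable_on `[0, T] alpha.
Let alpha1 := deriv_on `[0, T] alpha.
Hypothesis alpha_derivable2 : derivable_on `[0, T] alpha1.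
Let alpha2 := deriv_on `[0, T] alpha1.
Hypothesis alpha2_bound : forall t : R, t \in `[0, T] -> `|alpha2 t| <= Q.
Hypothesis alpha0 : alpha 0 = 0.
Hypothesis alpha10 : alpha1 0 = 0.

Let Q0 : 0 <= Q.
Proof.
by apply: le_trans (alpha2_bound (t := 0) _); rewrite // in_itv/= lexx ltW.
Qed.

(** Used first with alpha'(0) = 0 and then with alpha(0) = 0: a bound on alpha'' becomes [Q * t] for
    alpha' and [Q * t ^+ 2] for alpha. *)
Let MVT0 (f df : R -> R) t : {within `[0, T], continuous f} ->
  (forall x, x \in `]0, T[ -> is_derive x 1 f (df x)) -> f 0 = 0 -> 0 < t < T ->
  exists2 c, 0 < c < t & f t = df c * t.
Proof.
move=> coef dfx f0 /andP[t0 tT].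
have dfs x : x \in `]0, t[ -> is_derive x 1 f (df x).
  by rewrite in_itv/= => /andP[x0 xt]; apply: dfx; rewrite in_itv/= x0 (lt_trans xt).
have cfs : {within `[0, t], continuous f}.
  by apply: continuous_subspaceW coef; apply: subset_itv; rewrite bnd_simp// ltW.
have [c cI fE] := MVT t0 dfs cfs; exists c; first by move: cI; rewrite in_itv.
by move: fE; rewrite f0 !subr0.
Qed.

Let alpha1_le t : 0 < t < T -> `|alpha1 t| <= Q * t.
Proof.
move=> /[dup] tT /andP[t0 tT1].
have [c /andP[c0 ct] ->] := MVT0 (derivable_on_continuous alpha_derivable2)
  (fun x => derivable_on_interior alpha_derivable2 (t := x)) alpha10 tT.
rewrite normrM (gtr0_norm t0) ler_wpM2r ?(ltW t0)// alpha2_bound// in_itv/= ltW//=.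
by rewrite ltW// (lt_trans ct).
Qed.

Let alpha_le t : 0 < t < T -> `|alpha t| <= Q * t ^+ 2.
Proof.
move=> /[dup] tT /andP[t0 tT1].
have [c /andP[c0 ct] ->] := MVT0 (derivable_on_continuous alpha_derivable)
  (fun x => derivable_on_interior alpha_derivable (t := x)) alpha0 tT.
rewrite normrM (gtr0_norm t0) expr2 mulrA ler_wpM2r ?(ltW t0)//.
apply: (le_trans (alpha1_le _)); first by rewrite c0 (lt_trans ct).
by rewrite ler_wpM2l// ltW.
Qed.

(* rho t = t^(-1/4) and tau t = t^(3/4). As ln = O(rho), the derivative of the
   kernel is O(rho), which is square integrable. *)
Let rho t : R := expR ((3 / 4 - 1) * ln t).
Let tau t : R := expR (3 / 4 * ln t).

Let tauE t : 0 < t -> t * rho t = tau t.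
Proof.
by move=> t0; rewrite /rho /tau -{1}(lnK t0) -expRD; congr expR; field.
Qed.

Let ln_le t : 0 < t < T -> ln t <= ln T.
Proof. by move=> /andP[t0 tT]; rewrite ler_ln ?posrE// ltW. Qed.

Let rho_ge t : 0 < t < T -> rho T <= rho t.
Proof.
move=> tT; rewrite /rho ler_expR; have := ln_le tT; lra.
Qed.

Let tau_le t : 0 < t < T -> tau t <= tau T.
Proof.
by move=> tT; rewrite /tau ler_expR ler_wpM2l ?ln_le//; lra.
Qed.

(** [normr_lnX_le] with exponent 1/4 gives 4 (t^(1/4) + t^(-1/4)), and t^(1/4) is t^(1/2) times
    [rho t], at most T^(1/2) times [rho t]. *)
Let ln_bound : exists2 L, 0 <= L & forall t, 0 < t < T -> `|ln t| <= L * rho t.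
Proof.
exists (4 * (1 + expR (ln T / 2))); first by rewrite mulr_ge0// addr_ge0 ?expR_ge0.
move=> t tT; have q4 : 0 < 4^-1 :> R by rewrite invr_gt0.
have := normr_lnX_le t 1 q4; rewrite !expr1 => /le_trans; apply.
have -> : (1`!)%:R = 1 :> R by [].
rewrite div1r invrK -mulrA ler_wpM2l//.
have -> : expR (4^-1 * ln t) = expR (ln t / 2) * rho t.
  by rewrite /rho -expRD; congr expR; field.
have -> : expR (- 4^-1 * ln t) = rho t by rewrite /rho; congr expR; field.
rewrite addrC mulrDl mul1r lerD2l ler_wpM2r ?expR_ge0// ler_expR.
by have := ln_le tT; lra.
Qed.

Notation bounded := (bounded_by T (cst 1)).
Notation rho_bounded := (bounded_by T rho).
Notation tau_bounded := (bounded_by T tau).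

Let bounded_rho f : bounded f -> rho_bounded f.
Proof.
apply: bounded_byW; exists (rho T)^-1; first by rewrite invr_ge0 expR_ge0.
by move=> t tT; rewrite mulrC ler_pdivlMr ?expR_gt0// mul1r rho_ge.
Qed.

Let tau_bounded_bounded f : tau_bounded f -> bounded f.
Proof.
apply: bounded_byW; exists (tau T); first exact: expR_ge0.
by move=> t tT; rewrite mulr1 tau_le.
Qed.

Let id_tau : tau_bounded (fun t => t).
Proof.
exists (expR (ln T / 4)); first exact: expR_ge0.
move=> t /[dup] tT /andP[t0 _]; rewrite (gtr0_norm t0) -{1}(lnK t0) /tau -expRD ler_expR.
by have := ln_le tT; lra.
Qed.

Let alpha1_tau : tau_bounded alpha1.
Proof.
have [C C0 HC] := id_tau; exists (Q * C); first exact: mulr_ge0.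
move=> t tT; rewrite (le_trans (alpha1_le tT))// -mulrA ler_wpM2l//.
by apply: le_trans (HC t tT); rewrite ler_norm.
Qed.

Let alpha2_bounded : bounded alpha2.
Proof.
exists Q => // t /andP[t0 tT]; rewrite mulr1 alpha2_bound// in_itv/= !ltW//.
Qed.

(** [E t] is t^(-alpha(t)), [m] its logarithmic derivative and [m1] the derivative of [m]. In [m1]
    the two quotients are bounded by the decay of alpha' and alpha, and only [alpha2 t * ln t] is
    singular. *)
Let m t := - (alpha1 t * ln t) - alpha t / t.
Let m1 t := - (alpha2 t * ln t) - 2 * (alpha1 t / t) + alpha t / t ^+ 2.
Let E t := expR (- (alpha t * ln t)).

Let m_tau : tau_bounded m.
Proof.
have [L L0 LP] := ln_bound; have [C C0 HC] := id_tau.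
apply: bounded_byD; apply: bounded_byN.
  exists (Q * L); first exact: mulr_ge0.
  move=> t /[dup] tT /andP[t0 _]; rewrite normrM.
  apply: (le_trans (ler_pM (normr_ge0 _) (normr_ge0 _) (alpha1_le tT) (LP t tT))).
  by rewrite -tauE// le_eqVlt; apply/orP; left; apply/eqP; ring.
exists (Q * C); first exact: mulr_ge0.
move=> t /[dup] tT /andP[t0 _]; rewrite normrM normfV (gtr0_norm t0).
rewrite ler_pdivrMr//; apply: (le_trans (alpha_le tT)).
rewrite expr2 -!mulrA ler_wpM2l// mulrA ler_wpM2r ?(ltW t0)//.
by apply: le_trans (HC t tT); rewrite ler_norm.
Qed.

Let m1_rho : rho_bounded m1.
Proof.
have [L L0 LP] := ln_bound.
apply: bounded_byD; [apply: bounded_byD|].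
- apply: bounded_byN; apply: bounded_byM => //; exists L => //.
- apply: bounded_byN; apply: bounded_rho; exists (2 * Q); first exact: mulr_ge0.
  move=> t /[dup] tT /andP[t0 _]; rewrite mulr1 normrM ger0_norm// ler_wpM2l//.
  by rewrite normrM normfV (gtr0_norm t0) ler_pdivrMr// alpha1_le.
- apply: bounded_rho; exists Q => // t /[dup] tT /andP[t0 _].
  rewrite mulr1 normrM normfV [`|t ^+ 2|]ger0_norm ?exprn_ge0 ?(ltW t0)//.
  by rewrite ler_pdivrMr ?exprn_gt0// alpha_le.
Qed.

Let E_bounded : bounded E.
Proof.
have [L L0 LP] := ln_bound.
exists (expR (Q * T * (L * tau T))); first exact: expR_ge0.
move=> t /[dup] tT /andP[t0 tT1]; rewrite mulr1 ger0_norm ?expR_ge0// ler_expR.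
rewrite (le_trans (ler_norm _))// normrN normrM.
apply: (le_trans (ler_pM (normr_ge0 _) (normr_ge0 _) (alpha_le tT) (LP t tT))).
rewrite [leLHS](_ : _ = Q * t * (L * (t * rho t))); last by ring.
rewrite tauE//; apply: ler_pM.
- by rewrite mulr_ge0// ltW.
- by rewrite mulr_ge0// expR_ge0.
- by rewrite ler_wpM2l// ltW.
- by rewrite ler_wpM2l// tau_le.
Qed.

(** With [g0] the reciprocal of Gamma (1 - a), the kernel is [k], the derivative of
    [E t * g0 (alpha t)], and [k1] is the derivative of [k]. As [k] is O(tau), it tends to 0 at 0
    and no constant appears beside its primitive; [k1] is O(rho), which is both integrable and
    square integrable. *)
Lemma memory_kernel_primitive : exists q : R -> R,
  [/\ measurable_fun `[0, T] q, L1 T q, L1 T (fun t => q t ^+ 2) &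
      forall t, t \in `]0, T[ -> memory_kernel alpha T t = prim q t].
Proof.
have [g1 [g2 [M [dg0 dg1 gM]]]] := reciprocal_gamma alphastar_lt1.
pose g0 a : R := (Gamma (1 - a))^-1.
have M0 : 0 <= M.
  have T00 : 0 \in `[0, T] by rewrite in_itv/= lexx ltW.
  have [+ _ _] := gM _ (alpha_bound T00); exact: le_trans.
have aI t : 0 < t < T -> 0 <= alpha t <= alphastar.
  by move=> /andP[t0 tT]; apply: alpha_bound; rewrite in_itv/= !ltW.
have bg0 : bounded (fun t => g0 (alpha t)).
  by exists M => // t tT; rewrite mulr1; have [] := gM _ (aI t tT).
have bg1 : bounded (fun t => g1 (alpha t)).
  by exists M => // t tT; rewrite mulr1; have [] := gM _ (aI t tT).
have bg2 : bounded (fun t => g2 (alpha t)).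
  by exists M => // t tT; rewrite mulr1; have [] := gM _ (aI t tT).
pose k t := E t * (m t * g0 (alpha t) + g1 (alpha t) * alpha1 t).
pose k1 t := E t * (m t * (m t * g0 (alpha t) + g1 (alpha t) * alpha1 t) +
  (m1 t * g0 (alpha t) + m t * (g1 (alpha t) * alpha1 t) +
   (g2 (alpha t) * alpha1 t * alpha1 t + g1 (alpha t) * alpha2 t))).
have ba1 := tau_bounded_bounded alpha1_tau.
have bm := tau_bounded_bounded m_tau.
have bB : tau_bounded (fun t => m t * g0 (alpha t) + g1 (alpha t) * alpha1 t).
  apply: bounded_byD; last exact: bounded_byM.
  by apply: eq_bounded_by (bounded_byM bg0 m_tau) => t _; rewrite mulrC.
have k_tau : tau_bounded k by exact: bounded_byM.
have k1_rho : rho_bounded k1.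
  apply: bounded_byM => //; apply: bounded_byD.
    by apply/bounded_rho/bounded_byM => //; exact: tau_bounded_bounded.
  apply: bounded_byD; last first.
    apply: bounded_rho; apply: bounded_byD; last exact: bounded_byM.
    by apply: bounded_byM => //; exact: bounded_byM.
  apply: bounded_byD.
    by apply: eq_bounded_by (bounded_byM bg0 m1_rho) => t _; rewrite mulrC.
  by apply: bounded_rho; do 2 apply: bounded_byM => //.
have Tt t : t \in `]0, T[ -> 0 < t < T by rewrite in_itv.
have dA t (tT : t \in `]0, T[) := derivable_on_interior alpha_derivable tT.
have dA1 t (tT : t \in `]0, T[) := derivable_on_interior alpha_derivable2 tT.
have dln t : t \in `]0, T[ -> is_derive t 1 (@ln R) t^-1.
  by rewrite in_itv/= => /andP[t0 _]; exact: is_derive1_ln.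
have al1 t : t \in `]0, T[ -> alpha t < 1.
  by move=> /Tt /aI /andP[_ aa]; exact: le_lt_trans alphastar_lt1.
have dE t : t \in `]0, T[ -> is_derive t 1 E (m t * E t).
  move=> tT; have d1 := dA t tT; have d2 := dln t tT; have /andP[t0 _] := Tt t tT.
  by apply: is_derive_eq; rewrite /GRing.scale/= /m /E -/alpha1; ring.
have dG0 t : t \in `]0, T[ -> is_derive t 1 (fun s => g0 (alpha s)) (g1 (alpha t) * alpha1 t).
  move=> tT; have d1 := dA t tT; have d2 := dg0 _ (al1 t tT).
  exact: (is_derive1_comp (f := g0) (g := alpha)).
have dG1 t : t \in `]0, T[ -> is_derive t 1 (fun s => g1 (alpha s)) (g2 (alpha t) * alpha1 t).
  move=> tT; have d1 := dA t tT; have d2 := dg1 _ (al1 t tT).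
  exact: (is_derive1_comp (f := g1) (g := alpha)).
have dm t : t \in `]0, T[ -> is_derive t 1 m (m1 t).
  move=> tT; have d1 := dA t tT; have d2 := dA1 t tT; have d3 := dln t tT.
  have /andP[t0 _] := Tt t tT; have t1 : t != 0 by rewrite gt_eqF.
  have d4 : is_derive t 1 (fun s : R => s^-1) (- t ^- 2 *: 1).
    exact: (is_deriveV (f := id) t1 (is_derive_id t 1)).
  by apply: is_derive_eq; rewrite /GRing.scale/= /m1 -/alpha1 -/alpha2; field.
have dk t : t \in `]0, T[ -> is_derive t 1 k (k1 t).
  move=> tT; have d1 := dE t tT; have d2 := dG0 t tT; have d3 := dG1 t tT.
  have d4 := dm t tT; have d5 := dA1 t tT.
  by apply: is_derive_eq; rewrite /GRing.scale/= /k1 -/alpha1 -/alpha2; ring.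
have kE t : t \in `]0, T[ -> memory_kernel alpha T t = k t.
  move=> tT; have /andP[t0 tT1] := Tt t tT; rewrite /memory_kernel t0.
  apply: deriv_on_is_derive.
    by apply: filterS (near_in_itvoo tT) => s; rewrite /= !in_itv/= => /andP[-> /ltW].
  apply: (near_eq_is_derive (f := fun s => E s * g0 (alpha s))).
    apply: filterS (near_in_itvoo tT) => s; rewrite /= in_itv/= => /andP[s0 _].
    by rewrite powR_expR// mulNr.
  have d1 := dE t tT; have d2 := dG0 t tT.
  by apply: is_derive_eq; rewrite /GRing.scale/= /k; ring.
(* The value 0 at 0 is the limit of [k], so [K] is continuous there. At [T] it may jump, whence the
   shorter intervals [[0, T']] below. *)
pose K t := if 0 < t < T then k t else 0.
pose q t := if 0 < t < T then k1 t else 0.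
have [Ct Ct0 CtP] := k_tau; have [Cr Cr0 CrP] := k1_rho.
have dK t : t \in `]0, T[ -> is_derive t 1 K (q t).
  move=> tT; rewrite /q (Tt t tT); have d := dk t tT.
  apply: (near_eq_is_derive (f := k)) => //.
  by apply: filterS (near_in_itvoo tT) => s /=; rewrite /K in_itv/= => ->.
have cKt t : t \in `]0, T[ -> {for t, continuous K}.
  move=> tT; have d := dK t tT.
  by apply/differentiable_continuous/derivable1_diffP; exact: ex_derive.
have cK T' : T' < T -> {within `[0, T'], continuous K}.
  move=> T'T; apply/subspace_continuousP => t /=; rewrite in_itv/= => /andP[t0 tT'].
  have [t00|t00] := eqVneq t 0; last first.
    have tT : t \in `]0, T[ by rewrite in_itv/= lt_neqAle eq_sym t00 t0/= (le_lt_trans tT').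
    by apply: cvg_within_filter; exact: cKt tT.
  have K0 : K 0 = 0 by rewrite /K ltxx.
  rewrite t00; apply/cvgrPdist_lt => e e0.
  have C1 : 0 < e / (Ct + 1) by rewrite divr_gt0// ltr_wpDl.
  (* This radius solves [tau s = e / (Ct + 1)], as [tau] is the power 3/4; the added 1 covers
     [Ct = 0]. *)
  apply/within_nbhsP; exists (expR (4 / 3 * ln (e / (Ct + 1)))); first exact: expR_gt0.
  move=> s; rewrite subr0 => sd _; change (`|K 0 - K s| < e).
  rewrite K0 sub0r normrN /K; case: ifPn => [sT|_]; last by rewrite normr0.
  have /andP[s0 _] := sT; apply: (le_lt_trans (CtP s sT)).
  rewrite gtr0_norm// in sd.
  have : tau s < e / (Ct + 1).
    rewrite -[X in _ < X]lnK ?posrE// /tau ltr_expR -ltr_pdivlMl; last by lra.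
    rewrite invf_div -ltr_expR lnK ?posrE//.
  rewrite ltr_pdivlMr ?ltr_wpDl// => H; apply: le_lt_trans H.
  by rewrite mulrC ler_wpM2l ?expR_ge0// lerDl.
have mI : measurable (`]0%R, T[%classic : set R) by [].
have mk : measurable_fun (`]0%R, T[%classic : set R) K.
  apply: open_continuous_measurable_fun; first exact: interval_open.
  by move=> t; rewrite inE; exact: cKt.
have KE : K = K \_ `]0, T[.
  by apply/funext => t; rewrite patchE mem_setE in_itv/= /K; case: ifP.
have qE : q = q \_ `]0, T[.
  by apply/funext => t; rewrite patchE mem_setE in_itv/= /q; case: ifP.
have mK : measurable_fun setT K.
  by rewrite KE; apply/(measurable_restrict _ _ _).1 => //; rewrite setTI.
have mq : measurable_fun setT q.
  rewrite qE; apply/(measurable_restrict _ _ _).1 => //; rewrite setTI.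
  by apply: (measurable_derivative (K := K)) => //; exact: measurable_funTS.
have q0 t : ~~ (0 < t < T) -> q t = 0 by rewrite /q => /negbTE ->.
have q_rho t : 0 < t < T -> `|q t| <= Cr * rho t by move=> tT; rewrite /q tT; exact: CrP.
exists q; split.
- exact: measurable_funTS.
- apply: (@L1_power_bound _ T (3 / 4) Cr) => //; exact: measurable_funTS.
- apply: (@L1_power_bound _ T (1 / 2) (Cr ^+ 2)) => //.
  + by apply: measurable_funX; exact: measurable_funTS.
  (* The square of [rho] is t^(-1/2), still integrable at 0. *)
  + move=> t tT; have -> : expR ((1 / 2 - 1) * ln t) = rho t ^+ 2.
      by rewrite /rho expr2 -expRD; congr expR; field.
    by rewrite normrX -exprMn lerXn2r ?nnegrE ?mulr_ge0 ?expR_ge0 ?q_rho.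
  + by move=> t /q0 ->; rewrite expr0n.
move=> t tT; rewrite (kE _ tT); have /andP[t0 tT1] := Tt t tT.
pose T' := (t + T) / 2.
have tT' : t < T' by rewrite /T'; lra.
have T'T : T' < T by rewrite /T'; lra.
have T'0 : 0 < T' by exact: lt_trans tT'.
have subT x : 0 < x < T' -> 0 < x < T by move=> /andP[-> xT]; exact: lt_trans T'T.
pose g x := if 0 < x < T' then Cr * rho x else 0.
have gL1 : L1 T' g.
  apply: (@L1_power_bound _ T' (3 / 4) Cr) => //.
  - have -> : g = (fun x => Cr * rho x) \_ `]0, T'[.
      by apply/funext => x; rewrite patchE mem_setE in_itv/= /g; case: ifP.
    apply: measurable_funTS; apply/(measurable_restrict _ _ _).1 => //; rewrite setTI.
    by apply: measurable_funM => //; exact: measurable_expR_ln.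
  - by move=> x xT; rewrite /g xT ger0_norm// mulr_ge0// expR_ge0.
  - by move=> x /negbTE xT; rewrite /g xT.
have H1 : 0 <= t < T' by rewrite (ltW t0).
have H2 : measurable_fun `[0, T'] q by exact: measurable_funTS.
have H3 x : x \in `]0, T'[ -> is_derive x 1 K (q x).
  by rewrite in_itv/= => /subT xT; apply: dK; rewrite in_itv.
have H4 x : x \in `]0, T'[ -> `|q x| <= g x.
  by rewrite in_itv/= => xT'; rewrite /g xT'; apply/q_rho/subT.
have H5 (x y : R) : 0 < x -> x <= y -> y < T' -> g y <= g x.
  move=> x0 xy yT'; rewrite /g x0 (le_lt_trans xy yT') (lt_le_trans x0 xy) yT'/=.
  rewrite ler_wpM2l// /rho ler_expR ler_wnM2l//; first by lra.
  by rewrite ler_ln ?posrE// (lt_le_trans x0).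
by rewrite (dominated_FTC H1 (cK T' T'T) gL1 H2 H3 H4 H5) /K ltxx/= subr0 t0 tT1.
Qed.

End memory_kernel.

(** * Regularity of the coefficients *)

Section coefficient_regularity.
Context {R : realType} {T : R}.
Hypothesis T0 : 0 < T.
Variable q : R -> R.
Hypotheses (mq : measurable_fun (`[0, T]%classic : set (measurableTypeR R)) q)
  (iq : L1 T q) (iq2 : L1 T (fun t => q t ^+ 2)).
Notation L1 := (L1 T).
Notation lm := (@lebesgue_measure R).
Notation msr := (measurable_fun (`[0, T]%classic : set (measurableTypeR R))).
Implicit Types (l a b s t M : R) (F y h : R -> R).

Section one_coefficient.
Variables (l a b : R) (F y y1 : R -> R).
Hypotheses (iF : L1 F) (sy : wsolution T q l a b F y y1).

(* The second and third functions are the first two derivatives of the first: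
   q * y = prim (a q + q * y1) because y = a + prim y1. *)
Definition kernel_conv t := time_convolution (prim q) y t.
Definition kernel_conv1 t := time_convolution q y t.
Definition kernel_conv2 t := a * q t + time_convolution q y1 t.
Definition deriv2 t := F t - l ^+ 2 * (y t + kernel_conv t).

Let cy := wsolution_continuous T0 sy.
Let iy : L1 y := L1_continuous cy.
Let iy1 : L1 y1. Proof. by case: sy => /L1_continuous. Qed.
Let yE (t : R) : t \in `[0, T] -> y t = a + prim y1 t. Proof. by case: sy => _ /(_ t). Qed.

Lemma kernel_conv_prim t : 0 <= t <= T -> kernel_conv t = prim kernel_conv1 t.
Proof. by move=> tT; rewrite /kernel_conv (conv_prim iq iy tT). Qed.

Lemma L1_kernel_conv1 : L1 kernel_conv1.
Proof. exact: L1_time_convolution. Qed.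

Lemma L1_kernel_conv2 : L1 kernel_conv2.
Proof. by apply: L1D; [exact: L1Z|exact: L1_time_convolution]. Qed.

Lemma kernel_conv1_prim t : 0 <= t <= T -> kernel_conv1 t = prim kernel_conv2 t.
Proof.
move=> tT; have /andP[t0 tT'] := tT.
have icy1 : L1 (time_convolution q y1) by exact: L1_time_convolution.
have ip : {within `[0, T], continuous (prim y1)} := prim_continuous (ltW T0) iy1.
have [M MP] := continuous_bounded T0 ip.
have mp := continuous_measurable ip.
rewrite /kernel_conv1 (@eq_time_convolution _ q y (fun s => a * cst 1 s + prim y1 s)).
  rewrite (@time_convolution_lin _ T q (cst 1) _ a (Num.max M 1))//; last 2 first.
  - by move=> s _; rewrite /= normr1 le_max lexx orbT.
  - by move=> s /MP Ms; rewrite le_max Ms.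
  (* [conv_prim] takes the primitive as its first argument, so both convolutions are commuted; the
     one with the constant 1 is then [prim q]. *)
  rewrite (time_convolutionC tT' mq (b := cst 1))// (time_convolutionC tT' mq mp).
  rewrite (conv_prim iy1 iq tT).
  rewrite (primD (L1Z a iq) icy1 tT') (primZ a iq tT'); congr (_ * _ + _).
    by apply: eq_prim => s sT; rewrite /= mul1r.
  apply: eq_prim => s /andP[_ st].
  apply: (time_convolutionC (le_trans st tT') _ mq).
  exact: L1_measurable.
move=> s /andP[s0 st]; rewrite /= mulr1 yE// in_itv/= s0.
exact: le_trans st tT'.
Qed.

Lemma L1_kernel_conv : L1 kernel_conv.
Proof. by apply: L1_time_convolution => //; exact: L1_prim (ltW T0) iq. Qed.

Lemma L1_deriv2 : L1 deriv2.
Proof. by apply: L1B => //; apply: L1Z; apply: L1D => //; exact: L1_kernel_conv. Qed.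

Lemma deriv1_prim (t : R) : t \in `[0, T] -> y1 t = b + prim deriv2 t.
Proof. by case: sy => _ _; apply. Qed.

Lemma weak_derivative_deriv1 : weak_derivative1 T y y1.
Proof. exact (weak_derivative1_prim T0 iy1 yE). Qed.

Lemma weak_derivative_deriv2 : weak_derivative1 T y1 deriv2.
Proof. exact (weak_derivative1_prim T0 L1_deriv2 deriv1_prim). Qed.

(* F1 and F2 are the first two weak derivatives of F. *)
Definition deriv3 F1 t := F1 t - l ^+ 2 * (y1 t + kernel_conv1 t).
Definition deriv4 F2 t := F2 t - l ^+ 2 * (deriv2 t + kernel_conv2 t).

Lemma weak_derivative_deriv3 F1 : L1 F1 -> weak_derivative1 T F F1 ->
  weak_derivative1 T deriv2 (deriv3 F1).
Proof.
move=> iF1 wF.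
have i1 : L1 (fun t => y t + kernel_conv t) := L1D iy L1_kernel_conv.
have i2 : L1 (fun t => y1 t + kernel_conv1 t) := L1D iy1 L1_kernel_conv1.
have w : weak_derivative1 T (fun t => y t + kernel_conv t) (fun t => y1 t + kernel_conv1 t).
  apply: (weak_derivative1_prim T0 (a := a) i2) => t tT.
  have tT' : 0 <= t <= T by rewrite in_itv/= in tT.
  have /andP[_ t1] := tT'.
  by rewrite (primD iy1 L1_kernel_conv1 t1) addrA -yE// kernel_conv_prim.
have := weak_derivative1_lin T0 (- l ^+ 2) i1 i2 iF iF1 w wF.
by apply: eq_weak_derivative1 => t _; rewrite mulNr addrC.
Qed.

Lemma weak_derivative_deriv4 F1 F2 : L1 F1 -> L1 F2 -> weak_derivative1 T F1 F2 ->
  weak_derivative1 T (deriv3 F1) (deriv4 F2).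
Proof.
move=> iF1 iF2 wF.
have i1 : L1 (fun t => y1 t + kernel_conv1 t) := L1D iy1 L1_kernel_conv1.
have i2 : L1 (fun t => deriv2 t + kernel_conv2 t) := L1D L1_deriv2 L1_kernel_conv2.
have w : weak_derivative1 T (fun t => y1 t + kernel_conv1 t) (fun t => deriv2 t + kernel_conv2 t).
  apply: (weak_derivative1_prim T0 (a := b) i2) => t tT.
  have tT' : 0 <= t <= T by rewrite in_itv/= in tT.
  have /andP[_ t1] := tT'.
  by rewrite (primD L1_deriv2 L1_kernel_conv2 t1) addrA -deriv1_prim// kernel_conv1_prim.
have := weak_derivative1_lin T0 (- l ^+ 2) i1 i2 iF1 iF2 w wF.
by apply: eq_weak_derivative1 => t _; rewrite mulNr addrC.
Qed.

Variables (l0 N : R).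
Hypotheses (l00 : 0 < l0) (l0l : l0 <= l) (mF : msr F) (N0 : 0 <= N)
  (FN : sq T F = (N ^+ 2)%:E).
(** [B] is the size of the data of this coefficient. [K] is the constant of [wsolution_bound] times
    the [1 + T] that bounds the L^1 norm of [F] by its L^2 norm [N]. *)
Let B := l * `|a| + `|b| + N.
Let K := 4 * expR (growth_rate T q * T) * (1 + T).
Let Q1 := prim (fun s => `|q s|) T.
Let l_gt0 : 0 < l := lt_le_trans l00 l0l.
Let B0 : 0 <= B. Proof. by rewrite !addr_ge0// mulr_ge0// ltW. Qed.
Let K0 : 0 <= K. Proof. by rewrite !mulr_ge0 ?expR_ge0// addr_ge0// ltW. Qed.
Let Q10 : 0 <= Q1. Proof. by apply: prim_ge0. Qed.

Lemma coefficient_bound t : t \in `[0, T] -> l * `|y t| <= K * B /\ `|y1 t| <= K * B.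
Proof.
move=> tT; have [_ FB] := sq_norm_bound T0 mF N0 FN.
have := wsolution_bound T0 iq l_gt0 iF sy tT.
set C := _ * (_ + _ + _) => -[h1 h2].
have CK : C <= K * B.
  rewrite /C /K -[leRHS]mulrA ler_wpM2l ?mulr_ge0 ?expR_ge0// /B.
  have T1 : 0 <= T * (l * `|a| + `|b|) by rewrite mulr_ge0 ?addr_ge0 ?mulr_ge0// ltW.
  by rewrite mulrDr mulrDl mul1r; lra.
by split; [exact: le_trans h1 CK|exact: le_trans h2 CK].
Qed.

Let q_conv_bound h M t : (0 <= t <= T) -> msr h -> (forall s : R, s \in `[0, T] -> `|h s| <= M) ->
  `|time_convolution q h t| <= M * Q1.
Proof.
move=> tT mh hM.
have := @time_convolution_bound _ T q h M 0 t (lexx 0) tT iq mh.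
by rewrite mul0r expR0 mulr1; apply => s sT; rewrite mul0r expR0 mulr1; exact: hM.
Qed.

Lemma kernel_conv1_bound t : 0 <= t <= T -> l * `|kernel_conv1 t| <= K * B * Q1.
Proof.
move=> tT; rewrite mulrC -ler_pdivlMr// mulrAC; apply: q_conv_bound => //.
  exact: continuous_measurable.
by move=> s sT; rewrite ler_pdivlMr// mulrC; have [] := coefficient_bound sT.
Qed.

Lemma kernel_conv_bound t : 0 <= t <= T -> l * `|kernel_conv t| <= K * B * Q1 * T.
Proof.
move=> tT; have /andP[t0 tT'] := tT.
rewrite kernel_conv_prim// mulrC -ler_pdivlMr//.
have ic : L1 (cst (K * B * Q1 / l)) by exact: L1_cst.
apply: le_trans (normr_prim_le L1_kernel_conv1 ic tT _) _.
  move=> s /andP[s0 st] /=; rewrite ler_pdivlMr// mulrC kernel_conv1_bound// s0.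
  exact: le_trans st tT'.
rewrite prim_cst// [leRHS]mulrAC ler_wpM2l//.
exact: divr_ge0 (mulr_ge0 (mulr_ge0 K0 B0) Q10) (ltW l_gt0).
Qed.

Lemma sq_coefficient : ((l ^+ 2)%:E * sq T y <= (T * K ^+ 2 * B ^+ 2)%:E)%E.
Proof.
have my := continuous_measurable cy.
rewrite -sqZ// -mulrA -exprMn; apply: sq_bounded => // [|t tT].
  exact: measurable_funM.
by rewrite normrM (gtr0_norm l_gt0); have [] := coefficient_bound tT.
Qed.

Lemma sq_deriv1 : (sq T y1 <= (T * K ^+ 2 * B ^+ 2)%:E)%E.
Proof.
rewrite -mulrA -exprMn; apply: sq_bounded => //; first exact: L1_measurable.
by move=> t tT; have [] := coefficient_bound tT.
Qed.

(** Since [1 <= l * m], a term with too few factors [l] receives the missing ones at the price of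
    powers of [m]. Each bound below is thereby reduced to a single power of [l]. *)
Let m := l0^-1.
Let m_ge0 : 0 <= m. Proof. by rewrite invr_ge0 ltW. Qed.
Let ml : 1 <= l * m. Proof. by rewrite ler_pdivlMr// mul1r. Qed.
Let NB : N <= B.
Proof. by rewrite /B lerDr addr_ge0// mulr_ge0// ltW. Qed.
Let lmB : B <= l * m * B. Proof. by rewrite -{1}[B]mul1r ler_wpM2r. Qed.

Lemma sq_deriv2 : (sq T deriv2 <=
  ((2 * m ^+ 2 + 2 * T * (K * (1 + Q1 * T)) ^+ 2) * l ^+ 2 * B ^+ 2)%:E)%E.
Proof.
have my := continuous_measurable cy; have mk := L1_measurable L1_kernel_conv.
have mr : msr (fun t => - l ^+ 2 * (y t + kernel_conv t)).
  by apply: measurable_funM => //; exact: measurable_funD.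
have -> : deriv2 = (fun t => F t + - l ^+ 2 * (y t + kernel_conv t)).
  by apply/funext => t; rewrite /deriv2 mulNr.
apply: le_trans (sqD mF mr) _; rewrite FN.
have H : (sq T (fun t => (- l ^+ 2 * (y t + kernel_conv t))%R) <=
    (T * (l * (K * B * (1 + Q1 * T))) ^+ 2)%:E)%E.
  apply: sq_bounded => // t tT; have [h1 _] := coefficient_bound tT.
  have tT' : 0 <= t <= T by rewrite in_itv/= in tT.
  have h2 := kernel_conv_bound tT'.
  rewrite normrM normrN normrX (gtr0_norm l_gt0) expr2 -(mulrA l l) ler_wpM2l ?(ltW l_gt0)//.
  apply: le_trans (ler_wpM2l (ltW l_gt0) (ler_normD _ _)) _.
  by rewrite mulrDr mulrDr mulr1 mulrA lerD.
apply: le_trans (leeD2l _ (lee_wpmul2l _ H)) _; first by rewrite lee_fin.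
rewrite -!EFinM -EFinD lee_fin.
have : N ^+ 2 <= (l * m * B) ^+ 2.
  by rewrite lerXn2r ?nnegrE// ?(le_trans NB lmB)// (le_trans B0 lmB).
rewrite !exprMn; move: (Q1) (K) (B) (l) (m) (T) (N) => *; lra.
Qed.

Lemma sq_deriv3 F1 : msr F1 -> (sq T (deriv3 F1) <=
  2%:E * sq T F1 + (2 * T * (K * (1 + Q1 * m)) ^+ 2 * l ^+ 4 * B ^+ 2)%:E)%E.
Proof.
move=> mF1; have my1 := L1_measurable iy1; have mk := L1_measurable L1_kernel_conv1.
have mr : msr (fun t => - l ^+ 2 * (y1 t + kernel_conv1 t)).
  by apply: measurable_funM => //; exact: measurable_funD.
have -> : deriv3 F1 = (fun t => F1 t + - l ^+ 2 * (y1 t + kernel_conv1 t)).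
  by apply/funext => t; rewrite /deriv3 mulNr.
apply: le_trans (sqD mF1 mr) _; apply: leeD2l.
have H : (sq T (fun t => (- l ^+ 2 * (y1 t + kernel_conv1 t))%R) <=
    (T * (l ^+ 2 * (K * B * (1 + Q1 * m))) ^+ 2)%:E)%E.
  apply: sq_bounded => // t tT; have [_ h1] := coefficient_bound tT.
  have tT' : 0 <= t <= T by rewrite in_itv/= in tT.
  have h2 := kernel_conv1_bound tT'.
  rewrite normrM normrN normrX (gtr0_norm l_gt0) ler_wpM2l ?exprn_ge0 ?(ltW l_gt0)//.
  apply: le_trans (ler_normD _ _) _; rewrite mulrDr mulr1 mulrA lerD//.
  rewrite ler_pdivlMr// mulrC; apply: le_trans h2.
  by rewrite ler_wpM2r.
apply: le_trans (lee_wpmul2l _ H) _; first by rewrite lee_fin.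
rewrite -!EFinM lee_fin !exprMn.
move: (Q1) (K) (B) (l) (m) (T) => *; lra.
Qed.

Let S := fine (sq T q).

(** The term [a * q] calls for the square integrability of [q]: [S] is its squared norm. The initial
    value is bounded by [|a| <= m * B]. *)
Lemma sq_kernel_conv2 : (sq T kernel_conv2 <=
  ((2 * m ^+ 2 * S + 2 * T * (K * Q1) ^+ 2) * B ^+ 2)%:E)%E.
Proof.
have mc := L1_measurable (L1_time_convolution iq iy1).
have maq : msr (fun t => a * q t) by exact: measurable_funM.
apply: le_trans (sqD maq mc) _; rewrite sqZ//.
have Sf : sq T q \is a fin_num by exact: integrable_fin_num.
have H : (sq T (time_convolution q y1) <= (T * (K * B * Q1) ^+ 2)%:E)%E.
  apply: sq_bounded => // t tT; apply: q_conv_bound.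
  - by rewrite in_itv/= in tT.
  - exact: L1_measurable.
  - by move=> s sT; have [] := coefficient_bound sT.
apply: le_trans (leeD2l _ (lee_wpmul2l _ H)) _; first by rewrite lee_fin.
rewrite -(fineK Sf) -/S -!EFinM -EFinD lee_fin.
have aB : `|a| <= m * B.
  rewrite mulrC ler_pdivlMr// mulrC; apply: le_trans (_ : l * `|a| <= _).
    by rewrite ler_wpM2r.
  by rewrite /B -addrA lerDl addr_ge0.
have S0 : 0 <= S by rewrite fine_ge0// sq_ge0.
have : a ^+ 2 * S <= (m * B) ^+ 2 * S.
  by rewrite ler_wpM2r// -real_normK ?num_real// lerXn2r ?nnegrE// mulr_ge0.
rewrite !exprMn; move: (S) (Q1) (K) (B) (l) (m) (T) (a) => *; lra.
Qed.

(** The bound of [deriv2] has the factor [l ^+ 2], that of [kernel_conv2] none; [lmB] supplies it,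
    and the outer [l ^+ 4] completes [l ^+ 6]. *)
Lemma sq_deriv4 F2 : msr F2 -> (sq T (deriv4 F2) <= 2%:E * sq T F2 +
  (4 * (2 * m ^+ 2 + 2 * T * (K * (1 + Q1 * T)) ^+ 2 +
        (2 * m ^+ 2 * S + 2 * T * (K * Q1) ^+ 2) * m ^+ 2) * l ^+ 6 * B ^+ 2)%:E)%E.
Proof.
move=> mF2; have m2 := L1_measurable L1_deriv2; have mk := L1_measurable L1_kernel_conv2.
have mdk : msr (fun t => deriv2 t + kernel_conv2 t) by exact: measurable_funD.
have mr : msr (fun t => - l ^+ 2 * (deriv2 t + kernel_conv2 t)) by exact: measurable_funM.
have -> : deriv4 F2 = (fun t => F2 t + - l ^+ 2 * (deriv2 t + kernel_conv2 t)).
  by apply/funext => t; rewrite /deriv4 mulNr.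
apply: le_trans (sqD mF2 mr) _; apply: leeD2l.
rewrite sqZ//.
have two : (0 <= 2%:E :> \bar R)%E by rewrite lee_fin.
have H : (sq T (fun t => (deriv2 t + kernel_conv2 t)%R) <= _)%E :=
  le_trans (sqD m2 mk) (leeD (lee_wpmul2l two sq_deriv2) (lee_wpmul2l two sq_kernel_conv2)).
have l40 : (0 <= ((- l ^+ 2) ^+ 2)%:E)%E by rewrite lee_fin sqr_ge0.
apply: le_trans (lee_wpmul2l two (lee_wpmul2l l40 H)) _.
have -> (u v x z : R) : (u%:E * (v%:E * (2%:E * x%:E + 2%:E * z%:E)) =
    (u * (v * (2 * x + 2 * z)))%:E)%E by [].
rewrite lee_fin sqrrN -exprM.
have BlmB : B ^+ 2 <= (l * m * B) ^+ 2.
  by rewrite lerXn2r ?nnegrE// (le_trans B0 lmB).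
set c := 2 * m ^+ 2 * S + _; set c' := 2 * m ^+ 2 + _.
have c0 : 0 <= c.
  have S0 : 0 <= S by rewrite fine_ge0// sq_ge0.
  have h1 : 0 <= 2 * m ^+ 2 * S by rewrite !mulr_ge0// sqr_ge0.
  have h2 : 0 <= 2 * T * (K * Q1) ^+ 2 by exact: mulr_ge0 (mulr_ge0 (ler0n _ 2) (ltW T0)) (sqr_ge0 _).
  exact: addr_ge0.
have l4 : 0 <= l ^+ 4 by rewrite exprn_ge0// ltW.
have := ler_wpM2l (mulr_ge0 l4 c0) BlmB.
rewrite !exprMn; move: (c) (c') (B) (l) (m) => x x' v w z; lra.
Qed.

End one_coefficient.

(** A single [C] serves all coefficients and all data. From the second on, each time derivative
    costs one more factor [l]. The bound on [y t] at each time is there for Riesz-Fischer at a fixed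
    time, the others for summation. *)
Definition coefficient_estimate (l0 C : R) : Prop :=
  forall l a b F y y1 (N : R), l0 <= l -> msr F -> 0 <= N -> sq T F = (N ^+ 2)%:E ->
  wsolution T q l a b F y y1 -> let B := l * `|a| + `|b| + N in
  [/\ forall t, t \in `[0, T] -> y t ^+ 2 <= C * B ^+ 2,
      ((l ^+ 2)%:E * sq T y <= (C * B ^+ 2)%:E)%E /\ (sq T y1 <= (C * B ^+ 2)%:E)%E,
      (sq T (deriv2 l F y) <= (C * l ^+ 2 * B ^+ 2)%:E)%E,
      forall F1, msr F1 ->
        (sq T (deriv3 l y y1 F1) <= 2%:E * sq T F1 + (C * l ^+ 4 * B ^+ 2)%:E)%E &
      forall F2, msr F2 ->
        (sq T (deriv4 l a F y y1 F2) <= 2%:E * sq T F2 + (C * l ^+ 6 * B ^+ 2)%:E)%E].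

Lemma coefficient_estimates l0 : 0 < l0 ->
  exists2 C : R, 0 <= C & coefficient_estimate l0 C.
Proof.
move=> l00.
set K := 4 * expR (growth_rate T q * T) * (1 + T).
set Q1 := prim (fun s => `|q s|) T; set m := l0^-1; set S := fine (sq T q).
set A0 := (K * m) ^+ 2; set A1 := T * K ^+ 2.
set A2 := 2 * m ^+ 2 + 2 * T * (K * (1 + Q1 * T)) ^+ 2.
set A3 := 2 * T * (K * (1 + Q1 * m)) ^+ 2.
set A4 := 4 * (A2 + (2 * m ^+ 2 * S + 2 * T * (K * Q1) ^+ 2) * m ^+ 2).
(* The absolute values let the sum dominate each constant without a discussion of signs. *)
exists (`|A0| + `|A1| + `|A2| + `|A3| + `|A4|); first by rewrite !addr_ge0.
set C := _ + `|A4| => l a b F y y1 N l0l mF N0 FN sy B.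
have [C0 C1 C2 C3 C4] : [/\ A0 <= C, A1 <= C, A2 <= C, A3 <= C & A4 <= C].
  have h (x : R) : x <= `|x| by exact: ler_norm.
  have n (x : R) : 0 <= `|x| by [].
  by split; apply: le_trans (h _) _; rewrite /C;
    have := n A0; have := n A1; have := n A2; have := n A3; have := n A4;
    move: (`|A0|) (`|A1|) (`|A2|) (`|A3|) (`|A4|) => *; lra.
have l_gt0 : 0 < l by exact: lt_le_trans l0l.
have iF : L1 F by have [] := sq_norm_bound T0 mF N0 FN.
have B2 : 0 <= B ^+ 2 by exact: sqr_ge0.
have X p : 0 <= l ^+ p * B ^+ 2 by rewrite mulr_ge0// exprn_ge0// ltW.
split.
- move=> t tT; apply: le_trans (ler_wpM2r B2 C0).
  have [h _] := coefficient_bound iF sy l00 l0l mF N0 FN tT.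
  have K0 : 0 <= K * B by apply: le_trans h; rewrite mulr_ge0// ltW.
  rewrite /A0 -exprMn -real_normK ?num_real// lerXn2r ?nnegrE//.
    by rewrite mulrAC mulr_ge0// invr_ge0 ltW.
  rewrite mulrAC ler_pdivlMr//; apply: le_trans h.
  by rewrite mulrC ler_wpM2r.
- split.
    by apply: le_trans (sq_coefficient iF sy l00 l0l mF N0 FN) _; rewrite lee_fin ler_wpM2r.
  by apply: le_trans (sq_deriv1 iF sy l00 l0l mF N0 FN) _; rewrite lee_fin ler_wpM2r.
- apply: le_trans (sq_deriv2 iF sy l00 l0l mF N0 FN) _.
  by rewrite lee_fin -!(mulrA _ (l ^+ _)) ler_wpM2r.
- move=> F1 mF1; apply: le_trans (sq_deriv3 iF sy l00 l0l mF N0 FN mF1) _.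
  by rewrite leeD2l// lee_fin -!(mulrA _ (l ^+ _)) ler_wpM2r.
- move=> F2 mF2; apply: le_trans (sq_deriv4 iF sy l00 l0l mF N0 FN mF2) _.
  by rewrite leeD2l// lee_fin -!(mulrA _ (l ^+ _)) ler_wpM2r.
Qed.
End coefficient_regularity.

(** * Equivalence of the strong and integrated equations *)

Section weak_solution.
Context {R : realType} {T : R}.
Hypothesis T0 : 0 < T.
Variables (q k : R -> R).
Hypotheses (iq : L1 T q) (kq : forall t : R, t \in `]0, T[ -> k t = prim q t).
Notation L1 := (L1 T).
Notation lm := (@lebesgue_measure R).
Implicit Types (l a b s t : R) (F y h : R -> R).

(** The two kernels are known to agree on the open interval only; the endpoints [s = 0] and [s = t],
    where [t - s] may be [T] or 0, form a null set. *)
Lemma eq_time_convolution_kernel y t : L1 y -> t \in `[0, T] ->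
  time_convolution k y t = time_convolution (prim q) y t.
Proof.
move=> iy; rewrite in_itv/= => /andP[t0 tT].
have sub : `]0, t[ `<=` (`[0, t]%classic : set (measurableTypeR R)).
  exact: subset_itv_oo_cc.
have ipq := prim_continuous (ltW T0) iq.
have mc : measurable_fun (`]0, t[%classic : set (measurableTypeR R))
    (fun s => (prim q (t - s) * y s)%:E).
  apply/measurable_EFinP; apply: measurable_funM; last first.
    apply: measurable_funS (L1_measurable iy) => //.
    by move=> s /sub; rewrite /= !in_itv/= => /andP[-> /le_trans]; apply.
  have mp := prim_measurable (ltW T0) iq.
  apply: (@measurable_comp _ _ _ _ _ _ `[0, T]%classic (prim q)) => //.
    move=> x [s /=]; rewrite !in_itv/= => /andP[s0 st] <-; rewrite subr_ge0 (ltW st)/=.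
    by rewrite lerBlDr (le_trans tT)// lerDl ltW.
  exact: measurable_funB.
have H h : (forall s, s \in `]0, t[ -> h s = prim q (t - s) * y s) ->
    \int[lm]_(s in `[0, t]) h s = \int[lm]_(s in `]0, t[) (prim q (t - s) * y s).
  move=> hE; have mh : measurable_fun (`]0, t[%classic : set (measurableTypeR R)) (fun s => (h s)%:E).
    apply: eq_measurable_fun mc => s /set_mem sI; by rewrite hE.
  have mh' : measurable_fun (`]0, t]%classic : set (measurableTypeR R)) (fun s => (h s)%:E).
    by apply/measurable_EFinP/measurable_fun_itv_bndo_bndcP/measurable_EFinP.
  congr fine; rewrite -integral_itv_obnd_cbnd// -integral_itv_bndo_bndc//.
  by apply: eq_integral => s /set_mem sI; rewrite hE.
rewrite /time_convolution !H// => s; rewrite in_itv/= => /andP[s0 st].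
by rewrite kq// in_itv/= subr_gt0 st/= ltrBlDr (le_lt_trans tT)// ltrDl.
Qed.

Lemma eq_wsolution l a b F y z y1 : (forall t : R, t \in `[0, T] -> y t = z t) ->
  wsolution T q l a b F y y1 -> wsolution T q l a b F z y1.
Proof.
move=> yz [c1 yE y1E]; split; [exact: c1|by move=> t tT; rewrite -(yz t tT); exact: yE|].
move=> t tT; rewrite (y1E t tT); apply: (congr1 (+%R b)); apply: eq_prim => s /andP[s0 st].
have st' : s <= T by apply: le_trans st _; move: tT; rewrite in_itv/= => /andP[].
rewrite yz ?in_itv/= ?s0//.
rewrite (@eq_time_convolution _ _ y z)// => r /andP[r0 rs].
by rewrite yz// in_itv/= r0 (le_trans rs).
Qed.

Lemma strong_wsolution l a b F y : L1 F -> derivable_on `[0, T] y -> y 0 = a ->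
  deriv_on `[0, T] y 0 = b ->
  (exists y2 : R -> R, [/\ lm.-integrable `[0, T] (EFin \o y2),
    forall t : R, t \in `[0, T] ->
      deriv_on `[0, T] y t = deriv_on `[0, T] y 0 + \int[lm]_(s in `[0, t]) y2 s &
    {ae lm, forall t : R, t \in `]0, T] ->
      y2 t + l ^+ 2 * y t = F t - l ^+ 2 * time_convolution k y t}]) ->
  wsolution T q l a b F y (deriv_on `[0, T] y).
Proof.
move=> iF dy y0 y10 [y2 [iy2 y1E ae2]].
have cy := derivable_on_continuous dy.
have iy := L1_continuous cy.
have c1 : {within `[0, T], continuous (deriv_on `[0, T] y)}.
  exact: (primitive_continuous T0 iy2 y1E).
have ik : L1 (time_convolution (prim q) y).
  by apply: L1_time_convolution => //; exact: L1_prim (ltW T0) iq.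
split => // t tT.
  have /andP[t0 tT'] : 0 <= t <= T by rewrite in_itv/= in tT.
  have sub : `[0, t] `<=` `[0, T].
    by move=> x /=; rewrite !in_itv/= => /andP[-> xt]; exact: le_trans xt tT'.
  have ft (x : R) : x \in `]0, t[ -> is_derive x 1 y (deriv_on `[0, T] y x).
    move=> xt; apply: derivable_on_interior => //.
    by move: xt; rewrite !in_itv/= => /andP[-> /lt_le_trans]; apply.
  rewrite (prim_FTC t0 (continuous_subspaceW sub c1) (continuous_subspaceW sub cy) ft).
  by rewrite y0 addrC subrK.
have tT' : t <= T by move: tT; rewrite in_itv/= => /andP[].
rewrite y1E// y10; congr (_ + _).
have i2 : L1 (fun s => F s - l ^+ 2 * (y s + time_convolution (prim q) y s)).
  by apply: L1B => //; apply: L1Z; exact: L1D.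
congr fine; apply: ae_eq_integral => //.
- by apply/measurable_EFinP; apply: (L1_measurable (T := t)); exact: L1_sub iy2 (lexx 0) tT'.
- by apply/measurable_EFinP; apply: (L1_measurable (T := t)); exact: L1_sub i2 (lexx 0) tT'.
(* The equation is given on []0, T]] only, and the time 0 is discarded as a null set. *)
have n0 : {ae lm, forall s : R, s != 0}.
  exists [set 0]; split => //; first exact: lebesgue_measure_set1.
  by move=> s /= /negP; rewrite negbK => /eqP.
apply: (@filterS2 _ _ (ae_filter_ringOfSetsType lm) _ _ _ _ ae2 n0) => s + s0 st.
have /andP[s0' st'] : 0 <= s <= t by rewrite /= in_itv/= in st.
have sT : s \in `]0, T] by rewrite in_itv/= lt_neqAle eq_sym s0 s0' (le_trans st').
move=> /(_ sT); rewrite eq_time_convolution_kernel//; last first.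
  by rewrite in_itv/= s0' (le_trans st').
by move=> e; congr EFin; apply/eqP; rewrite eq_sym subr_eq; apply/eqP; lra.
Qed.

Lemma wsolution_strong l a b F y y1 : L1 F -> wsolution T q l a b F y y1 ->
  [/\ derivable_on `[0, T] y, y 0 = a, deriv_on `[0, T] y 0 = b &
  (exists y2 : R -> R, [/\ lm.-integrable `[0, T] (EFin \o y2),
    forall t : R, t \in `[0, T] ->
      deriv_on `[0, T] y t = deriv_on `[0, T] y 0 + \int[lm]_(s in `[0, t]) y2 s &
    {ae lm, forall t : R, t \in `]0, T] ->
      y2 t + l ^+ 2 * y t = F t - l ^+ 2 * time_convolution k y t}])].
Proof.
move=> iF sy; have [c1 yE y1E] := sy.
have dE (t : R) (tT : t \in `[0, T]) := derivable_on_prim c1 yE tT.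
have d1 (t : R) : t \in `[0, T] -> deriv_on `[0, T] y t = y1 t.
  by move=> tT; exact: (deriv_onE T0 tT (dE t tT)).
have zT : 0 \in `[0, T] by rewrite in_itv/= lexx ltW.
have y10 : y1 0 = b by rewrite y1E// prim0 addr0.
split.
- by move=> t tT; apply/cvg_ex; exists (y1 t); exact: dE.
- by rewrite yE// prim0 addr0.
- by rewrite d1.
- exists (deriv2 q l F y); split.
  + exact: L1_deriv2 sy.
  + by move=> t tT; rewrite !d1// y10 y1E.
  + apply: aeW => t; rewrite in_itv/= => /andP[t0 tT].
    rewrite eq_time_convolution_kernel//; first by rewrite /deriv2 /kernel_conv; ring.
      exact: L1_continuous (wsolution_continuous T0 sy).
    by rewrite in_itv/= (ltW t0).
Qed.

End weak_solution.

(** * Summation over the coefficients *)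

Section solution_regularity.
Context {R : realType} {d : nat} {Omega : set 'rV[R]_d}.
Variables (phi : nat -> 'rV[R]_d -> R) (lam : nat -> R) (T : R) (q : R -> R).
Hypotheses (onb : orthonormal_basis Omega phi) (T0 : 0 < T).
Hypotheses (lam_gt0 : forall i, 0 < lam i) (lam_ge : forall i, lam 0%N <= lam i).
Hypotheses (mq : measurable_fun (`[0, T]%classic : set (measurableTypeR R)) q)
  (iq : L1 T q) (iq2 : L1 T (fun t => q t ^+ 2)).
Notation L2 := (L2 Omega).
Notation inner := (inner Omega).
Notation lm := (@lebesgue_measure R).
Notation msr := (measurable_fun (`[0, T]%classic : set (measurableTypeR R))).
Notation NH := (checkH_norm Omega lam phi).
Notation V := (coef_norm2 lam T).
Notation coef := (@coef R d Omega phi).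
Notation L2_path := (@L2_path R d Omega T).
Implicit Types (g h : R -> 'rV[R]_d -> R) (w : 'rV[R]_d -> R) (X : nat -> R -> R).

Definition l2_norm2 n (c : nat -> R) : \bar R :=
  (\sum_(0 <= i <oo) (lam i ^+ (2 * n) * c i ^+ 2)%:E)%E.
Notation E := l2_norm2.

Lemma l2_norm2_ge0 n c : (0 <= E n c)%E.
Proof.
by apply: nneseries_ge0 => i _ _; rewrite lee_fin mulr_ge0 ?sqr_ge0 ?(weight_ge0 lam_gt0).
Qed.

Lemma sq_coef g i : L2_path g -> (V 0 (coef g) < +oo)%E ->
  let N := Num.sqrt (fine (sq T (coef g i))) in sq T (coef g i) = (N ^+ 2)%:E.
Proof.
move=> gp Voo N; have s0 := @sq_ge0 R T (coef g i).
have : (sq T (coef g i) <= V 0 (coef g))%E.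
  have nn n : (0 <= (lam n ^+ (2 * 0))%:E * sq T (coef g n))%E.
    by rewrite mule_ge0 ?lee_fin ?(weight_ge0 lam_gt0) ?sq_ge0.
  have -> : sq T (coef g i) = ((lam i ^+ (2 * 0))%:E * sq T (coef g i))%E.
    by rewrite muln0 expr0 mul1e.
  exact: nneseries_term_le i nn.
move=> /le_lt_trans/(_ Voo) soo; rewrite /N sqr_sqrtr ?fine_ge0// fineK//.
by rewrite ge0_fin_numE.
Qed.

Lemma L1_coef g i : L2_path g -> (V 0 (coef g) < +oo)%E -> L1 T (coef g i).
Proof.
move=> gp Voo.
by have [] := sq_norm_bound T0 (measurable_coef onb i gp) (sqrtr_ge0 _) (sq_coef i gp Voo).
Qed.

Lemma finite_coef_norm2 m n X : (m <= n)%N -> (V n X < +oo)%E -> (V m X < +oo)%E.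
Proof.
move=> mn Voo; apply: le_lt_trans (coef_norm2_weight T lam_gt0 lam_ge X mn) _.
have Vf : V n X \is a fin_num by rewrite ge0_fin_numE ?(coef_norm2_ge0 T lam_gt0).
by rewrite -(fineK Vf) -EFinM ltry.
Qed.

(* Dominates lam_0^-p for all p <= 8. *)
Definition weight_bound : R := (1 + (lam 0%N)^-1) ^+ 8.
Notation W := weight_bound.

Let W1 : 1 <= W.
Proof. by rewrite exprn_ege1// lerDl invr_ge0 ltW. Qed.

Let W_ge p : (p <= 8)%N -> lam 0%N ^- p <= W.
Proof.
move=> p8; have h : 0 <= (lam 0%N)^-1 by rewrite invr_ge0 ltW.
rewrite -exprVn; apply: le_trans (_ : (1 + (lam 0%N)^-1) ^+ p <= _).
  by rewrite lerXn2r ?nnegrE ?addr_ge0// lerDr.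
by rewrite ler_weXn2l// lerDl.
Qed.

Lemma coef_norm2_weight_bound m n X : (m <= n <= 4)%N -> (V m X <= W%:E * V n X)%E.
Proof.
move=> /andP[mn n4]; apply: le_trans (coef_norm2_weight T lam_gt0 lam_ge X mn) _.
apply: lee_wpmul2r; first exact: coef_norm2_ge0 T lam_gt0 _ _.
rewrite lee_fin; apply: W_ge; rewrite (leq_trans (leq_mul (leqnn 2) (leq_subr m n)))//.
by rewrite (leq_mul2l 2 n 4).
Qed.

Lemma l2_norm2_weight_bound m n c : (m <= n <= 4)%N -> (E m c <= W%:E * E n c)%E.
Proof.
move=> /andP[mn n4]; rewrite -nneseriesZl; last first.
  by move=> i _; rewrite lee_fin mulr_ge0 ?sqr_ge0 ?(weight_ge0 lam_gt0).
apply: lee_nneseries => i _; first by rewrite lee_fin mulr_ge0 ?sqr_ge0 ?(weight_ge0 lam_gt0).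
rewrite -EFinM lee_fin [leRHS]mulrA ler_wpM2r ?sqr_ge0//.
have -> : lam i ^+ (2 * n) = lam i ^+ (2 * (n - m)) * lam i ^+ (2 * m).
  by rewrite -exprD -mulnDr subnK.
rewrite mulrA ler_peMl ?(weight_ge0 lam_gt0)//.
apply: le_trans (_ : lam 0%N ^- (2 * (n - m)) * lam i ^+ (2 * (n - m)) <= _); last first.
  rewrite ler_wpM2r ?(weight_ge0 lam_gt0)//; apply: W_ge.
  rewrite (leq_trans (leq_mul (leqnn 2) (leq_subr m n)))//.
  by rewrite (leq_mul2l 2 n 4).
rewrite mulrC ler_pdivlMr ?exprn_gt0// mul1r lerXn2r ?nnegrE ?(ltW (lam_gt0 _))//.
Qed.

Variables (C : R) (C0 : 0 <= C).
Hypothesis est : @coefficient_estimate R T q (lam 0%N) C.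

Variables (u0 v0 : 'rV[R]_d -> R) (f : R -> 'rV[R]_d -> R).
Hypotheses (fp : L2_path f) (Vf : (V 0 (coef f) < +oo)%E).

Definition data_size i : R := lam i * `|inner u0 (phi i)| + `|inner v0 (phi i)| +
  Num.sqrt (fine (sq T (coef f i))).
Notation B := data_size.

Section given_solution.
Variables (u : R -> 'rV[R]_d -> R) (Y : nat -> R -> R).
Hypothesis up : L2_path u.
Hypothesis sol : forall i, wsolution T q (lam i) (inner u0 (phi i)) (inner v0 (phi i))
  (coef f i) (coef u i) (Y i).

Let esti i := est (lam_ge i) (measurable_coef onb i fp) (sqrtr_ge0 _) (sq_coef i fp Vf) (sol i).

(* The j-th time derivatives of the coefficients of u. *)
Definition solution_deriv (F1 F2 : nat -> R -> R) (j : nat) (i : nat) : R -> R :=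
  match j with
  | 0 => coef u i
  | 1 => Y i
  | 2 => deriv2 q (lam i) (coef f i) (coef u i)
  | 3 => deriv3 q (lam i) (coef u i) (Y i) (F1 i)
  | _ => deriv4 q (lam i) (inner u0 (phi i)) (coef f i) (coef u i) (Y i) (F2 i)
  end%N.

Let le_series n p (X X' : nat -> R -> R) (k : R) : 0 <= k ->
  (forall i, (sq T (X i) <= k%:E * sq T (X' i) + (C * lam i ^+ (2 * p) * B i ^+ 2)%:E)%E) ->
  (V n X <= k%:E * V n X' + C%:E * E (n + p) B)%E.
Proof.
move=> k0 H; rewrite -!nneseriesZl; first last.
- by move=> i _; rewrite mule_ge0 ?lee_fin ?(weight_ge0 lam_gt0) ?sq_ge0.
- by move=> i _; rewrite lee_fin mulr_ge0 ?sqr_ge0 ?(weight_ge0 lam_gt0).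
rewrite -nneseriesD; first last.
- by move=> i _ _; rewrite -EFinM lee_fin (mulr_ge0 C0 (mulr_ge0 (weight_ge0 lam_gt0 _ _) (sqr_ge0 _))).
- by move=> i _ _; rewrite !mule_ge0 ?lee_fin ?(weight_ge0 lam_gt0) ?sq_ge0.
apply: lee_nneseries => i _; first by rewrite mule_ge0 ?lee_fin ?(weight_ge0 lam_gt0) ?sq_ge0.
have w0 : (0 <= (lam i ^+ (2 * n))%:E)%E by rewrite lee_fin (weight_ge0 lam_gt0).
apply: le_trans (lee_wpmul2l w0 (H i)) _.
rewrite ge0_muleDr; last 2 first.
- by rewrite mule_ge0 ?lee_fin ?sq_ge0.
- by rewrite lee_fin (mulr_ge0 (mulr_ge0 C0 (weight_ge0 lam_gt0 _ _)) (sqr_ge0 _)).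
rewrite muleCA -!EFinM leeD2l// lee_fin mulnDr exprD le_eqVlt; apply/orP; left; apply/eqP.
by clear; move: (lam i ^+ _) (lam i ^+ _) (B i ^+ 2) => x y z; ring.
Qed.

Let le_series0 n p (X : nat -> R -> R) :
  (forall i, (sq T (X i) <= (C * lam i ^+ (2 * p) * B i ^+ 2)%:E)%E) ->
  (V n X <= C%:E * E (n + p) B)%E.
Proof.
move=> H; have := @le_series n p X X 0 (lexx 0).
rewrite mul0e add0e; apply => i; rewrite mul0e add0e; exact: H.
Qed.

(** A count of orders: for [j >= 1] the [j]-th derivative of coefficient [i] is of size
    [lam i ^+ j.-1] times [data_size i], so order [n] in space needs order [n + j - 1 <= p] of the
    data. Derivatives 3 and 4 add the first and second derivatives of the forcing term. With
    [p <= 3] the exponents remain within the range of [weight_bound]. *)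
Lemma solution_deriv_bound F1 F2 p n j (e r : R) : (j <= 4)%N -> (n + j <= p.+1)%N ->
  (p <= 3)%N -> 0 <= r ->
  (E p B <= e%:E)%E ->
  ((2 < j)%N -> (forall i, msr (F1 i)) /\ (V n F1 <= (W * r)%:E)%E) ->
  ((3 < j)%N -> (forall i, msr (F2 i)) /\ (V n F2 <= (W * r)%:E)%E) ->
  (V n (solution_deriv F1 F2 j) <= (W * C * e + 2 * W * r)%:E)%E.
Proof.
move=> j4 njp p3 r0 Ee F1P F2P.
have W0 : 0 <= W by apply: le_trans W1.
have e0 : 0 <= e by rewrite -lee_fin (le_trans _ Ee)// l2_norm2_ge0.
have EC : (C%:E * E p B <= (C * e)%:E)%E by rewrite EFinM lee_wpmul2l.
have final (x : \bar R) : (x <= W%:E * (C%:E * E p B))%E -> (x <= (W * C * e + 2 * W * r)%:E)%E.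
  move=> /le_trans; apply; apply: le_trans (lee_wpmul2l _ EC) _; rewrite ?lee_fin//.
  by rewrite -?EFinM ?lee_fin [leLHS]mulrA lerDl (mulr_ge0 (mulr_ge0 (ler0n _ 2) W0) r0).
have Ep m : (m <= p)%N -> (C%:E * E m B <= W%:E * (C%:E * E p B))%E.
  move=> mp; rewrite muleCA; apply: lee_wpmul2l; first by rewrite lee_fin.
  by apply: l2_norm2_weight_bound; rewrite mp (leq_trans p3).
have fin2 X F : (V n F <= (W * r)%:E)%E -> (V n X <= 2%:E * V n F + W%:E * (C%:E * E p B))%E ->
    (V n X <= (W * C * e + 2 * W * r)%:E)%E.
  move=> FWr /le_trans; apply.
  have -> : W * C * e + 2 * W * r = 2 * (W * r) + W * (C * e) by ring.
  have two : (0 <= 2%:E :> \bar R)%E by rewrite lee_fin.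
  have W0' : (0 <= W%:E :> \bar R)%E by rewrite lee_fin.
  exact: leeD (lee_wpmul2l two FWr) (lee_wpmul2l W0' EC).
case: j j4 njp F1P F2P => [|[|[|[|[|//]]]]] _; rewrite ?addn0 => njp F1P F2P.
(* For [j = 0] the estimate controls [lam i] times the coefficient, so order [p.+1] of [u] is
   reached from order [p] of the data. *)
- apply: final; apply: le_trans (coef_norm2_weight_bound (n := p.+1) _ _) _.
    by rewrite njp ltnS.
  apply: lee_wpmul2l; first by rewrite lee_fin.
  rewrite -nneseriesZl; last first.
    by move=> i _; rewrite lee_fin mulr_ge0 ?sqr_ge0 ?(weight_ge0 lam_gt0).
  apply: lee_nneseries => i _; first by rewrite mule_ge0 ?lee_fin ?(weight_ge0 lam_gt0) ?sq_ge0.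
  have [_ [h _] _ _ _] := esti i.
  have w0 : (0 <= (lam i ^+ (2 * p))%:E)%E by rewrite lee_fin (weight_ge0 lam_gt0).
  rewrite mulnS addnC exprD EFinM -muleA; apply: le_trans (lee_wpmul2l w0 h) _.
  rewrite -!EFinM lee_fin le_eqVlt; apply/orP; left; apply/eqP.
  by clear; rewrite /B; move: (lam i ^+ _) (_ ^+ 2) => x y; ring.
- apply: final; apply: le_trans (Ep n _); last by rewrite addn1 ltnS in njp.
  rewrite -[X in E X _]addn0; apply: le_series0 => i.
  by have [_ [_ h] _ _ _] := esti i; rewrite muln0 expr0 mulr1.
- apply: final; apply: le_trans (Ep (n + 1)%N _); last by rewrite addnS ltnS in njp.
  by apply: le_series0 => i; have [_ _ h _ _] := esti i; rewrite muln1.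
- have [mF1 VF1] := F1P isT; apply: (fin2 _ F1 VF1).
  apply: le_trans (leeD2l _ (Ep (n + 2)%N _)); last by rewrite addnS ltnS in njp.
  by apply: le_series => // i; have [_ _ _ h _] := esti i; exact: h.
- have [mF2 VF2] := F2P isT; apply: (fin2 _ F2 VF2).
  apply: le_trans (leeD2l _ (Ep (n + 3)%N _)); last by rewrite addnS ltnS in njp.
  by apply: le_series => // i; have [_ _ _ _ h] := esti i; exact: h.
Qed.

(** The factor 5 bounds the number of time derivatives, from order 0 to order [m <= 4]. *)
Lemma solution_HmX F1 F2 p n m (e r : R) : (m <= 4)%N -> (n + m <= p.+1)%N ->
  (p <= 3)%N -> 0 <= e -> 0 <= r -> (E p B <= e%:E)%E ->
  ((2 < m)%N -> (V n F1 <= (W * r)%:E)%E /\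
    forall i, L1 T (F1 i) /\ weak_derivative1 T (coef f i) (F1 i)) ->
  ((3 < m)%N -> (V n F2 <= (W * r)%:E)%E /\
    forall i, L1 T (F2 i) /\ weak_derivative1 T (F1 i) (F2 i)) ->
  HmX Omega T m (NH n%:R) u /\
  (HmX_norm Omega T m (NH n%:R) u <= (Num.sqrt (5 * (W * C * e + 2 * W * r)))%:E)%E.
Proof.
move=> m4 nmp p3 e0 r0 Ee F1P F2P; set s := W * C * e + 2 * W * r.
have W0 : 0 <= W by apply: le_trans W1.
have s0 : 0 <= s := addr_ge0 (mulr_ge0 (mulr_ge0 W0 C0) e0) (mulr_ge0 (mulr_ge0 (ler0n _ 2) W0) r0).
have iY i : L1 T (Y i) by have [/L1_continuous] := sol i.
have iF i := L1_coef i fp Vf.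
pose X := solution_deriv F1 F2.
have iX j i : (j <= m)%N -> L1 T (X j i).
  case: j => [|[|[|[|j]]]] jm.
  - exact: L1_continuous (wsolution_continuous T0 (sol i)).
  - exact: iY.
  - exact: L1_deriv2 (sol i).
  - have [_ /(_ i)[i1 _]] := F1P jm.
    by apply: L1B => //; apply: L1Z; apply: L1D => //; exact: L1_kernel_conv1 (sol i).
  - have [_ /(_ i)[i2 _]] := F2P (leq_trans (ltn_addr j (ltnSn 3)) jm).
    apply: L1B => //; apply: L1Z; apply: L1D.
      exact: L1_deriv2 (sol i).
    exact: L1_kernel_conv2 (sol i).
have bX j : (j <= m)%N -> (V n (X j) <= s%:E)%E.
  move=> jm; apply: (@solution_deriv_bound _ _ p) => //.
  - exact: leq_trans jm m4.
  - by apply: leq_trans nmp; rewrite leq_add2l.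
  - move=> j2; have [h1 h2] := F1P (leq_trans j2 jm); split => // i.
    by apply: L1_measurable; have [] := h2 i.
  - move=> j2; have [h1 h2] := F2P (leq_trans j2 jm); split => // i.
    by apply: L1_measurable; have [] := h2 i.
have [] := @HmX_coefs _ _ _ _ _ _ onb T0 lam_gt0 lam_ge m n u X up.
- by [].
- by move=> j jm i; apply: L1_measurable; exact: iX.
- by move=> j jm; apply: le_lt_trans (bX j jm) (ltry _).
- move=> [|[|[|[|j]]]] jm i.
  + exact (weak_derivative_deriv1 T0 (sol i)).
  + exact (weak_derivative_deriv2 T0 iq (iF i) (sol i)).
  + have [_ /(_ i)[i1 w1]] := F1P jm.
    exact (weak_derivative_deriv3 T0 iq (iF i) (sol i) i1 w1).
  + have [_ /(_ i)[i1 w1]] := F1P (ltnW jm); have [_ /(_ i)[i2 w2]] := F2P jm.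
    exact (weak_derivative_deriv4 T0 mq iq (iF i) (sol i) i1 i2 w2).
  + by move: (leq_trans jm m4).
move=> h1 h2; split => //; apply: le_trans h2 _.
rewrite -powR12_sqrt; last by rewrite mulr_ge0.
rewrite -poweR_EFin; apply: gt0_ler_poweR; rewrite ?invr_ge0// ?in_itv/= ?leey ?andbT.
- by apply: sume_ge0 => j _; exact: coef_norm2_ge0 T lam_gt0 _ _.
- by rewrite lee_fin mulr_ge0.
apply: le_trans (lee_sum _ (fun (j : 'I_m.+1) _ => bX j (leq_ord j))) _.
rewrite sumEFin lee_fin sumr_const card_ord -[leLHS]mulr_natl ler_wpM2r// ler_nat.
by rewrite ltnS.
Qed.

Lemma solution_L2X n p (e : R) : (n <= p.+1)%N -> (p <= 3)%N -> 0 <= e -> (E p B <= e%:E)%E ->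
  L2X Omega T (NH n%:R) u /\
  (L2X_norm T (NH n%:R) u <= (Num.sqrt (5 * (W * C * e)))%:E)%E.
Proof.
move=> np p3 e0 Ee; have W0 : 0 <= W by apply: le_trans W1.
have WCe0 : 0 <= W * C * e := mulr_ge0 (mulr_ge0 W0 C0) e0.
have bV : (V n (coef u) <= (W * C * e)%:E)%E.
  have := @solution_deriv_bound (fun=> cst 0) (fun=> cst 0) p n 0 e 0 isT.
  rewrite addn0 !mulr0 addr0 => /(_ np p3 (lexx 0) Ee); apply => h; by rewrite ltn0 in h.
split.
  apply/(L2X_NHP T onb lam_gt0); split; first exact: up.
  exact: le_lt_trans bV (ltry _).
rewrite (L2X_norm_half onb lam_gt0 n up) -powR12_sqrt; last exact: mulr_ge0 (ler0n _ 5) WCe0.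
rewrite -poweR_EFin; apply: gt0_ler_poweR; rewrite ?invr_ge0// ?in_itv/= ?leey ?andbT.
- exact: coef_norm2_ge0 T lam_gt0 _ _.
- by rewrite lee_fin (mulr_ge0 (ler0n _ 5) WCe0).
(* The factor 5 gives the bound the form it has in [solution_HmX], so that [sqrt_stability] serves
   both. *)
by apply: le_trans bV _; rewrite lee_fin ler_peMl// ler1n.
Qed.

End given_solution.

(** The scalar equations are solved one by one; what remains is to assemble their solutions into a
    path whose coefficients they are. *)
Lemma path_solution_exists (e : R) : (E 0 B <= e%:E)%E ->
  exists u (Y : nat -> R -> R), L2_path u /\
  forall i, wsolution T q (lam i) (inner u0 (phi i)) (inner v0 (phi i))
    (coef f i) (coef u i) (Y i).
Proof.
move=> Ee.
have [y yP] : {y : nat -> R -> R & forall i, exists y1, wsolution T q (lam i)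
    (inner u0 (phi i)) (inner v0 (phi i)) (coef f i) (y i) y1}.
  apply: (@boolp.choice _ _ (fun i yi => exists y1, wsolution T q (lam i)
    (inner u0 (phi i)) (inner v0 (phi i)) (coef f i) yi y1)) => i.
  exact: (wsolution_exists T0 iq (lam i) _ _ (L1_coef i fp Vf)).
have [Y YP] := boolp.choice yP.
(* The square summability of the [y i t] holds at every time, so the path has exactly these
   coefficients on the whole of [[0, T]], initial values included. Outside, 0 is a placeholder. *)
have H (t : R) : exists q, L2 q /\ (t \in `[0, T] -> forall i, inner q (phi i) = y i t).
  have [tT|] := boolP (t \in `[0, T]); last by exists (cst 0); split => //; exact: L2_0.
  have [|w wL wE] := @riesz_fischer _ _ _ _ onb (fun i => y i t); last by exists w.
  apply: (@le_lt_trans _ _ (C%:E * E 0 B)%E).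
    rewrite -nneseriesZl; last first.
      by move=> i _; rewrite lee_fin mulr_ge0 ?sqr_ge0 ?(weight_ge0 lam_gt0).
    apply: lee_nneseries => i _; first by rewrite lee_fin sqr_ge0.
    have [h _ _ _ _] := est (lam_ge i) (measurable_coef onb i fp) (sqrtr_ge0 _) (sq_coef i fp Vf) (YP i).
    by rewrite -EFinM lee_fin muln0 expr0 mul1r; exact: h.
  have C0' : (0 <= C%:E)%E by rewrite lee_fin.
  by apply: le_lt_trans (lee_wpmul2l C0' Ee) _; rewrite -EFinM ltry.
have [u uP] := boolp.choice H.
have uE i (t : R) : t \in `[0, T] -> y i t = coef u i t.
  by move=> tT; exact: esym ((uP t).2 tT i).
exists u, Y; split; last first.
  by move=> i; exact: eq_wsolution (uE i) (YP i).
apply: (L2_pathP onb); first by move=> t _; exact: (uP t).1.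
move=> i; apply: (@eq_measurable_fun _ _ _ _ _ (y i)).
  by move=> t /set_mem; exact: uE.
exact: continuous_measurable (wsolution_continuous T0 (YP i)).
Qed.
End solution_regularity.

(** * Norms of the data as real numbers *)

Section data_norms.
Context {R : realType} {d : nat} {Omega : set 'rV[R]_d}.
Variables (phi : nat -> 'rV[R]_d -> R) (lam : nat -> R) (T : R).
Hypotheses (onb : orthonormal_basis Omega phi) (T0 : 0 < T).
Hypotheses (lam_gt0 : forall i, 0 < lam i) (lam_ge : forall i, lam 0%N <= lam i).
Notation L2 := (L2 Omega).
Notation inner := (inner Omega).
Notation NH := (checkH_norm Omega lam phi).
Notation V := (coef_norm2 lam T).
Notation coef := (@coef R d Omega phi).
Notation L2_path := (@L2_path R d Omega T).
Notation E := (l2_norm2 lam).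
Implicit Types (Q a x y z r : R).

Lemma half_power_EFin (s : \bar R) : (0 <= s)%E -> (s `^ 2^-1 < +oo)%E ->
  exists x, [/\ 0 <= x, (s `^ 2^-1 = x%:E)%E & s = (x ^+ 2)%:E].
Proof.
move=> s0 soo; have h0 : (0 <= s `^ 2^-1)%E by exact: poweR_ge0.
have hf : (s `^ 2^-1)%E \is a fin_num by rewrite ge0_fin_numE.
exists (fine (s `^ 2^-1)%E); split; [exact: fine_ge0|by rewrite fineK|].
rewrite -[LHS]sqr_poweR_half// -[X in (X `^ 2)%E](fineK hf) poweR_EFin.
by rewrite powR_mulrn// fine_ge0.
Qed.

Lemma checkH_norm_real n p : checkH Omega lam phi n%:R p ->
  exists x, [/\ 0 <= x, NH n%:R p = x%:E & E n (fun i => inner p (phi i)) = (x ^+ 2)%:E].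
Proof.
move=> [pL]; rewrite (checkH_norm_nat phi lam_gt0) => /half_power_EFin; apply.
exact: l2_norm2_ge0.
Qed.

Lemma L2X_norm_real n g : L2X Omega T (NH n%:R) g ->
  exists x, [/\ 0 <= x, L2X_norm T (NH n%:R) g = x%:E & V n (coef g) = (x ^+ 2)%:E].
Proof.
move=> gX; have [gp _] := (L2X_NHP T onb lam_gt0 n g).1 gX.
have [_ _] := gX; rewrite (L2X_norm_half onb lam_gt0)// => /half_power_EFin; apply.
exact: coef_norm2_ge0.
Qed.

(** The 3 comes from [(r + s + t)^2 <= 3 (r^2 + s^2 + t^2)] in each term; the sum of squares of the
    three norms is then at most the square of their sum. The extra order of [u0] is the factor
    [lam i] in [data_size]. *)
Lemma data_size_bound n (u0 v0 : 'rV[R]_d -> R) f x y z : 0 <= x -> 0 <= y -> 0 <= z ->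
  L2_path f -> (V 0 (coef f) < +oo)%E ->
  E n.+1 (fun i => inner u0 (phi i)) = (x ^+ 2)%:E ->
  E n (fun i => inner v0 (phi i)) = (y ^+ 2)%:E ->
  V n (coef f) = (z ^+ 2)%:E ->
  (E n (@data_size R d Omega phi lam T u0 v0 f) <= (3 * (x + y + z) ^+ 2)%:E)%E.
Proof.
move=> x0 y0 z0 fp Vf Ex Ey Ez; have w0 i p : 0 <= lam i ^+ (2 * p) by exact: weight_ge0 lam_gt0 _ _.
apply: le_trans (_ : 3%:E * (E n.+1 (fun i => inner u0 (phi i)) +
   E n (fun i => inner v0 (phi i)) + V n (coef f)) <= _)%E.
  have t0 i p (c : R) : (0 <= (lam i ^+ (2 * p) * c ^+ 2)%:E)%E.
    by rewrite lee_fin (mulr_ge0 (w0 _ _) (sqr_ge0 _)).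
  have sq0 i : (0 <= (lam i ^+ (2 * n))%:E * sq T (coef f i))%E.
    by apply: mule_ge0; [rewrite lee_fin|exact: sq_ge0].
  rewrite /coef_norm2 /l2_norm2 -nneseriesD; [|by move=> *; exact: t0..].
  rewrite -nneseriesD; [|by move=> *; exact: adde_ge0|by move=> *; exact: sq0].
  rewrite -nneseriesZl; last by move=> i _; apply: adde_ge0; [exact: adde_ge0|exact: sq0].
  apply: lee_nneseries => i _.
    by rewrite lee_fin (mulr_ge0 (w0 _ _) (sqr_ge0 _)).
  rewrite (sq_coef lam_gt0 i fp Vf) /data_size.
  set N := Num.sqrt _; set a := inner u0 _; set b := inner v0 _.
  apply: (@le_trans _ _ (3 * (lam i ^+ (2 * n.+1) * a ^+ 2 + lam i ^+ (2 * n) * b ^+ 2 +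
    lam i ^+ (2 * n) * N ^+ 2))%:E%E); last exact: lexx.
  rewrite lee_fin mulnS exprD.
  have -> : 3 * (lam i ^+ 2 * lam i ^+ (2 * n) * a ^+ 2 + lam i ^+ (2 * n) * b ^+ 2 +
      lam i ^+ (2 * n) * N ^+ 2) =
      lam i ^+ (2 * n) * (3 * ((lam i * `|a|) ^+ 2 + `|b| ^+ 2 + N ^+ 2)).
    rewrite exprMn !real_normK ?num_real//.
    by clear; move: (lam i ^+ _) (lam i ^+ 2) => u v; ring.
  rewrite ler_wpM2l//; move: (lam i * `|a|) (`|b|) (N) => r s t.
  have := sqr_ge0 (r - s); have := sqr_ge0 (s - t); have := sqr_ge0 (r - t).
  by rewrite !sqrrB !sqrrD; lra.
rewrite Ex Ey Ez.
apply: (@le_trans _ _ (3 * (x ^+ 2 + y ^+ 2 + z ^+ 2))%:E%E); first exact: lexx.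
rewrite lee_fin.
have := mulr_ge0 x0 y0; have := mulr_ge0 x0 z0; have := mulr_ge0 y0 z0.
by rewrite !sqrrD mulrDl; lra.
Qed.

Lemma Hm_derivatives_real m n g D : Hm_derivatives Omega T m (NH n%:R) g D ->
  exists r, [/\ 0 <= r,
    ((\sum_(j < m.+1) (L2X_norm T (NH n%:R) (D j) `^ 2)) `^ 2^-1)%E = r%:E &
    forall j, (j <= m)%N -> (V n (coef (D j)) <= (r ^+ 2)%:E)%E].
Proof.
move=> [D0 DX wD].
have s0 : (0 <= \sum_(j < m.+1) (L2X_norm T (NH n%:R) (D j) `^ 2))%E.
  by apply: sume_ge0 => j _; exact: poweR_ge0.
have soo : (\sum_(j < m.+1) (L2X_norm T (NH n%:R) (D j) `^ 2) < +oo)%E.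
  apply: lte_sum_pinfty => j _; have [_ _ h] := DX j (leq_ord j).
  exact: poweR_lty.
have [r [r0 re rE]] := half_power_EFin s0 (poweR_lty _ soo).
exists r; split => // j jm; rewrite -rE.
have jm' : (j < m.+1)%N by rewrite ltnS.
have [gp _] := (L2X_NHP T onb lam_gt0 n (D j)).1 (DX j jm).
rewrite -(L2X_normE onb lam_gt0 n gp) (bigD1 (Ordinal jm'))//= leeDl//.
by apply: sume_ge0 => i _; exact: poweR_ge0.
Qed.

Lemma HmX_norm_ge0 m n g : (0 <= HmX_norm Omega T m (NH n%:R) g)%E.
Proof. by apply: le_ereal_inf_tmp => _ [D _ <-]; exact: poweR_ge0. Qed.

(** The norm is an infimum over families of derivatives: a bound valid for each family passes to it
    up to an arbitrary [e], and an infinite norm makes the right-hand side infinite. *)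
Lemma le_HmX_norm m n g (L : \bar R) Q a z : 0 < Q ->
  (forall D r, Hm_derivatives Omega T m (NH n%:R) g D -> 0 <= r ->
    (forall j, (j <= m)%N -> (V n (coef (D j)) <= (r ^+ 2)%:E)%E) ->
    (L <= (Q * (a + r + z))%:E)%E) ->
  (L <= Q%:E * (a%:E + HmX_norm Omega T m (NH n%:R) g + z%:E))%E.
Proof.
move=> Q0 H; have := HmX_norm_ge0 m n g.
case hE : (HmX_norm _ _ _ _ _) => [h| |] // h0; last first.
  by rewrite addey// addye// gt0_muley ?lte_fin// leey.
apply/lee_addgt0Pr => e e0.
have eQ : 0 < e / Q by rewrite divr_gt0.
have hf : HmX_norm Omega T m (NH n%:R) g \is a fin_num by rewrite hE.
have [y [D HD yE]] := lb_ereal_inf_adherent eQ hf.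
have [r [r0 re rV]] := Hm_derivatives_real HD.
have {re}yE : y = r%:E := etrans (esym yE) re.
rewrite {}yE [ereal_inf _]hE -EFinD lte_fin => rh.
apply: le_trans (H D r HD r0 rV) _; rewrite -[leRHS]/(Q * (a + h + z) + e)%:E lee_fin.
have -> : e = Q * (e / Q) by rewrite mulrCA divff ?mulr1// gt_eqF.
by rewrite -mulrDr ler_pM2l//; move: (e / Q) rh => e'; lra.
Qed.

End data_norms.

Lemma L2_ae_eq {R : realType} {d : nat} {Omega : set 'rV[R]_d} (p r : 'rV[R]_d -> R) :
  L2 Omega p -> L2 Omega r -> inner Omega (fun x => p x - r x) (fun x => p x - r x) = 0 ->
  {ae lebesgue_rV R d, forall x, Omega x -> p x = r x}.
Proof.
move=> pL rL pr0; have prL := L2B pL rL.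
have N0 : L2_norm Omega (fun x => p x - r x) = 0%E by rewrite L2_normE// pr0 sqrtr0.
have mpr : measurable_fun setT (EFin \o (fun x => p x - r x) \_ Omega).
  by apply/measurable_EFinP; exact: L2_measurable.
have := Lnorm_eq0_eq0 mpr _ N0; rewrite lte_fin => /(_ (ltr0n _ 2)).
apply: filterS => x + Ox => /(_ I) /=; rewrite restrictE mem_set// => -[].
by move/eqP; rewrite subr_eq0 => /eqP.
Qed.

(** * Well-posedness and regularity *)

Section well_posedness.
Context {R : realType} {d : nat} {Omega : set 'rV[R]_d}.
Variables (phi : nat -> 'rV[R]_d -> R) (lam : nat -> R) (T : R) (q k : R -> R).
Hypotheses (onb : orthonormal_basis Omega phi) (T0 : 0 < T).
Hypotheses (lam_gt0 : forall i, 0 < lam i) (lam_ge : forall i, lam 0%N <= lam i).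
Hypotheses (mq : measurable_fun (`[0, T]%classic : set (measurableTypeR R)) q)
  (iq : L1 T q) (iq2 : L1 T (fun t => q t ^+ 2)).
Hypothesis kq : forall t : R, t \in `]0, T[ -> k t = prim q t.
Notation L2 := (L2 Omega).
Notation inner := (inner Omega).
Notation NH := (checkH_norm Omega lam phi).
Notation H := (checkH Omega lam phi).
Notation V := (coef_norm2 lam T).
Notation coef := (@coef R d Omega phi).
Notation L2_path := (@L2_path R d Omega T).
Notation E := (l2_norm2 lam).
Notation W := (weight_bound lam).
Notation sol := (solution Omega T k lam phi).
Notation HmX := (HmX Omega T).
Notation HmX_norm := (HmX_norm Omega T).
Notation L2X := (L2X Omega T).
Notation N := (L2_norm Omega).

Lemma solution_wsolution u0 v0 f u : L2_path f -> (V 0 (coef f) < +oo)%E -> sol u0 v0 f u ->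
  forall i, wsolution T q (lam i) (inner u0 (phi i)) (inner v0 (phi i))
    (coef f i) (coef u i) (deriv_on `[0, T] (coef u i)).
Proof.
move=> fp Vf su i; have [dy y0 y10 ex] := su i.
exact (strong_wsolution T0 iq kq (L1_coef onb T0 lam_gt0 i fp Vf) dy y0 y10 ex).
Qed.

Lemma wsolution_solution u0 v0 f u Y : L2_path f -> (V 0 (coef f) < +oo)%E ->
  (forall i, wsolution T q (lam i) (inner u0 (phi i)) (inner v0 (phi i))
    (coef f i) (coef u i) (Y i)) -> sol u0 v0 f u.
Proof.
move=> fp Vf su i.
exact (wsolution_strong T0 iq kq (L1_coef onb T0 lam_gt0 i fp Vf) (su i)).
Qed.

Lemma HmX_path m n u : HmX m (NH n%:R) u -> L2_path u.
Proof. by move=> [D [<- /(_ 0%N (leq0n m))]] /(L2X_NHP T onb lam_gt0)[]. Qed.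

Lemma solution_unique u0 v0 f u w : L2_path f -> (V 0 (coef f) < +oo)%E ->
  L2_path u -> L2_path w -> sol u0 v0 f u -> sol u0 v0 f w ->
  forall t : R, t \in `[0, T] -> {ae lebesgue_rV R d, forall x, Omega x -> w t x = u t x}.
Proof.
move=> fp Vf [uL _] [wL _] su sw t tT; apply: L2_ae_eq; [exact: wL|exact: uL|].
apply: (L2_eq0 onb) => [|i]; first by apply: L2B; [exact: wL|exact: uL].
rewrite innerBl; [|exact: wL|exact: uL|exact: basis_L2 onb i].
apply/eqP; rewrite subr_eq0; apply/eqP.
exact: (wsolution_unique T0 iq (lam_gt0 i) (L1_coef onb T0 lam_gt0 i fp Vf)
  (solution_wsolution fp Vf sw i) (solution_wsolution fp Vf su i) tT).
Qed.

Section estimates.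
Variables (C : R) (C0 : 0 <= C).
Hypothesis est : @coefficient_estimate R T q (lam 0%N) C.

(** The common factor 5 counts time derivatives; 15 is 5 times the 3 of [data_size_bound], and 10 is
    5 times the 2 of the forcing term in [solution_deriv_bound]. The constant of the theorem is
    twice this one because the regularity estimates bound a sum of two norms. *)
Definition stability_constant : R := Num.sqrt (15 * (W * C) + 10 * W).
Notation S := stability_constant.

Lemma weight_bound_ge1 : 1 <= W.
Proof. by rewrite exprn_ege1// lerDl invr_ge0 ltW. Qed.

Lemma stability_constant_gt0 : 0 < S.
Proof.
have W1 := weight_bound_ge1; have W0 : 0 <= W := le_trans ler01 W1.
rewrite sqrtr_gt0; have := mulr_ge0 W0 C0.
by move: W W1 (W * C) => w w1 x x0; lra.
Qed.

Lemma sqrt_stability (e r : R) : 0 <= e -> 0 <= r ->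
  Num.sqrt (5 * (W * C * (3 * e ^+ 2) + 2 * W * r ^+ 2)) <= S * (e + r).
Proof.
have W1 := weight_bound_ge1; have W0 : 0 <= W := le_trans ler01 W1 => e0 r0.
have er0 : 0 <= e + r by exact: addr_ge0.
rewrite -(ger0_norm er0) -(sqrtr_sqr (e + r)) /S.
have WC0 := mulr_ge0 W0 C0.
have K0 : 0 <= 15 * (W * C) + 10 * W.
  by move: W W1 (W * C) WC0 => w w1 x x0; lra.
rewrite -sqrtrM//; apply: ler_wsqrtr.
have := mulr_ge0 e0 r0; have := sqr_ge0 e; have := sqr_ge0 r.
move: (W) W0 WC0 => w w0 x0 h1 h2 h3.
rewrite sqrrD; have := mulr_ge0 x0 h1; have := mulr_ge0 w0 h2.
have := mulr_ge0 x0 h3; have := mulr_ge0 w0 h3.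
by move: C (e ^+ 2) (r ^+ 2) (e * r) => x a b c; lra.
Qed.

Lemma data_bound n u0 v0 f : H n.+1%:R u0 -> H n%:R v0 -> L2X (NH n%:R) f ->
  exists x y z, [/\ [/\ 0 <= x, 0 <= y & 0 <= z],
    [/\ NH n.+1%:R u0 = x%:E, NH n%:R v0 = y%:E & L2X_norm T (NH n%:R) f = z%:E],
    L2_path f, (V 0 (coef f) < +oo)%E &
    (E n (@data_size R d Omega phi lam T u0 v0 f) <= (3 * (x + y + z) ^+ 2)%:E)%E].
Proof.
move=> /(checkH_norm_real lam_gt0)[x [x0 xE xV]] /(checkH_norm_real lam_gt0)[y [y0 yE yV]] fX.
have [z [z0 zE zV]] := L2X_norm_real onb lam_gt0 fX.
have [fp Vf] := (L2X_NHP T onb lam_gt0 n f).1 fX.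
have V0f := finite_coef_norm2 lam_gt0 lam_ge (leq0n n) Vf.
exists x, y, z; split => //.
exact: (data_size_bound lam_gt0 x0 y0 z0 fp V0f xV yV zV).
Qed.

Lemma well_posed_H1 u0 v0 f : L2X N f -> H 1 u0 -> L2 v0 ->
  exists u, [/\ sol u0 v0 f u, HmX 1%N N u,
    (forall w, sol u0 v0 f w -> HmX 1%N N w -> forall t : R, t \in `[0, T] ->
      {ae lebesgue_rV R d, forall x, Omega x -> w t x = u t x}) &
    (HmX_norm 1%N N u <= (2 * S)%:E * (NH 1%R u0 + N v0 + L2X_norm T N f))%E].
Proof.
move=> fX u0H v0L; have fX0 := (L2X_L2 T onb lam_gt0 f).1 fX.
have v0H : H 0%:R v0.
  by split => //; rewrite (checkH_norm0 onb lam_gt0)// L2_normE// ltry.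
have [x [y [z [[x0 y0 z0] [xE yE zE] fp Vf Ee]]]] := data_bound (n := 0) u0H v0H fX0.
have xyz0 : 0 <= x + y + z by rewrite !addr_ge0.
have [u [Y [up uY]]] := path_solution_exists onb T0 lam_gt0 lam_ge iq C0 est fp Vf Ee.
have uS := wsolution_solution fp Vf uY.
have e0 : 0 <= 3 * (x + y + z) ^+ 2 by rewrite mulr_ge0// sqr_ge0.
(* For [m = 1] the placeholders [F1] and [F2] are not read; [r] is written [0 ^+ 2] to fit
   [sqrt_stability]. *)
have [|//|] := solution_HmX onb T0 lam_gt0 lam_ge mq iq C0 est fp Vf up uY
  (F1 := fun=> cst 0) (F2 := fun=> cst 0) (p := 0) (n := 0) (m := 1) (r := 0 ^+ 2)
  isT isT isT e0 (sqr_ge0 0) Ee => // uX uN.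
exists u; split => //.
- exact/(HmX_L2 T onb lam_gt0).
- move=> w ws wX t tT; have wp := HmX_path (m := 1) (n := 0) ((HmX_L2 T onb lam_gt0 1%N w).1 wX).
  exact: solution_unique fp Vf up wp uS ws t tT.
- rewrite (HmX_norm_L2 T onb lam_gt0); apply: le_trans uN _.
  rewrite -(checkH_norm0 onb lam_gt0 v0L) (L2X_norm_L2 onb lam_gt0); last by case: fX.
  rewrite xE yE zE -[leRHS]/(2 * S * (x + y + z))%:E lee_fin.
  apply: le_trans (sqrt_stability xyz0 (lexx 0)) _.
  by rewrite addr0 -mulrA ler_peMl ?ler1n// mulr_ge0// ltW// stability_constant_gt0.
Qed.

Lemma regularity_H2 u0 v0 f u : L2X (NH 1) f -> H 2 u0 -> H 1 v0 ->
  sol u0 v0 f u -> HmX 1%N N u ->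
  [/\ HmX 2%N N u, L2X (NH 2) u &
    (HmX_norm 2%N N u + L2X_norm T (NH 2%R) u <=
     (2 * S)%:E * (NH 2%R u0 + NH 1%R v0 + HmX_norm 1%N N f + L2X_norm T (NH 1%R) f))%E].
Proof.
move=> fX u0H v0H uS /(HmX_L2 T onb lam_gt0) uX1.
have up := HmX_path (m := 1) (n := 0) uX1.
have [x [y [z [[x0 y0 z0] [xE yE zE] fp Vf Ee]]]] := data_bound (n := 1) u0H v0H fX.
have uY := solution_wsolution fp Vf uS.
have xyz0 : 0 <= x + y + z by rewrite !addr_ge0.
have e0 : 0 <= 3 * (x + y + z) ^+ 2 by rewrite mulr_ge0// sqr_ge0.
have [uX uN] := solution_HmX onb T0 lam_gt0 lam_ge mq iq C0 est fp Vf up uY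
  (F1 := fun=> cst 0) (F2 := fun=> cst 0) (p := 1) (n := 0) (m := 2) (r := 0 ^+ 2)
  isT isT isT e0 (sqr_ge0 0) Ee (fun h => False_ind _ (notF h)) (fun h => False_ind _ (notF h)).
have [uX2 uN2] := solution_L2X onb lam_gt0 lam_ge C0 est fp Vf up uY (n := 2) (p := 1) isT isT e0 Ee.
split => //; first exact/(HmX_L2 T onb lam_gt0).
apply: le_trans (_ : (2 * S * (x + y + z))%:E <= _)%E.
  rewrite !(HmX_norm_L2 T onb lam_gt0).
  apply: le_trans (leeD uN uN2) _; rewrite -EFinD lee_fin.
  have b1 := sqrt_stability xyz0 (lexx 0).
  have b2 : Num.sqrt (5 * (W * C * (3 * (x + y + z) ^+ 2))) <= S * (x + y + z + 0).
    by apply: le_trans b1; rewrite expr0n/= mulr0 addr0.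
  by apply: le_trans (lerD b1 b2) _; rewrite addr0 -mulrA mulr_natl mulr2n.
rewrite !(HmX_norm_L2 T onb lam_gt0) xE yE zE.
apply: (@le_HmX_norm _ _ _ _ _ _ onb lam_gt0 1 0 f _ (2 * S) (x + y) z).
  by rewrite mulr_gt0// stability_constant_gt0.
move=> D r _ r0 _; rewrite lee_fin ler_wpM2l ?mulr_ge0 ?(ltW stability_constant_gt0)//.
by rewrite lerD2r lerDl.
Qed.

(** Two uses of [solution_HmX] with [p = s.+1] exhaust the budget [n + m = p.+1]: [s.+2] time
    derivatives at order 0 in space, and [s] of them at order 2. The first involves [s] derivatives
    of [f]; the second, with [s <= 2], stops before they appear. *)
Lemma regularity_HmX s u0 v0 f u : (0 < s <= 2)%N ->
  HmX s (NH s%:R) f -> L2X (NH s.+1%:R) f -> H s.+2%:R u0 -> H s.+1%:R v0 ->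
  sol u0 v0 f u -> HmX 1%N N u ->
  [/\ HmX s.+2 N u, HmX s (NH 2%:R) u &
    (HmX_norm s.+2 N u + HmX_norm s (NH 2%:R) u <=
     (2 * S)%:E * (NH s.+2%:R u0 + NH s.+1%:R v0 + HmX_norm s (NH s%:R) f
       + L2X_norm T (NH s.+1%:R) f))%E].
Proof.
move=> /andP[s0 s2] fXs fX u0H v0H uS /(HmX_L2 T onb lam_gt0) uX1.
have up := HmX_path (m := 1) (n := 0) uX1.
have [x [y [z [[x0 y0 z0] [xE yE zE] fp Vf Ee]]]] := data_bound u0H v0H fX.
have uY := solution_wsolution fp Vf uS.
have xyz0 : 0 <= x + y + z by rewrite !addr_ge0.
have e0 : 0 <= 3 * (x + y + z) ^+ 2 by rewrite mulr_ge0// sqr_ge0.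
have W0 : (0 <= W%:E)%E by rewrite lee_fin (le_trans ler01 weight_bound_ge1).
(* Stated for an arbitrary family [D] of derivatives of [f]: one family proves the membership of
   [u], all of them give the bound by the infimum. *)
have key D r : Hm_derivatives Omega T s (NH s%:R) f D -> 0 <= r ->
    (forall j, (j <= s)%N -> (V s (coef (D j)) <= (r ^+ 2)%:E)%E) ->
    [/\ HmX s.+2 (NH 0) u, HmX s (NH 2%:R) u &
    (HmX_norm s.+2 (NH 0) u + HmX_norm s (NH 2%:R) u <= (2 * S * (x + y + r + z))%:E)%E].
  move=> [D0 DX wD] r0 Dr.
  have FP j : (j < s)%N -> (V 0 (coef (D j.+1)) <= (W * r ^+ 2)%:E)%E /\
      forall i, L1 T (coef (D j.+1) i) /\ weak_derivative1 T (coef (D j) i) (coef (D j.+1) i).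
    move=> js; have [Djp DjV] := (L2X_NHP T onb lam_gt0 s (D j.+1)).1 (DX j.+1 js).
    have VDj := finite_coef_norm2 lam_gt0 lam_ge (leq0n s) DjV.
    split=> [|i]; last first.
      split; first exact (L1_coef onb T0 lam_gt0 i Djp VDj).
      exact (weak_derivative_coefs onb i (wD j js)).
    have s4 : (0 <= s <= 4)%N by rewrite (leq_trans s2).
    apply: le_trans (coef_norm2_weight_bound T lam_gt0 lam_ge (m := 0) _ s4) _.
    by rewrite [leRHS]EFinM; exact (lee_wpmul2l W0 (Dr j.+1 js)).
  have F1P := FP 0%N s0; rewrite D0 in F1P.
  have s24 : (s.+2 <= 4)%N by rewrite !ltnS.
  have s13 : (s.+1 <= 3)%N by rewrite ltnS.
  (* [3 < s.+2] is convertible to [1 < s], so [D 2] is read only when it is a derivative of [f],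
     that is for [s = 2]. *)
  have [uX uN] := solution_HmX onb T0 lam_gt0 lam_ge mq iq C0 est fp Vf up uY
    (F1 := coef (D 1%N)) (F2 := coef (D 2%N)) (p := s.+1) (n := 0) (m := s.+2)
    (r := r ^+ 2) s24 (leqnn _) s13 e0 (sqr_ge0 r) Ee (fun=> F1P) (FP 1%N).
  have s2F j : (2 <= j < s)%N -> False by move=> /andP[j2 /(leq_ltn_trans j2)]; rewrite ltnNge s2.
  have [uX2 uN2] := solution_HmX onb T0 lam_gt0 lam_ge mq iq C0 est fp Vf up uY
    (F1 := fun=> cst 0) (F2 := fun=> cst 0) (p := s.+1) (n := 2) (m := s) (r := r ^+ 2)
    (leq_trans s2 (isT : (2 <= 4)%N)) (leqnn _) s13 e0 (sqr_ge0 r) Ee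
    (fun h => False_ind _ (s2F 2%N h)) (fun h => False_ind _ (s2F 3%N h)).
  split; [exact: uX|exact: uX2|].
  apply: le_trans (leeD uN uN2) _; rewrite -EFinD lee_fin.
  have b := sqrt_stability xyz0 r0; apply: le_trans (lerD b b) _.
  by rewrite -[leLHS]mulr2n -[leLHS]mulr_natl [leLHS]mulrA (addrAC _ r z).
rewrite !(HmX_norm_L2 T onb lam_gt0).
have [D HD] := fXs; have [r [r0 _ Dr]] := Hm_derivatives_real onb lam_gt0 HD.
have [uX uX2 _] := key D r HD r0 Dr.
split; [exact/(HmX_L2 T onb lam_gt0)|exact: uX2|].
rewrite xE yE zE.
apply: (@le_HmX_norm _ _ _ _ _ _ onb lam_gt0 s s f _ (2 * S) (x + y) z).
  by rewrite mulr_gt0// stability_constant_gt0.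
by move=> D' r' HD' r'0 Dr'; have [_ _] := key D' r' HD' r'0 Dr'.
Qed.

End estimates.
End well_posedness.

Theorem theorem2p3 (R : realType) (d : nat) (d13 : (1 <= d <= 3)%N)
  (Omega : set 'rV[R]_d) (domOmega : admissible_domain Omega)
  (K T : R) (K_gt0 : 0 < K) (T_gt0 : 0 < T)
  (lam : nat -> R) (phi : nat -> 'rV[R]_d -> R)
  (eig : dirichlet_eigensystem Omega K lam phi)
  (alpha : R -> R) (alphastar Qstar : R)
  (alphastar_lt1 : alphastar < 1)
  (alpha_bound : forall t : R, t \in `[0, T] -> 0 <= alpha t <= alphastar)
  (alpha_derivable : derivable_on `[0, T] alpha)
  (alpha_derivable2 : derivable_on `[0, T] (deriv_on `[0, T] alpha))
  (alpha'_bound : forall t : R, t \in `[0, T] -> `|deriv_on `[0, T] alpha t| <= Qstar)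
  (alpha''_bound : forall t : R, t \in `[0, T] ->
    `|deriv_on `[0, T] (deriv_on `[0, T] alpha) t| <= Qstar)
  (alpha0 : alpha 0 = 0) (alpha'0 : deriv_on `[0, T] alpha 0 = 0) :
  let N := L2_norm Omega in
  let H := checkH Omega lam phi in
  let NH := checkH_norm Omega lam phi in
  let L2X := L2X Omega T in
  let L2X_norm := @L2X_norm R d T in
  let HmX := HmX Omega T in
  let HmX_norm := HmX_norm Omega T in
  let sol := solution Omega T (memory_kernel alpha T) lam phi in
  exists Q : R, 0 < Q /\
    forall (u0 v0 : 'rV[R]_d -> R) (f : R -> 'rV[R]_d -> R),
    [/\ (L2X N f -> H 1 u0 -> L2 Omega v0 ->
          exists u : R -> 'rV[R]_d -> R,
          [/\ sol u0 v0 f u, HmX 1%N N u,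
              (forall w, sol u0 v0 f w -> HmX 1%N N w ->
                forall t : R, t \in `[0, T] ->
                {ae lebesgue_rV R d, forall x, Omega x -> w t x = u t x}) &
              (HmX_norm 1%N N u <= Q%:E * (NH 1%R u0 + N v0 + L2X_norm N f))%E]),
        (HmX 1%N N f -> L2X (NH 1) f -> H 2 u0 -> H 1 v0 ->
          forall u, sol u0 v0 f u -> HmX 1%N N u ->
          [/\ HmX 2%N N u, L2X (NH 2) u &
              (HmX_norm 2%N N u + L2X_norm (NH 2%R) u <=
               Q%:E * (NH 2%R u0 + NH 1%R v0 + HmX_norm 1%N N f
                       + L2X_norm (NH 1%R) f))%E]),
        (HmX 1%N (NH 1) f -> L2X (NH 2) f -> H 3 u0 -> H 2 v0 ->
          forall u, sol u0 v0 f u -> HmX 1%N N u ->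
          [/\ HmX 3%N N u, HmX 1%N (NH 2) u &
              (HmX_norm 3%N N u + HmX_norm 1%N (NH 2%R) u <=
               Q%:E * (NH 3%R u0 + NH 2%R v0 + HmX_norm 1%N (NH 1%R) f
                       + L2X_norm (NH 2%R) f))%E]) &
        (HmX 2%N (NH 2) f -> L2X (NH 3) f -> H 4 u0 -> H 3 v0 ->
          forall u, sol u0 v0 f u -> HmX 1%N N u ->
          [/\ HmX 4%N N u, HmX 2%N (NH 2) u &
              (HmX_norm 4%N N u + HmX_norm 2%N (NH 2%R) u <=
               Q%:E * (NH 4%R u0 + NH 3%R v0 + HmX_norm 2%N (NH 2%R) f
                       + L2X_norm (NH 3%R) f))%E])].
Proof.
move=> N H NH L2X L2X_norm HmX HmX_norm sol.
have [lam_gt0 lam_mono _ onb] := eig.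
have lam_ge i : lam 0%N <= lam i by rewrite -ler_sqr ?nnegrE ?(ltW (lam_gt0 _))//; exact: lam_mono.
have [q [mq iq iq2 kq]] := memory_kernel_primitive T_gt0 alphastar_lt1 alpha_bound
  alpha_derivable alpha_derivable2 alpha''_bound alpha0 alpha'0.
have [C C0 est] := coefficient_estimates T_gt0 mq iq iq2 (lam_gt0 0%N).
exists (2 * stability_constant lam C); split.
  by rewrite mulr_gt0// stability_constant_gt0.
move=> u0 v0 f; split.
- exact (@well_posed_H1 _ _ _ _ _ _ _ _ onb T_gt0 lam_gt0 lam_ge mq iq kq C C0 est u0 v0 f).
- by move=> _ fX u0H v0H u; exact (regularity_H2 onb T_gt0 lam_gt0 lam_ge mq iq kq C0 est fX u0H v0H).
- by move=> fX1 fX u0H v0H u; exact (@regularity_HmX _ _ _ _ _ _ _ _ onb T_gt0 lam_gt0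
    lam_ge mq iq kq C C0 est 1 u0 v0 f u isT fX1 fX u0H v0H).
- by move=> fX2 fX u0H v0H u; exact (@regularity_HmX _ _ _ _ _ _ _ _ onb T_gt0 lam_gt0
    lam_ge mq iq kq C C0 est 2 u0 v0 f u isT fX2 fX u0H v0H).
Qed.
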